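(* Let $q\ge 2$ be an integer, let $X$ be a $q$-homogeneous tree with origin $o$, let $\alpha>1$, and let $L^p_\alpha$, $H^1_\alpha$, ${\rm BMO}_\alpha$ and the complex interpolation spaces $(A_0,A_1)_{[\theta]}$ be as defined in the context. Let $\theta\in(0,1)$ and let $p$ be given by $\frac1p=1-\theta$. Then: (i) $(L^1_\alpha,{\rm BMO}_\alpha)_{[\theta]}=L^p_\alpha$; (ii) $(H^1_\alpha,L^\infty_\alpha)_{[\theta]}=L^p_\alpha$; (iii) $(H^1_\alpha,{\rm BMO}_\alpha)_{[\theta]}=L^p_\alpha$. Equality of spaces is understood as equality of vector spaces with equivalent norms.
   Context: Tree. $X$ is a $q$-homogeneous tree ($q\ge2$): a connected, loop-free graph in which every vertex has exactly $q+1$ neighbours; $X$ also denotes its set of vertices, and $d$ is the graph distance. Fix an origin $o\in X$ and put $|x|=d(o,x)$. For $x\ne o$, the predecessor $p(x)$ is the unique neighbour of $x$ with $|p(x)|=|x|-1$. The sector of $x\in X$ is $T_x=\{y\in X: p^\ell(y)=x\text{ for some integer }\ell\ge0\}$ (so $x\in T_x$ and $T_o=X$). Measure. For $\alpha>1$, $\mu_\alpha$ is the (finite) measure on $X$ with $\mu_\alpha(\{x\})=q^{-\alpha|x|}$, and $L^p_\alpha=L^p(X,\mu_\alpha)$ with norm $\|\cdot\|_{p,\alpha}$ (complex-valued functions). Dyadic sets. $\mathcal D=\{\{v\}: v\in X\}\cup\{T_v: v\in X\}$. For a function $f$ and $D\in\mathcal D$, $f_D=\frac1{\mu_\alpha(D)}\sum_{x\in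 D}f(x)q^{-\alpha|x|}$. Hardy space. A $(1,\infty)$-atom is a function $a$ on $X$ such that either $a$ is the constant function $\mu_\alpha(X)^{-1}$, or there is $D\in\mathcal D$ such that $a$ is supported in $D$, $\|a\|_{\infty,\alpha}\le\mu_\alpha(D)^{-1}$, and $\sum_{x\in D}a(x)q^{-\alpha|x|}=0$. $H^1_\alpha$ is the space of $g\in L^1_\alpha$ of the form $g=\sum_j\lambda_ja_j$ with $a_j$ $(1,\infty)$-atoms and $(\lambda_j)$ a summable sequence of complex numbers; $\|g\|_{H^1_\alpha}$ is the infimum of $\sum_j|\lambda_j|$ over all such representations. BMO. ${\rm BMO}_\alpha$ is the space of functions $f:X\to\mathbb C$ with $f\in L^1_\alpha$ and $$\|f\|_{{\rm BMO}_\alpha}=\sup_{D\in\mathcal D}\frac1{\mu_\alpha(D)}\sum_{x\in D}|f(x)-f_D|q^{-\alpha|x|}+\Big|\sum_{x\in X}f(x)q^{-\alpha|x|}\Big|<\infty .$$ Complex interpolation. All the spaces involved are spaces of functions on $X$, and sums $A_0+A_1$ are taken there. Let $\Sigma=\{z\in\mathbb C:0<\Re z<1\}$, with closure $\overline\Sigma$. $\mathcal F(A_0,A_1)$ is the space of functions $F:\overline\Sigma\to A_0+A_1$ such that: for every $\ell\in(A_0+A_1)^*$ the function $z\mapsto\langle F(z),\ell\rangle$ is continuous and bounded on $\overline\Sigma$ and analytic on $\Sigma$; $F(it)\in A_0$ and $F(1+it)\in A_1$ for all $t\in\mathbb R$, with $\|F\|_{\mathcal F}=\sup_{t\in\mathbb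 R}\max(\|F(it)\|_{A_0},\|F(1+it)\|_{A_1})<\infty$. Then $(A_0,A_1)_{[\theta]}=\{F(\theta):F\in\mathcal F(A_0,A_1)\}$, with norm $\|f\|_{[\theta]}=\inf\{\|F\|_{\mathcal F}:F\in\mathcal F(A_0,A_1),\,F(\theta)=f\}$. *)

(* Defs.v *)
From HB Require Import structures.
From mathcomp Require Import all_boot all_order all_algebra.
From mathcomp Require Import complex.
From mathcomp Require Import all_classical all_reals all_analysis.

Set Implicit Arguments.
Unset Strict Implicit.
Unset Printing Implicit Defensive.

Import Order.TTheory GRing.Theory Num.Theory.
Import numFieldNormedType.Exports.
Import ComplexField.Normc.

Local Open Scope classical_set_scope.
Local Open Scope complex_scope.
Local Open Scope ring_scope.

(** [R[i]] itself carries no topology in the libraries; its regular module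
    [R[i]^o] is a normed module over it.  The modulus, as an element of [R],
    is [normc]. *)
Notation Cplx R := ((R[i])^o).

Section Tree.
Context {V : choiceType} (adj : rel V).

(** "Loop-free" means without cycles: a cyclic walk with pairwise distinct
    vertices has length at most 2 (length 2 being a back-and-forth along one
    edge). *)
Record homogeneous_tree (q : nat) : Prop := HomogeneousTree {
  adj_sym : symmetric adj ;
  adj_irr : irreflexive adj ;
  adj_connected : forall x y, exists2 s, path adj x s & last x s = y ;
  adj_acyclic : forall c, ucycle adj c -> (size c <= 2)%N ;
  adj_degree : forall x, ([set y | adj x y] #= `I_q.+1)%card
}.

Definition walk (x y : V) (n : nat) : Prop :=
  exists2 s, path adj x s & last x s = y /\ size s = n.

Definition gdist (x y : V) : nat :=
  xget 0%N [set n | walk x y n /\ forall m, walk x y m -> (n <= m)%N].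

(** At the origin, where no predecessor exists, the value is the default [o];
    this adds nothing to the sectors below, as [o] is already in the orbit. *)
Definition predecessor (o x : V) : V :=
  xget o [set y | adj x y /\ (gdist o y).+1 = gdist o x].

Definition sector (o x : V) : set V :=
  [set y | exists l, iter l (predecessor o) y = x].

Definition dyadic (o : V) : set (set V) :=
  [set D | exists v, D = [set v] \/ D = sector o v].

End Tree.

(** The vertex set, pointed at the origin, with the discrete sigma-algebra. *)
Definition rooted {V : choiceType} (o : V) : Type := V.

Section Rooted.
Context {V : choiceType} (o : V).

HB.instance Definition _ := Choice.on (rooted o).
HB.instance Definition _ := isPointed.Build (rooted o) o.
HB.instance Definition _ := @isMeasurable.Build default_measure_display
  (rooted o) discrete_measurable discrete_measurable0
  discrete_measurableC discrete_measurableU.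

End Rooted.

Section Measure.
Context {R : realType} {V : choiceType} (adj : rel V) (o : V) (q : nat).
Variable alpha : R.
Local Open Scope ereal_scope.

Definition weight (x : rooted o) : R :=
  (q%:R `^ (- (alpha * (gdist adj o x)%:R)))%R.

Definition mu_alpha (D : set (rooted o)) : \bar R :=
  \esum_(x in D) (weight x)%:E.

Let mu_alpha0 : mu_alpha set0 = 0. Proof. exact: esum_set0. Qed.

Let mu_alpha_ge0 D : 0 <= mu_alpha D.
Proof. by apply: esum_ge0 => x _; rewrite lee_fin powR_ge0. Qed.

Let mu_alpha_sigma_additive : semi_sigma_additive mu_alpha.
Proof.
move=> F mF tF mUF; rewrite /mu_alpha nneseries_sum_bigcup//.
  apply: is_cvg_nneseries => n _ _.
  by apply: esum_ge0 => x _; rewrite lee_fin powR_ge0.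
by move=> x; rewrite lee_fin powR_ge0.
Qed.

HB.instance Definition _ := isMeasure.Build _ _ _ mu_alpha
  mu_alpha0 mu_alpha_ge0 mu_alpha_sigma_additive.

End Measure.

(** A space of complex functions on [X] together with a norm, which is only
    meaningful on [fcarrier]; it is extended-real valued so that infima and
    suprema need no side condition. *)
Record fspace (R : realType) (X : Type) := FSpace {
  fcarrier : set (X -> Cplx R) ;
  fnorm : (X -> Cplx R) -> \bar R
}.

Definition equiv_fspace {R : realType} {X : Type} (A B : fspace R X) : Prop :=
  fcarrier A = fcarrier B /\
  exists c1 c2 : R, [/\ 0 < c1, 0 < c2 &
    forall f, fcarrier A f ->
      (c1%:E * fnorm A f <= fnorm B f <= c2%:E * fnorm A f)%E].

Section Spaces.
Context {R : realType} {V : choiceType} (adj : rel V) (o : V) (q : nat).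
Variable alpha : R.
Local Notation X := (rooted o).
Local Notation C := (Cplx R).
Local Notation mu := (@mu_alpha R V adj o q alpha).

Definition Lp_norm (p : \bar R) (f : X -> C) : \bar R :=
  Lnorm mu p (fun x => (normc (f x))%:E).

Definition Lp_space (p : \bar R) : fspace R X :=
  FSpace [set f | (Lp_norm p f < +oo)%E] (Lp_norm p).

(** The sum over [D] of [f x * q ^ (- alpha * |x|)], for [f] in [L^1]. *)
Definition wsum (D : set X) (f : X -> C) : C :=
  (\int[mu]_(x in D) complex.Re (f x)) +i* (\int[mu]_(x in D) complex.Im (f x)).

Definition average (D : set X) (f : X -> C) : C :=
  ((fine (mu D))^-1)%:C * wsum D f.

Definition atom (a : X -> C) : Prop :=
  a = (fun=> ((fine (mu setT))^-1)%:C) \/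
  exists D : set X, [/\ dyadic adj o D,
    forall x, ~ D x -> a x = 0,
    (Lp_norm +oo a <= ((fine (mu D))^-1)%:E)%E &
    wsum D a = 0].

(** The series of atoms converges in [L^1]. *)
Definition atomic_decomposition
    (g : X -> C) (lam : nat -> C) (a : nat -> X -> C) : Prop :=
  [/\ forall j, atom (a j),
      (\sum_(0 <= j <oo) (normc (lam j))%:E < +oo)%E &
      (fun n => Lp_norm 1 (fun x => g x - \sum_(j < n) lam j * a j x))
        @ \oo --> 0%E].

Definition H1_space : fspace R X := FSpace
  [set g | fcarrier (Lp_space 1) g /\
           exists lam a, atomic_decomposition g lam a]
  (fun g => ereal_inf
    [set s | exists lam a, atomic_decomposition g lam a /\
             s = (\sum_(0 <= j <oo) (normc (lam j))%:E)%E]).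

Definition oscillation (f : X -> C) (D : set X) : \bar R :=
  (((fine (mu D))^-1)%:E *
    \int[mu]_(x in D) (normc (f x - average D f))%:E)%E.

Definition BMO_norm (f : X -> C) : \bar R :=
  (ereal_sup [set oscillation f D | D in dyadic adj o] +
    (normc (wsum setT f))%:E)%E.

Definition BMO_space : fspace R X := FSpace
  [set f | fcarrier (Lp_space 1) f /\ (BMO_norm f < +oo)%E] BMO_norm.

End Spaces.

Section Interpolation.
Context {R : realType} {X : Type}.
Local Notation C := (Cplx R).
Implicit Types A : fspace R X.

Definition sum_fspace A0 A1 : fspace R X := FSpace
  [set f | exists f0 f1, [/\ fcarrier A0 f0, fcarrier A1 f1 & f = f0 \+ f1]]
  (fun f => ereal_inf [set s | exists f0 f1,
    [/\ fcarrier A0 f0, fcarrier A1 f1, f = f0 \+ f1 &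
        s = (fnorm A0 f0 + fnorm A1 f1)%E]]).

(** Continuous linear functionals on [A], represented by maps on all functions
    of which only the restriction to [fcarrier A] matters. *)
Definition dual_fspace A : set ((X -> C) -> C) :=
  [set l | (forall (c : C) f g, fcarrier A f -> fcarrier A g ->
             l (fun x => c * f x + g x) = c * l f + l g) /\
           exists K : R, forall f, fcarrier A f ->
             ((normc (l f))%:E <= K%:E * fnorm A f)%E].

Definition strip : set C := [set z | 0 < complex.Re z < 1].

Definition analytic_at (h : C -> C) (z0 : C) : Prop :=
  exists (c : nat -> C) (r : R), 0 < r /\
    forall z, normc (z - z0) < r ->
      series (fun n => c n * (z - z0) ^+ n) @ \oo --> h z.

Definition calderon_norm A0 A1 (F : C -> X -> C) : \bar R :=
  ereal_sup (range (fun t : R =>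
    maxe (fnorm A0 (F (0 +i* t))) (fnorm A1 (F (1 +i* t))))).

(** Functions on the closed strip are represented by functions on the plane of
    which only the restriction to [closure strip] matters. *)
Definition calderon_space A0 A1 : set (C -> X -> C) :=
  [set F | [/\ forall z, closure strip z -> fcarrier (sum_fspace A0 A1) (F z),
      forall l, dual_fspace (sum_fspace A0 A1) l ->
        [/\ {within closure strip, continuous (fun z => l (F z))},
            exists M : R, forall z, closure strip z -> normc (l (F z)) <= M &
            forall z, strip z -> analytic_at (fun w => l (F w)) z],
      forall t : R, fcarrier A0 (F (0 +i* t)) /\ fcarrier A1 (F (1 +i* t)) &
      (calderon_norm A0 A1 F < +oo)%E]].

Definition complex_interpolation A0 A1 (theta : R) : fspace R X := FSpace
  [set f | exists2 F, calderon_space A0 A1 F & F theta%:C = f]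
  (fun f => ereal_inf [set calderon_norm A0 A1 F | F in
    [set F | calderon_space A0 A1 F /\ F theta%:C = f]]).

End Interpolation.

(* Main.v *)
(** It suffices that L^p embeds into (H^1, L^oo)_[theta] and (L^1, BMO)_[theta]
    into L^p, since H^1 embeds into L^1, L^oo into BMO, and complex
    interpolation is monotone.

    Both rest on one decomposition.  The sectors and points form a filtration
    by blocks whose measure drops by at most a factor K from one generation to
    the next.  With A = 4 K, let E_j be the set where some block average of |f|
    exceeds A^j.  Then f = c + sum_j b_j, where b_j lives on E_j, has mean zero
    on each stopping block, is at most C A^j, and vanishes on E_(j+2) (j >= 1):
    hence sum_j A^(-j) |b_j| is bounded pointwise, while the weak type estimate
    bounds sum_j A^(jp) mu(E_j).

    For the first embedding take F(z) = c + sum_j A^(j(p(1-z)-1)) b_j, which is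
    a Dirichlet series when tested against functionals.  For the second, pair
    F with G(z) = c + sum_j A^(j(z/theta-1)) b_j built from a bounded function h
    in the dual Lebesgue space: the pairing is controlled by L^1-L^oo on Re z = 0
    and by BMO against atoms on Re z = 1, and the maximum principle on the strip
    bounds the integral of F(theta) h. *)

From HB Require Import structures.
From mathcomp Require Import all_boot all_order all_algebra.
From mathcomp Require Import complex.
From mathcomp Require Import all_classical all_reals all_analysis.
From mathcomp Require Import ess_sup_inf ring lra zify.
Require Import Defs.

Set Implicit Arguments.
Unset Strict Implicit.
Unset Printing Implicit Defensive.

Import Order.TTheory GRing.Theory Num.Theory.
Import numFieldNormedType.Exports.
Import ComplexField.Normc.

Local Open Scope classical_set_scope.
Local Open Scope complex_scope.
Local Open Scope ring_scope.

(** * Complex analysis on the strip *)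

(** The endpoint [L^oo] shapes the decomposition. With block averages as good functions, [b_j] could
    be of size [A^j] on all of [E_(j+1)], and [sum_j A^(-j) |b_j|] would count the generations
    around a point, without bound. So the good function [g_j] is zero on [E_(j+1)], and the integral
    lost there is spread over the rest of each stopping block. The choice [A = 4 K] leaves three
    quarters of the block for this: the filling constants stay of size [A^j], and
    [b_j = g_(j+1) - g_j]. The factor of [b_j] in [F] has modulus [A^(j(p-1))] on [Re z = 0], where
    the atomic norms add up to the weak type sum, and [A^(-j)] on [Re z = 1]; it is 1 at [theta]. In
    [G] the edges are exchanged and [1/theta], the exponent conjugate to [p], replaces [p]. As [h]
    is bounded, [E_j] is empty for large [j], so [G] is a finite sum and its pairing with [F] is
    made of finitely many products of an exponential and a scalar function supplied by the weak
    analyticity of [F]. The maximum principle is drawn from the Laplacian of the squared modulus,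
    for which a second order Taylor expansion at each interior point is enough. *)

Section Modulus.
Context {R : realType}.
Implicit Types z w : Cplx R.

Lemma normc_ge0 z : 0 <= normc z.
Proof. by case: z => x y /=; exact: sqrtr_ge0. Qed.

Lemma normcD z w : normc (z + w) <= normc z + normc w.
Proof. exact: le_normcD. Qed.

Lemma normcB z w : normc (z - w) <= normc z + normc w.
Proof. by rewrite (le_trans (normcD _ _))// (normcN (w : Rcomplex R)). Qed.

Lemma normc_oppr z : normc (- z) = normc z.
Proof. exact: normcN. Qed.

Lemma normc_distC z w : normc (z - w) = normc (w - z).
Proof. by rewrite -normc_oppr opprB. Qed.

Lemma normc_sqr z : normc z ^+ 2 = complex.Re z ^+ 2 + complex.Im z ^+ 2.
Proof. by case: z => x y /=; rewrite sqr_sqrtr// addr_ge0// sqr_ge0. Qed.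

Lemma normcX z n : normc (z ^+ n) = normc z ^+ n.
Proof.
by elim: n => [|n ih]; rewrite ?expr0 ?normc1// !exprS normcM ih.
Qed.

Lemma normc_real (x : R) : normc x%:C = `|x|.
Proof. by rewrite /= expr0n addr0 sqrtr_sqr. Qed.

Lemma normc_Re z : `|complex.Re z| <= normc z.
Proof. by case: z => x y /=; rewrite -sqrtr_sqr ler_wsqrtr// lerDl sqr_ge0. Qed.

Lemma normc_Im z : `|complex.Im z| <= normc z.
Proof. by case: z => x y /=; rewrite -sqrtr_sqr ler_wsqrtr// lerDr sqr_ge0. Qed.

Lemma normc_ReIm z : normc z <= `|complex.Re z| + `|complex.Im z|.
Proof.
case: z => x y /=; rewrite -(@ler_pXn2r _ 2)// ?nnegrE ?sqrtr_ge0 ?addr_ge0//.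
rewrite sqr_sqrtr ?addr_ge0 ?sqr_ge0// sqrrD !real_normK ?num_real//.
by rewrite addrAC lerDl mulrn_wge0// mulr_ge0.
Qed.

Lemma normc_eq0 z : (normc z == 0) = (z == 0).
Proof.
by apply/eqP/eqP => [/eq0_normc//|->]; rewrite normc0.
Qed.

Lemma normc_sum (I : Type) (r : seq I) (P : pred I) (F : I -> Cplx R) :
  normc (\sum_(i <- r | P i) F i) <= \sum_(i <- r | P i) normc (F i).
Proof.
elim/big_rec2: _ => [|i y x _ h]; first by rewrite normc0.
by rewrite (le_trans (normcD _ _))// lerD2l.
Qed.

Lemma le_normcB z w : normc z - normc w <= normc (z - w).
Proof. by rewrite lerBlDr -{1}(subrK w z) normcD. Qed.

Lemma norm_normcB z w : `|normc z - normc w| <= normc (z - w).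
Proof.
rewrite ler_norml le_normcB andbT lerNl opprB (le_trans (le_normcB _ _))//.
by rewrite normc_distC.
Qed.

Lemma normc_conjc z : normc (conjc z) = normc z.
Proof. by case: z => x y /=; rewrite sqrrN. Qed.

Lemma mulcJ_normc z : conjc z * z = (normc z ^+ 2)%:C.
Proof.
case: z => x y; rewrite normc_sqr /=; apply/eqP; rewrite eq_complex /=.
by apply/andP; split; apply/eqP; ring.
Qed.

Lemma ReD z w : complex.Re (z + w) = complex.Re z + complex.Re w.
Proof. by case: z w => [? ?] [? ?]. Qed.

Lemma ImD z w : complex.Im (z + w) = complex.Im z + complex.Im w.
Proof. by case: z w => [? ?] [? ?]. Qed.

(** The norm of [R[i]^o] takes values in [R[i]], where a positive element is real; this reduces
    convergence there to that of a real modulus. *)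
Lemma cvg_normcP {T : Type} (F : set_system T) {FF : Filter F}
    (f : T -> Cplx R) (l : Cplx R) :
  f @ F --> l <-> (fun x => normc (f x - l)) @ F --> (0 : R).
Proof.
have E x : `|0 - normc (f x - l)| = normc (l - f x).
  by rewrite sub0r normrN (ger0_norm (normc_ge0 _)) normc_distC.
have N x : `|l - f x| = (normc (l - f x))%:C by [].
split=> h.
  apply/cvgrPdist_lt => e e0.
  have /cvgrPdist_lt/(_ e%:C) := h; rewrite ltcR => /(_ e0).
  by apply: filterS => x; rewrite N ltcR E.
apply/cvgrPdist_lt => e; case: e => e e'; rewrite ltcE /= => /andP[/eqP -> e0].
have /cvgrPdist_lt/(_ e e0) := h.
by apply: filterS => x; rewrite E N ltcR.
Qed.

End Modulus.

Section MaxPrinciple.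
Context {R : realType}.
Local Notation C := (Cplx R).
Implicit Types (h : C -> C) (z w : C).

(* All that the maximum principle needs from analyticity; unlike [analytic_at]
   it passes to sums and products without manipulating power series. *)
Definition taylor2 h z := exists c1 c2 : C, exists K r : R, 0 < r /\
  forall w, normc w < r ->
    normc (h (z + w) - (h z + c1 * w + c2 * w ^+ 2)) <= K * normc w ^+ 3.

Lemma within_continuous_normcP (A : set C) h :
  {within A, continuous h} <->
  forall z, A z -> forall e : R, 0 < e -> exists2 d : R, 0 < d &
    forall w, A w -> normc (w - z) < d -> normc (h w - h z) < e.
Proof.
have N z w : `|z - w| = (normc (z - w))%:C by [].
split=> [hc z Az e e0|hc].
  have /subspace_continuousP/(_ _ Az)/cvgrPdist_lt/(_ e%:C) := hc.
  rewrite ltcR => /(_ e0)/nbhs_ballP[d].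
  case: d => d d'; rewrite /= ltcE /= => /andP[/eqP -> d0] H.
  exists d => // w Aw wz; have /H : ball z d%:C w.
    by rewrite -ball_normE /ball_ /= N ltcR normc_distC.
  by move=> /(_ Aw); rewrite N ltcR normc_distC.
apply/subspace_continuousP => z Az; apply/cvgrPdist_lt => e.
case: e => e e'; rewrite ltcE /= => /andP[/eqP -> e0].
have [d d0 H] := hc _ Az _ e0.
apply/nbhs_ballP; exists d%:C; first by rewrite /= ltcR.
move=> w; rewrite -ball_normE /ball_ /= N ltcR normc_distC => wz Aw.
by rewrite N ltcR normc_distC; exact: H.
Qed.

Lemma closure_strip : closure (@strip R) = [set z | 0 <= complex.Re z <= 1].
Proof.
have N z w : `|z - w| = (normc (z - w))%:C by [].
apply/seteqP; split=> z.
  move=> zS; apply: contrapT => /negP; rewrite negb_and -!ltNge => z01.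
  (* Horizontal distance from [z] to the strip, positive when [z] lies outside the closed band. *)
  pose d := Num.max (- complex.Re z) (complex.Re z - 1).
  have d0 : 0 < d by rewrite lt_max oppr_gt0 subr_gt0.
  have : nbhs z (ball z d%:C).
    by apply: nbhsx_ballx; rewrite ltcR.
  move=> /zS[w []] /= /andP[w0 w1]; rewrite -ball_normE /ball_ /= N ltcR.
  move=> /(le_lt_trans (normc_Re _)).
  have -> : complex.Re (z - w) = complex.Re z - complex.Re w.
    by case: (z) (w) => [? ?] [? ?].
  rewrite lt_max !ltr_norml => /orP[/andP[h1 h2]|/andP[h1 h2]]; lra.
case: z => x y /= /andP[x0 x1] B /nbhs_ballP[d].
case: d => d d'; rewrite /= ltcE /= => /andP[/eqP -> d0] H.
(* The point is pushed by [s] towards the line of abscissa 1/2; with [s] at most 1/4 it cannot leave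
   the strip on the other side. *)
pose s := Num.min (d / 2) (1 / 4).
have s0 : 0 < s by rewrite lt_min !divr_gt0.
have sd : s <= d / 2 by rewrite ge_min lexx.
have s4 : s <= 1 / 4 by rewrite ge_min lexx orbT.
pose x' := if x <= 1 / 2 then x + s else x - s.
have E : `|x - x'| = s.
  rewrite /x'; case: ifP => _; last by rewrite opprB addrC subrK gtr0_norm.
  by rewrite opprD addrA subrr sub0r normrN gtr0_norm.
exists (x' +i* y); split.
  rewrite /strip /= /x'; case: (leP x (1 / 2)) => hx;
    by apply/andP; split; lra.
apply: H; rewrite -ball_normE /ball_ /= N ltcR.
have -> : (x +i* y - (x' +i* y) : C) = (x - x')%:C.
  by rewrite -[LHS]/((x - x') +i* (y - y)) subrr.
by rewrite normc_real E; lra.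
Qed.

(** Parseval over the fourth roots of unity: two exponents among 0, 1, 2 differ by less than 4, so
    all cross terms cancel. *)
Lemma four_point_sum (a b c : C) (t : R) :
  let P w := normc (a + b * w + c * w ^+ 2) ^+ 2 in
  P t%:C + P (- t)%:C + P (0 +i* t) + P (0 +i* - t) =
  4 * (normc a ^+ 2 + normc b ^+ 2 * t ^+ 2 + normc c ^+ 2 * t ^+ 4).
Proof.
cbv zeta; rewrite !normc_sqr; case: a b c => [a1 a2] [b1 b2] [c1 c2].
by rewrite !expr2 /=; ring.
Qed.

(* [quad] has Laplacian [- 2 * eps] and grows with the imaginary part, so
   [normc (h z) ^+ 2 - quad eps x y] is strictly subharmonic and small far away. *)
Let quad eps (x y : R) : R := eps * (y ^+ 2 - 2 * x ^+ 2 + 2).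

Let four_point_arith (H1 H2 H3 H4 P1 P2 P3 P4 a u v k e t x y : R) :
  H4 ^+ 2 - e * ((y - t) ^+ 2 - 2 * x ^+ 2 + 2) <=
    a ^+ 2 - e * (y ^+ 2 - 2 * x ^+ 2 + 2) ->
  H3 ^+ 2 - e * ((y + t) ^+ 2 - 2 * x ^+ 2 + 2) <=
    a ^+ 2 - e * (y ^+ 2 - 2 * x ^+ 2 + 2) ->
  H2 ^+ 2 - e * (y ^+ 2 - 2 * (x - t) ^+ 2 + 2) <=
    a ^+ 2 - e * (y ^+ 2 - 2 * x ^+ 2 + 2) ->
  H1 ^+ 2 - e * (y ^+ 2 - 2 * (x + t) ^+ 2 + 2) <=
    a ^+ 2 - e * (y ^+ 2 - 2 * x ^+ 2 + 2) ->
  P4 - k * t ^+ 3 <= H4 ^+ 2 -> P3 - k * t ^+ 3 <= H3 ^+ 2 ->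
  P2 - k * t ^+ 3 <= H2 ^+ 2 -> P1 - k * t ^+ 3 <= H1 ^+ 2 ->
  P1 + P2 + P3 + P4 = 4 * (a ^+ 2 + u + v) -> 0 <= u -> 0 <= v ->
  2 * e * t ^+ 2 <= 4 * k * t ^+ 3.
Proof. by move=> *; lra. Qed.

Let small_arith (e t k : R) : 0 < e -> 0 < t -> t * (4 * (k + 1)) <= e ->
  2 * e <= 4 * k * t -> False.
Proof. by move=> *; lra. Qed.

(** At a maximum, adding the inequalities at the four points [z + t], [z - t], [z + i t], [z - i t]
    gives [2 * eps * t ^+ 2 <= 4 * Cst * t ^+ 3]: the four-point mean of the squared quadratic part
    is at least [normc (h z) ^+ 2], while the four values of [quad] add up to [2 * eps * t ^+ 2]
    less than four times the central value. This fails for small [t]. *)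
Lemma taylor2_not_max h (z : C) (eps : R) : 0 < eps -> taylor2 h z ->
  ~ (exists2 d : R, 0 < d & forall w, normc w < d ->
    normc (h (z + w)) ^+ 2 -
      quad eps (complex.Re z + complex.Re w) (complex.Im z + complex.Im w) <=
    normc (h z) ^+ 2 - quad eps (complex.Re z) (complex.Im z)).
Proof.
move=> e0 [b [c [K [r [r0 H]]]]] [d d0 M].
set a := h z in H M *.
pose L := normc a + normc b + normc c.
pose K' := Num.max K 0.
have L0 : 0 <= L by rewrite !addr_ge0// normc_ge0.
have K0 : 0 <= K' by rewrite le_max lexx orbT.
(* With [u] the modulus of the Taylor polynomial and [v] that of the remainder,
   [normc (h (z + w)) ^+ 2] is at least [u ^+ 2 - 2 * u * v]; here [u <= L] as [t <= 1], and
   [v <= K' * t ^+ 3]. *)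
pose Cst := 2 * L * K'.
have Cst0 : 0 <= Cst by rewrite !mulr_ge0.
(* The last bound on [t] gives [4 * (Cst + 1) * t <= eps], against the inequality
   [eps <= 2 * Cst * t] that a maximum would force. *)
pose t := Num.min (Num.min (r / 2) (d / 2)) (Num.min 1 (eps / (4 * (Cst + 1)))).
have t0 : 0 < t.
  by rewrite !lt_min !divr_gt0 ?ltr01 ?mulr_gt0 ?ltr_wpDl.
have tr : t < r by apply: (@le_lt_trans _ _ (r / 2)); [rewrite !ge_min lexx|lra].
have td : t < d.
  by apply: (@le_lt_trans _ _ (d / 2)); [rewrite !ge_min lexx orbT|lra].
have t1 : t <= 1 by rewrite !ge_min lexx !orbT.
have te : t <= eps / (4 * (Cst + 1)) by rewrite !ge_min lexx !orbT.
have key w : normc w = t ->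
    normc (a + b * w + c * w ^+ 2) ^+ 2 - Cst * t ^+ 3 <= normc (h (z + w)) ^+ 2.
  move=> wt; set P := a + b * w + c * w ^+ 2.
  have Hw : normc (h (z + w) - P) <= K' * t ^+ 3.
    rewrite -wt (le_trans (H _ _)) ?wt//.
    by rewrite ler_wpM2r ?exprn_ge0 ?(ltW t0)// le_max lexx.
  have PL : normc P <= L.
    rewrite (le_trans (normcD _ _))// lerD//.
      rewrite (le_trans (normcD _ _))// lerD// normcM wt.
      by rewrite ler_piMr ?normc_ge0.
    by rewrite normcM normcX wt ler_piMr ?normc_ge0// exprn_ile1 ?(ltW t0).
  have PD : normc P - normc (h (z + w) - P) <= normc (h (z + w)).
    rewrite lerBlDr -[in leLHS](subKr (h (z + w)) P).
    by rewrite normcB.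
  have DP : normc (h (z + w) - P) - normc P <= normc (h (z + w)).
    by rewrite lerBlDr normcB.
  set u := normc P in PL PD DP *; set v := normc (h (z + w) - P) in Hw PD DP *.
  set H0 := normc (h (z + w)) in PD DP *.
  have u0 : 0 <= u by exact: normc_ge0.
  have v0 : 0 <= v by exact: normc_ge0.
  have H00 : 0 <= H0 by exact: normc_ge0.
  have uv : 2 * u * v <= Cst * t ^+ 3.
    by rewrite /Cst -(mulrA (2 * L)) ler_pM// ?mulr_ge0// ler_wpM2l.
  have sq : (u - v) ^+ 2 <= H0 ^+ 2.
    by rewrite -[leLHS]real_normK ?num_real// lerXn2r ?nnegrE// ler_norml lerNl opprB PD DP.
  have : u ^+ 2 - 2 * u * v <= (u - v) ^+ 2.
    by rewrite sqrrB mulr2n -subr_ge0; have := sqr_ge0 v; nra.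
  by move=> A; lra.
have n1 : normc (t%:C : C) = t by rewrite normc_real gtr0_norm.
have n2 : normc ((- t)%:C : C) = t by rewrite normc_real normrN gtr0_norm.
have n3 : normc (0 +i* t : C) = t by rewrite /= expr0n add0r sqrtr_sqr gtr0_norm.
have n4 : normc (0 +i* - t : C) = t.
  by rewrite /= expr0n add0r sqrtr_sqr normrN gtr0_norm.
have fp := four_point_sum a b c t.
have := key _ n1; have := key _ n2; have := key _ n3; have := key _ n4.
have := M t%:C; have := M (- t)%:C; have := M (0 +i* t); have := M (0 +i* - t).
rewrite n1 n2 n3 n4 => /(_ td) m1 /(_ td) m2 /(_ td) m3 /(_ td) m4 k1 k2 k3 k4.
cbv zeta in fp.
set H1 := normc (h (z + t%:C)) in m4 k4.
set H2 := normc (h (z + (- t)%:C)) in m3 k3.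
set H3 := normc (h (z + 0 +i* t)) in m2 k2.
set H4 := normc (h (z + 0 +i* - t)) in m1 k1.
set P1 := normc _ ^+ 2 in fp k4; set P2 := normc _ ^+ 2 in fp k3.
set P3 := normc _ ^+ 2 in fp k2; set P4 := normc _ ^+ 2 in fp k1.
set na := normc a in m1 m2 m3 m4 fp.
rewrite /quad /= !addr0 in m1 m2 m3 m4.
have b2 : 0 <= normc b ^+ 2 * t ^+ 2 by rewrite mulr_ge0 ?sqr_ge0.
have c2 : 0 <= normc c ^+ 2 * t ^+ 4 by rewrite mulr_ge0 ?sqr_ge0// exprn_ge0 ?ltW.
set x := complex.Re z in m1 m2 m3 m4; set y := complex.Im z in m1 m2 m3 m4.
have S : 2 * eps * t ^+ 2 <= 4 * Cst * t ^+ 3.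
  exact: (four_point_arith m1 m2 m3 m4 k1 k2 k3 k4 fp b2 c2).
have : 2 * eps <= 4 * Cst * t.
  rewrite -(@ler_pM2r _ (t ^+ 2)) ?exprn_gt0//.
  by rewrite (le_trans S)// exprS (mulrA (4 * Cst)).
move: te; rewrite ler_pdivlMr ?mulr_gt0 ?ltr_wpDl//.
by move=> te' ?; exact: (small_arith e0 t0 te').
Qed.

(** On a tall rectangle the maximum of [normc (h z) ^+ 2 - quad eps] cannot be interior. On the
    vertical sides it is at most [M ^+ 2] because [quad] is nonnegative there; on the horizontal
    sides the penalty outweighs [B ^+ 2]. Then [eps] tends to 0 at the fixed point [z0]. *)
Lemma strip_max_principle h (B M : R) :
  {within closure (@strip R), continuous h} ->
  (forall z, closure (@strip R) z -> normc (h z) <= B) ->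
  (forall z, strip z -> taylor2 h z) ->
  (forall t : R, normc (h (0 +i* t)) <= M) ->
  (forall t : R, normc (h (1 +i* t)) <= M) ->
  forall z, strip z -> normc (h z) <= M.
Proof.
rewrite closure_strip => /within_continuous_normcP hc hB ht h0 h1 z0 sz0.
have M0 : 0 <= M by rewrite (le_trans _ (h0 0))// normc_ge0.
suff sq : normc (h z0) ^+ 2 <= M ^+ 2.
  by rewrite -(@ler_pXn2r _ 2)// nnegrE normc_ge0.
pose v eps (p : R * R) := normc (h (p.1 +i* p.2)) ^+ 2 - quad eps p.1 p.2.
pose x0 := complex.Re z0; pose y0 := complex.Im z0.
have zE : z0 = x0 +i* y0 by rewrite /x0 /y0; case: (z0).
have main eps : 0 < eps -> v eps (x0, y0) <= M ^+ 2.
  move=> e0.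
  (* The quotient makes [eps * Y] at least [B ^+ 2], and the summand 1 then gives
     [eps * Y <= eps * Y ^+ 2]; [Y] also keeps [z0] inside the rectangle. *)
  pose Y := Num.max (`|y0|) (B ^+ 2 / eps) + 1.
  have Y1 : 1 <= Y by rewrite lerDr le_max normr_ge0.
  have yY : `|y0| <= Y.
    by rewrite /Y (@le_trans _ _ (Num.max (`|y0|) (B ^+ 2 / eps)))//
      ?le_max ?lexx// lerDl.
  have BY : B ^+ 2 <= eps * Y.
    rewrite mulrC -ler_pdivrMr// /Y.
    by rewrite (@le_trans _ _ (Num.max (`|y0|) (B ^+ 2 / eps)))//
      ?le_max ?lexx ?orbT// lerDl.
  have eY : eps * Y <= eps * Y ^+ 2 by rewrite ler_pM2l// expr2 ler_peMr// (le_trans _ Y1).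
  clearbody Y.
  pose A : set (R * R) := `[0, 1]%classic `*` `[- Y, Y]%classic.
  have A0 : A !=set0.
    by exists (0, 0); split; rewrite /= in_itv /= ?lexx ?ler01//; apply/andP; split; lra.
  have cA : compact A by apply: compact_setX; exact: segment_compact.
  have cv : {within A, continuous (v eps)}.
    have cn : {within A, continuous (fun p : R * R => normc (h (p.1 +i* p.2)))}.
      apply/subspace_continuousP => -[x y] /= [/=].
      rewrite !in_itv /= => x01 yYY; apply/cvgrPdist_lt => e ee0.
      have [//|d d0 H] := hc (x +i* y) _ _ ee0.
      apply/nbhs_ballP; exists (d / 2); first by rewrite /= divr_gt0.
      move=> -[x' y'] [/=]; rewrite -!ball_normE /ball_ /= => xd yd [/=].
      rewrite !in_itv /= => x01' _.
      rewrite distrC (le_lt_trans (norm_normcB _ _))// H//.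
      rewrite (le_lt_trans (normc_ReIm _))//= (distrC x') (distrC y'); lra.
    have c1 : {within A, continuous (fun p : R * R => p.1)}.
      by apply: continuous_subspaceT => p; exact: cvg_fst.
    have c2 : {within A, continuous (fun p : R * R => p.2)}.
      by apply: continuous_subspaceT => p; exact: cvg_snd.
    move=> p; apply: cvgB; first by apply: cvgM; exact: cn.
    apply: cvgM; first exact: cvg_cst.
    apply: cvgD; last exact: cvg_cst.
    apply: cvgB; first by apply: cvgM; exact: c2.
    by apply: cvgM; [exact: cvg_cst|apply: cvgM; exact: c1].
  have [[x y]] := compact_EVT_max A0 cA cv.
  rewrite inE => -[/=]; rewrite !in_itv /= => /andP[xge0 xle1] /andP[yge yle] mx.
  have le1 : v eps (x0, y0) <= v eps (x, y).
    apply: mx; rewrite inE; split; rewrite /= in_itv /=.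
      by move: sz0; rewrite /strip /= => /andP[/ltW -> /ltW ->].
    by rewrite -ler_norml.
  apply: (le_trans le1); rewrite /v /quad /=.
  have q0 : 0 <= y ^+ 2 - 2 * x ^+ 2 + 2 by have := sqr_ge0 y; nra.
  have hMsq (u : R) : 0 <= u -> u <= M -> u ^+ 2 - eps * (y ^+ 2 - 2 * x ^+ 2 + 2) <= M ^+ 2.
    move=> u0 uM; have : u ^+ 2 <= M ^+ 2 by rewrite lerXn2r// nnegrE.
    by have := mulr_ge0 (ltW e0) q0; lra.
  have [x_eq0|xn0] := eqVneq x 0.
    by apply: hMsq; [exact: normc_ge0|rewrite x_eq0; exact: h0].
  have [x_eq1|xn1] := eqVneq x 1.
    by apply: hMsq; [exact: normc_ge0|rewrite x_eq1; exact: h1].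
  (* Within the rectangle this case means [y = Y] or [y = - Y], a horizontal side. *)
  have [yY2|yY2] := boolP (Y ^+ 2 <= y ^+ 2).
    have hb : normc (h (x +i* y)) <= B by apply: hB; rewrite /= xge0.
    have : normc (h (x +i* y)) ^+ 2 <= B ^+ 2.
      by rewrite lerXn2r// ?nnegrE ?normc_ge0// (le_trans _ hb)// normc_ge0.
    have e1 : 0 <= eps * (2 - 2 * x ^+ 2).
      by rewrite pmulr_rge0// subr_ge0 ler_piMr// expr_le1.
    have e2 : eps * Y ^+ 2 <= eps * y ^+ 2 by rewrite ler_pM2l.
    by have := sqr_ge0 M; lra.
  exfalso.
  have xgt0 : 0 < x by rewrite lt_neqAle eq_sym xn0.
  have xlt1 : x < 1 by rewrite lt_neqAle xn1.
  have ylt : y < Y by rewrite lt_neqAle yle andbT; apply: contraNneq yY2 => ->.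
  have ygt : - Y < y.
    by rewrite lt_neqAle yge andbT; apply: contraNneq yY2 => <-; rewrite sqrrN.
  have sxy : strip (x +i* y : C) by rewrite /strip /= xgt0.
  apply: (taylor2_not_max e0 (ht _ sxy)).
  exists (Num.min (Num.min x (1 - x)) (Num.min (Y - y) (y + Y))).
    by rewrite !lt_min xgt0 /= !subr_gt0 xlt1 ylt /= -ltrBlDr sub0r.
  move=> w wd /=; have := mx (x + complex.Re w, y + complex.Im w).
  rewrite /v /=; have -> : (x +i* y + w) = (x + complex.Re w) +i* (y + complex.Im w).
    by case: (w).
  apply; have := normc_Re w; have := normc_Im w.
  move: wd; rewrite !lt_min => /andP[/andP[w1 w2] /andP[w3 w4]].
  rewrite !ler_norml => /andP[i1 i2] /andP[r1 r2].
  by rewrite inE; split; rewrite /= in_itv /=; apply/andP; split; lra.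
rewrite leNgt; apply/negP => lt.
pose Q := y0 ^+ 2 - 2 * x0 ^+ 2 + 2.
pose D := normc (h z0) ^+ 2 - M ^+ 2.
have D0 : 0 < D by rewrite subr_gt0.
have Q1 : 0 < `|Q| + 1 by rewrite ltr_wpDl.
(* With this [eps] the penalty at [z0] costs at most [D / 2], half of the supposed excess over
   [M ^+ 2]. *)
have := main (D / (2 * (`|Q| + 1))); rewrite divr_gt0 ?mulr_gt0// => /(_ isT).
rewrite /v /quad /= -zE -/Q.
have : D / (2 * (`|Q| + 1)) * Q <= D / 2.
  rewrite invfM mulrA -mulrA -[leRHS]mulr1 ler_pM2l ?divr_gt0//.
  by rewrite mulrC ler_pdivrMr// mul1r (le_trans (ler_norm _))// lerDl.
by rewrite /D in D0 *; lra.
Qed.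

End MaxPrinciple.

(** * The complex exponential and its Taylor remainder *)

Section ComplexExponential.
Context {R : realType}.
Local Notation C := (Cplx R).
Implicit Types (z w : C).

Definition cexp z : C :=
  (expR (complex.Re z) * cos (complex.Im z)) +i*
  (expR (complex.Re z) * sin (complex.Im z)).

Lemma cexpD z w : cexp (z + w) = cexp z * cexp w.
Proof.
case: z w => [a b] [c d]; rewrite /cexp /=; apply/eqP; rewrite eq_complex /=.
by rewrite expRD cosD sinD; apply/andP; split; apply/eqP; ring.
Qed.

Lemma cexp0 : cexp 0 = 1.
Proof. by rewrite /cexp /= expR0 cos0 sin0 mulr1 mulr0. Qed.

Lemma normc_cexp z : normc (cexp z) = expR (complex.Re z).
Proof.
rewrite /cexp /= !exprMn -mulrDr cos2Dsin2 mulr1 sqrtr_sqr.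
by rewrite ger0_norm// expR_ge0.
Qed.

Let is_derive_monomial (c : R) n (t : R) :
  is_derive t (1 : R) (fun s => c * s ^+ n.+1) ((c *+ n.+1) * t ^+ n).
Proof.
rewrite (_ : (fun _ => _) = c \*: (id ^+ n.+1)); last first.
  by apply/funext => s; rewrite /= exprfctE.
apply: (is_derive_eq (is_deriveZ _ (is_deriveX _ (is_derive_id _ _)))).
by rewrite /GRing.scale /= mulr1 mulrA mulr_natr.
Qed.

Let is_derive_linear (x t : R) : is_derive t (1 : R) (fun s => s * x) x.
Proof.
rewrite (_ : (fun _ => _) = x \*: id); last first.
  by apply/funext => s; rewrite /= mulrC.
apply: (is_derive_eq (is_deriveZ _ (is_derive_id _ _))).
by rewrite /GRing.scale /= mulr1.
Qed.

Let is_derive_poly (a : nat -> R) N (t : R) :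
  is_derive t (1 : R) (fun t => \sum_(n < N.+1) a n * t ^+ n)
    (\sum_(n < N) (a n.+1 *+ n.+1) * t ^+ n).
Proof.
elim: N => [|N ih].
  rewrite big_ord0 (_ : (fun _ => _) = cst (a 0%N)).
    exact: is_derive_cst.
  by apply/funext => s; rewrite big_ord1 expr0 mulr1.
rewrite (_ : (fun _ => _) = (fun t => \sum_(n < N.+1) a n * t ^+ n) \+
    (fun t => a N.+1 * t ^+ N.+1)); last first.
  by apply/funext => s; rewrite big_ord_recr.
rewrite big_ord_recr /=; apply: is_deriveD; exact: is_derive_monomial.
Qed.

Let comparison (f g df dg : R -> R) :
  (forall t, is_derive t (1 : R) f (df t)) ->
  (forall t, is_derive t (1 : R) g (dg t)) ->
  f 0 <= g 0 -> (forall t, 0 <= t <= 1 -> df t <= dg t) ->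
  forall t, 0 <= t <= 1 -> f t <= g t.
Proof.
move=> hf hg fg0 dfg t /andP[]; rewrite le_eqVlt => /predU1P[<-//|t0] t1.
have hd s : is_derive s (1 : R) (g - f) (dg s - df s) by exact: is_deriveB.
have [|c] := @MVT R (g - f) (fun s => dg s - df s) 0 t t0 (fun s _ => hd s).
  apply: continuous_subspaceT => x.
  by apply/differentiable_continuous/derivable1_diffP; have [] := hd x.
rewrite in_itv /= => /andP[c0 ct]; rewrite !fctE subr0 => E.
have : 0 <= (dg c - df c) * t.
  by rewrite mulr_ge0 ?(ltW t0)// subr_ge0 dfg// (ltW c0) (le_trans (ltW ct)).
by rewrite -E; lra.
Qed.

Definition cexp_poly N w : C := \sum_(n < N) (n`!%:R)^-1%:C * w ^+ n.

(** Along the segment [t * w], with [w = x + i y], the real and imaginary remainders [f] and [g] of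
    order [N + 1] vanish at 0 and have derivatives [x f - y g] and [x g + y f] in terms of those of
    order [N]. Both [|x|] and [|y|] are at most [normc w], so the induction by comparison of
    derivatives needs a majorant whose derivative is [2 * normc w] times the preceding one: hence
    the power of [2 * normc w]. *)
Let cexp_rem_bound w N (t : R) : 0 <= t <= 1 ->
  let B := expR (normc w) * (2 * normc w) ^+ N * t ^+ N / N`!%:R in
  `|complex.Re (cexp (t%:C * w) - cexp_poly N (t%:C * w))| <= B /\
  `|complex.Im (cexp (t%:C * w) - cexp_poly N (t%:C * w))| <= B.
Proof.
set M := normc w.
have M0 : 0 <= M by exact: normc_ge0.
case: w @M M0 => x y M M0.
have tE (s : R) : s%:C * (x +i* y) = (s * x) +i* (s * y) :> C.
  by apply/eqP; rewrite eq_complex /= !mul0r subr0 addr0 !eqxx.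
pose a n := complex.Re ((n`!%:R)^-1%:C * (x +i* y) ^+ n : C).
pose b n := complex.Im ((n`!%:R)^-1%:C * (x +i* y) ^+ n : C).
have ReX (s : R) n : complex.Re ((n`!%:R)^-1%:C * (s%:C * (x +i* y)) ^+ n : C) = a n * s ^+ n.
  rewrite exprMn mulrCA -rmorphXn /a.
  by case: (_ * (x +i* y) ^+ n) => u v /=; rewrite mul0r subr0 mulrC.
have ImX (s : R) n : complex.Im ((n`!%:R)^-1%:C * (s%:C * (x +i* y)) ^+ n : C) = b n * s ^+ n.
  rewrite exprMn mulrCA -rmorphXn /b.
  by case: (_ * (x +i* y) ^+ n) => u v /=; rewrite mul0r addr0 mulrC.
have ReP (s : R) N' : complex.Re (cexp_poly N' (s%:C * (x +i* y))) = \sum_(n < N') a n * s ^+ n.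
  by rewrite /cexp_poly (raddf_sum (@complex.Re R)); apply: eq_bigr => i _; exact: ReX.
have ImP (s : R) N' : complex.Im (cexp_poly N' (s%:C * (x +i* y))) = \sum_(n < N') b n * s ^+ n.
  by rewrite /cexp_poly (raddf_sum (@complex.Im R)); apply: eq_bigr => i _; exact: ImX.
have fS n : n.+1%:R / n.+1`!%:R = (n`!%:R)^-1 :> R.
  rewrite factS natrM invfM mulrA divff ?mul1r// pnatr_eq0//.
have aS n : a n.+1 *+ n.+1 = x * a n - y * b n.
  rewrite /a /b exprS; case: ((x +i* y : C) ^+ n) => u v /=.
  rewrite !mul0r !subr0 !addr0 -(fS n) -mulr_natl; ring.
have bS n : b n.+1 *+ n.+1 = x * b n + y * a n.
  rewrite /a /b exprS; case: ((x +i* y : C) ^+ n) => u v /=.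
  rewrite !mul0r !subr0 !addr0 -(fS n) -mulr_natl; ring.
pose f N (s : R) := expR (s * x) * cos (s * y) - \sum_(n < N) a n * s ^+ n.
pose g N (s : R) := expR (s * x) * sin (s * y) - \sum_(n < N) b n * s ^+ n.
have fE N' (s : R) : complex.Re (cexp (s%:C * (x +i* y)) - cexp_poly N' (s%:C * (x +i* y))) = f N' s.
  rewrite ReD /f -ReP tE /=; congr (_ + _); by case: (cexp_poly _ _).
have gE N' (s : R) : complex.Im (cexp (s%:C * (x +i* y)) - cexp_poly N' (s%:C * (x +i* y))) = g N' s.
  rewrite ImD /g -ImP tE /=; congr (_ + _); by case: (cexp_poly _ _).
cbv zeta; rewrite fE gE => t01.
pose H N (s : R) := expR M * (2 * M) ^+ N * s ^+ N / N`!%:R.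
have dH N' (s : R) : is_derive s (1 : R) (H N'.+1) (2 * M * H N' s).
  rewrite (_ : H N'.+1 = (fun t => (expR M * (2 * M) ^+ N'.+1 / N'.+1`!%:R) * t ^+ N'.+1)).
    apply: (is_derive_eq (is_derive_monomial _ _ _)).
    by rewrite /H -(fS N') -mulr_natr exprS; ring.
  by apply/funext => u; rewrite /H /=; ring.
have de (s : R) : is_derive s (1 : R) (fun s => expR (s * x)) (x * expR (s * x)).
  apply: (is_derive_eq (is_derive1_comp (f := expR) (g := fun s => s * x) (b := x) _ _)).
    exact: is_derive_linear.
  by rewrite mulrC.
have dc (s : R) : is_derive s (1 : R) (fun s => cos (s * y)) (- y * sin (s * y)).
  apply: (is_derive_eq (is_derive1_comp (f := cos) (g := fun s => s * y) (b := y) _ _)).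
    exact: is_derive_linear.
  by rewrite !mulNr mulrC.
have ds (s : R) : is_derive s (1 : R) (fun s => sin (s * y)) (y * cos (s * y)).
  apply: (is_derive_eq (is_derive1_comp (f := sin) (g := fun s => s * y) (b := y) _ _)).
    exact: is_derive_linear.
  by rewrite mulrC.
have df N' (s : R) : is_derive s (1 : R) (f N'.+1) (x * f N' s - y * g N' s).
  apply: (is_derive_eq (is_deriveB (is_deriveM (de s) (dc s)) (is_derive_poly a N' s))).
  under eq_bigr do rewrite aS mulrBl -!mulrA.
  by rewrite sumrB -!mulr_sumr /f /g /GRing.scale /=; ring.
have dg N' (s : R) : is_derive s (1 : R) (g N'.+1) (x * g N' s + y * f N' s).
  apply: (is_derive_eq (is_deriveB (is_deriveM (de s) (ds s)) (is_derive_poly b N' s))).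
  under eq_bigr do rewrite bS mulrDl -!mulrA.
  by rewrite big_split /= -!mulr_sumr /f /g /GRing.scale /=; ring.
have xM : `|x| <= M by rewrite (le_trans _ (normc_Re (x +i* y))).
have yM : `|y| <= M by rewrite (le_trans _ (normc_Im (x +i* y))).
suff : `|f N t| <= H N t /\ `|g N t| <= H N t by [].
elim: N t t01 => [|N ih] t t01.
  rewrite /f /g /H !big_ord0 !subr0 !expr0 !mulr1 divr1.
  have eb : expR (t * x) <= expR M.
    rewrite ler_expR (le_trans (ler_norm _))// normrM -[leRHS]mul1r.
    by case/andP: t01 => t0 t1; rewrite ler_pM// ger0_norm.
  split; rewrite normrM (ger0_norm (expR_ge0 _)) (le_trans _ eb)// ler_piMr ?expR_ge0//.
    by rewrite ler_norml cos_geN1 cos_le1.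
  by rewrite ler_norml sin_geN1 sin_le1.
have at0 (c : nat -> R) : \sum_(n < N.+1) c n * 0 ^+ n = c 0%N.
  by rewrite big_ord_recl expr0 mulr1 big1 ?addr0// => i _; rewrite exprS mul0r mulr0.
have f0 : f N.+1 0 = 0.
  rewrite /f at0.
  by rewrite !mul0r expR0 cos0 mul1r /a expr0 mulr1 fact0 invr1 subrr.
have g0 : g N.+1 0 = 0.
  by rewrite /g at0 !mul0r expR0 sin0 mul1r /b expr0 mulr1 fact0 invr1 subrr.
have H0 : H N.+1 0 = 0 by rewrite /H (exprS 0) mul0r mulr0 mul0r.
have bnd (s u v : R) : 0 <= s <= 1 -> `|u| <= M -> `|v| <= M ->
    `|u * f N s + v * g N s| <= 2 * M * H N s.
  move=> s01 uM vM; have [hf hg] := ih _ s01.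
  rewrite (le_trans (ler_normD _ _))// !normrM mulr_natl mulr2n mulrDl.
  by rewrite lerD// ler_pM.
split; rewrite ler_norml; apply/andP; split.
- rewrite lerNl -[leLHS]/((- f N.+1) t).
  apply: (@comparison _ _ (fun s => - (x * f N s - y * g N s)) _ _ (dH N) _ _ _ t01).
  + by rewrite fctE f0 H0 oppr0.
  + move=> s s01; rewrite (le_trans (ler_norm _))// normrN -mulNr.
    by apply: bnd; rewrite ?normrN.
- apply: (@comparison _ _ (fun s => (x * f N s - y * g N s)) _ (df N) (dH N) _ _ _ t01).
  + by rewrite f0 H0.
  + move=> s s01; rewrite (le_trans (ler_norm _))// -mulNr.
    by apply: bnd; rewrite ?normrN.
- rewrite lerNl -[leLHS]/((- g N.+1) t).
  apply: (@comparison _ _ (fun s => - (x * g N s + y * f N s)) _ _ (dH N) _ _ _ t01).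
  + by rewrite fctE g0 H0 oppr0.
  + move=> s s01; rewrite (le_trans (ler_norm _))// normrN addrC.
    by apply: bnd.
- apply: (@comparison _ _ (fun s => (x * g N s + y * f N s)) _ (dg N) (dH N) _ _ _ t01).
  + by rewrite g0 H0.
  + move=> s s01; rewrite (le_trans (ler_norm _))// addrC.
    by apply: bnd.
Qed.

Lemma cexp_remainder w N :
  normc (cexp w - cexp_poly N w) <=
  2 * (expR (normc w) * (2 * normc w) ^+ N / N`!%:R).
Proof.
have [|hR hI] := @cexp_rem_bound w N 1; first by rewrite ler01 lexx.
move: hR hI; rewrite mul1r expr1n mulr1 => hR hI.
by rewrite (le_trans (normc_ReIm _))// mulr_natl mulr2n lerD.
Qed.

End ComplexExponential.

(** * Second order expansions of analytic functions *)

Section ComplexSeries.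
Context {R : realType}.
Local Notation C := (Cplx R).
Implicit Types (z w : C) (h : C -> C) (u : nat -> C).

Lemma cvgn_normcP u (l : C) :
  u @ \oo --> l <->
  forall e : R, 0 < e -> exists N, forall n, (N <= n)%N -> normc (u n - l) < e.
Proof.
have E n : `|0 - normc (u n - l)| = normc (u n - l).
  by rewrite sub0r normrN (ger0_norm (normc_ge0 _)).
split=> [/cvg_normcP/cvgrPdist_lt h e e0|h].
  by have [N _ HN] := h e e0; exists N => n Nn; rewrite -E; exact: HN.
apply/cvg_normcP/cvgrPdist_lt => e e0; have [N HN] := h e e0.
by exists N => // n /= Nn; rewrite E; exact: HN.
Qed.

Lemma cvgn_normc_le u (l a : C) (M : R) N : u @ \oo --> l ->
  (forall n, (N <= n)%N -> normc (u n - a) <= M) -> normc (l - a) <= M.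
Proof.
move=> /cvgn_normcP ul uM; rewrite leNgt; apply/negP => Ml.
have [|N' HN'] := ul (normc (l - a) - M); first by rewrite subr_gt0.
have := HN' _ (leq_maxr N N'); rewrite ltNge => /negP; apply.
have := uM _ (leq_maxl N N'); set v := u _ => vM.
rewrite lerBlDr (le_trans _ (lerD (lexx _) vM))// (normc_distC v l).
by rewrite -[leLHS](_ : normc ((l - v) + (v - a)) = _) ?normcD// addrA subrK.
Qed.

Lemma geom_tail_le (x : R) N k : 0 <= x <= 1 / 2 ->
  \sum_(N <= n < N + k) x ^+ n <= 2 * x ^+ N.
Proof.
move=> /andP[x0 x1].
suff: \sum_(N <= n < N + k) x ^+ n + 2 * x ^+ (N + k) <= 2 * x ^+ N.
  by apply: le_trans; rewrite lerDl mulr_ge0// exprn_ge0.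
elim: k => [|k ih]; first by rewrite addn0 big_geq// add0r.
rewrite addnS big_nat_recr ?leq_addr//= (le_trans _ ih)// -addrA lerD2l.
have := exprn_ge0 (N + k) x0; rewrite exprS; set t := x ^+ _ => t0; nra.
Qed.

Let addNKr z w : z + w - z = w.
Proof. by rewrite addrC addKr. Qed.

(** Convergence at one point at distance [rho] bounds [normc (c n) * rho ^+ n], since a term is a
    difference of two partial sums. For [normc w < rho / 2] the terms of degree at least 3 are then
    dominated by a geometric series of ratio at most 1/2, hence by twice its first term. *)
Lemma analytic_taylor2 h z : analytic_at h z -> taylor2 h z.
Proof.
move=> [c [r [r0 H]]].
pose rho := r / 2.
have rho0 : 0 < rho by rewrite divr_gt0.
have [B HB] : exists B : R, forall n, normc (c n) * rho ^+ n <= B.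
  have nrho : normc (z + rho%:C - z) = rho by rewrite addNKr normc_real gtr0_norm.
  have Hr : normc (z + rho%:C - z) < r by rewrite nrho /rho; lra.
  have /cvgn_normcP/(_ 1 ltr01)[N HN] := H _ Hr.
  set S := series _ in HN.
  have Sb : exists B : R, forall n, normc (S n - h (z + rho%:C)) <= B.
    exists (1 + \sum_(i < N) normc (S i - h (z + rho%:C))) => n.
    have [Nn|nN] := leqP N n.
      by rewrite (le_trans (ltW (HN _ Nn)))// lerDl sumr_ge0// => *; exact: normc_ge0.
    rewrite (bigD1 (Ordinal nN))//= addrCA lerDl addr_ge0// sumr_ge0// => *.
    exact: normc_ge0.
  have [B HB] := Sb; exists (B + B) => n.
  have -> : normc (c n) * rho ^+ n = normc (S n.+1 - S n).
    by rewrite /S /series /= big_nat_recr//= addNKr normcM normcX nrho.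
  have -> : S n.+1 - S n = (S n.+1 - h (z + rho%:C)) - (S n - h (z + rho%:C)).
    by rewrite opprB addrA subrK.
  by rewrite (le_trans (normcB _ _))// lerD.
have B0 : 0 <= B by rewrite (le_trans _ (HB 0%N))// mulr_ge0 ?normc_ge0// exprn_ge0 ?ltW.
have key w : normc w < rho / 2 ->
    normc (h (z + w) - (c 0%N + c 1%N * w + c 2%N * w ^+ 2)) <=
    (2 * B / rho ^+ 3) * normc w ^+ 3.
  move=> wr; have wr' : normc (z + w - z) < r.
    by rewrite addNKr (lt_trans wr)// /rho; lra.
  apply: (cvgn_normc_le (N := 3) (H _ wr')) => n n3.
  rewrite /series /= (big_cat_nat (n:=3))//=.
  rewrite [X in X + _ - _](_ : _ = c 0%N + c 1%N * w + c 2%N * w ^+ 2); last first.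
    by rewrite !big_nat_recr//= big_geq// add0r !addNKr expr0 expr1 mulr1.
  rewrite addNKr (le_trans (normc_sum _ _ _))//.
  have x01 : 0 <= normc w / rho <= 1 / 2.
    rewrite divr_ge0 ?normc_ge0 ?(ltW rho0)//= ler_pdivrMr// mulrC mul1r.
    by rewrite -[leRHS]/(rho / 2) ltW.
  have := geom_tail_le 3 (n - 3) x01; rewrite subnKC// => geo.
  apply: (@le_trans _ _ (B * (2 * (normc w / rho) ^+ 3))); last first.
    by rewrite exprMn exprVn le_eqVlt; apply/orP; left; apply/eqP; ring.
  rewrite (le_trans _ (ler_wpM2l B0 geo))// mulr_sumr ler_sum// => i _.
  rewrite addNKr normcM normcX.
  have -> : normc (c i) * normc w ^+ i = (normc (c i) * rho ^+ i) * (normc w / rho) ^+ i.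
    by rewrite -mulrA -exprMn mulrC (mulrC rho) divfK ?gt_eqF// mulrC.
  by rewrite ler_wpM2r// exprn_ge0//; case/andP: x01.
have hz : h z = c 0%N.
  have := key 0; rewrite normc0 divr_gt0// => /(_ isT).
  rewrite addr0 !(mulr0, expr0n, addr0) /= => h0.
  by apply/eqP; rewrite -subr_eq0 -normc_eq0 eq_le h0 normc_ge0.
exists (c 1%N), (c 2%N), (2 * B / rho ^+ 3), (rho / 2); split.
  by rewrite divr_gt0.
by rewrite hz; exact: key.
Qed.

Lemma taylor2_cst (a : C) z : taylor2 (fun=> a) z.
Proof.
exists 0, 0, 0, 1; split => // w _.
by rewrite !mul0r !addr0 subrr normc0.
Qed.

Lemma taylor2D (h g : C -> C) z :
  taylor2 h z -> taylor2 g z -> taylor2 (fun w => h w + g w) z.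
Proof.
move=> [a1 [a2 [K [r [r0 H]]]]] [b1 [b2 [L [s [s0 G]]]]].
exists (a1 + b1), (a2 + b2), (K + L), (Num.min r s); split.
  by rewrite lt_min r0.
move=> w; rewrite lt_min => /andP[/H hw /G gw].
have -> : h (z + w) + g (z + w) - (h z + g z + (a1 + b1) * w + (a2 + b2) * w ^+ 2) =
    (h (z + w) - (h z + a1 * w + a2 * w ^+ 2)) +
    (g (z + w) - (g z + b1 * w + b2 * w ^+ 2)) by ring.
by rewrite (le_trans (normcD _ _))// mulrDl lerD.
Qed.

Lemma taylor2M (h g : C -> C) z :
  taylor2 h z -> taylor2 g z -> taylor2 (fun w => h w * g w) z.
Proof.
move=> [a1 [a2 [K [r [r0 H]]]]] [b1 [b2 [L [s [s0 G]]]]].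
set a0 := h z in H *; set b0 := g z in G *.
pose K' := Num.max K 0; pose L' := Num.max L 0.
have K0 : 0 <= K' by rewrite le_max lexx orbT.
have L0 : 0 <= L' by rewrite le_max lexx orbT.
pose A := normc a0 + normc a1 + normc a2.
pose B := normc b0 + normc b1 + normc b2.
exists (a0 * b1 + a1 * b0), (a0 * b2 + a1 * b1 + a2 * b0).
(* In order: the coefficients of degree 3 and 4 in the product of the quadratic parts, then the two
   products that involve a remainder. The radius is cut at 1 so that higher powers of [normc w] are
   bounded by its cube. *)
exists (normc (a1 * b2 + a2 * b1) + normc (a2 * b2) + K' * (B + L') + A * L').
exists (Num.min (Num.min r s) 1); split.
  by rewrite !lt_min r0 s0 ltr01.
move=> w; rewrite !lt_min => /andP[/andP[/H hw /G gw] w1].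
have w0 := normc_ge0 w.
set rho := h (z + w) - _ in hw; set sig := g (z + w) - _ in gw.
pose P := a0 + a1 * w + a2 * w ^+ 2; pose Q := b0 + b1 * w + b2 * w ^+ 2.
have -> : h (z + w) = P + rho by rewrite /rho /P; ring.
have -> : g (z + w) = Q + sig by rewrite /sig /Q; ring.
have w31 : normc w ^+ 3 <= 1 by rewrite exprn_ile1// ltW.
have poly_le (c0 c1 c2 : C) :
    normc (c0 + c1 * w + c2 * w ^+ 2) <= normc c0 + normc c1 + normc c2.
  rewrite (le_trans (normcD _ _))// lerD//.
    by rewrite (le_trans (normcD _ _))// lerD// normcM ler_piMr ?normc_ge0// ltW.
  by rewrite normcM normcX ler_piMr ?normc_ge0// exprn_ile1// ltW.
have PA : normc P <= A by exact: poly_le.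
have QB : normc Q <= B by exact: poly_le.
have hw' : normc rho <= K' * normc w ^+ 3.
  by rewrite (le_trans hw)// ler_wpM2r ?exprn_ge0// le_max lexx.
have gw' : normc sig <= L' * normc w ^+ 3.
  by rewrite (le_trans gw)// ler_wpM2r ?exprn_ge0// le_max lexx.
have sL : normc sig <= L' by rewrite (le_trans gw')// ler_piMr.
have -> : (P + rho) * (Q + sig) - (a0 * b0 + (a0 * b1 + a1 * b0) * w +
      (a0 * b2 + a1 * b1 + a2 * b0) * w ^+ 2) =
    (a1 * b2 + a2 * b1) * w ^+ 3 + a2 * b2 * w ^+ 4 + rho * (Q + sig) + P * sig.
  by rewrite /P /Q; ring.
rewrite [leRHS]mulrDl [X in _ <= X + _]mulrDl [X in _ <= X + _ + _]mulrDl.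
rewrite (le_trans (normcD _ _))// lerD//; last first.
  by rewrite normcM -mulrA ler_pM// ?normc_ge0.
rewrite (le_trans (normcD _ _))// lerD//; last first.
  rewrite normcM mulrAC ler_pM// ?normc_ge0//.
  by rewrite (le_trans (normcD _ _))// lerD.
rewrite (le_trans (normcD _ _))// lerD//; first by rewrite normcM normcX.
rewrite normcM normcX ler_wpM2l ?normc_ge0// exprS ler_piMl ?exprn_ge0//.
exact: ltW.
Qed.


(** Near 0 the Taylor polynomial of degree 2 with its remainder suffices; the functional equation of
    [cexp] moves the expansion to any other point. *)
Lemma taylor2_cexp (a b z : C) : taylor2 (fun w => cexp (a * w + b)) z.
Proof.
have : taylor2 (@cexp R) 0.
  exists 1, (2^-1), (2 * (expR 1 * 2 ^+ 3 / 3`!%:R)), 1; split => // w w1.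
  rewrite add0r cexp0 (_ : 1 + _ + _ = cexp_poly 3 w).
    rewrite (le_trans (cexp_remainder _ _))// exprMn.
    rewrite [leRHS](_ : _ = 2 * (expR 1 * (2 ^+ 3 * normc w ^+ 3) / 3`!%:R)); last by ring.
    rewrite ler_wpM2l// ler_wpM2r ?invr_ge0//.
    by rewrite ler_wpM2r ?mulr_ge0 ?exprn_ge0 ?normc_ge0// ler_expR ltW.
  rewrite /cexp_poly !big_ord_recl big_ord0 /= /bump /= !addn0 addr0 addrA.
  have -> : ((1 + 1)`!%:R^-1)%:C = 2^-1 :> C by rewrite fmorphV rmorph_nat.
  by rewrite !fact0 invr1 expr0 expr1 mulr1.
move=> [c1 [c2 [K [r [r0 H]]]]].
have [a0|an0] := eqVneq a 0.
  rewrite (_ : (fun w => cexp (a * w + b)) = fun=> cexp b); first exact: taylor2_cst.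
  by apply/funext => w; rewrite a0 mul0r add0r.
have na : 0 < normc a by rewrite lt_neqAle normc_ge0 andbT eq_sym normc_eq0.
exists (cexp (a * z + b) * c1 * a), (cexp (a * z + b) * c2 * a ^+ 2).
exists (normc (cexp (a * z + b)) * K * normc a ^+ 3), (r / normc a); split.
  by rewrite divr_gt0.
move=> w; rewrite ltr_pdivlMr// mulrC -normcM => /H.
rewrite add0r cexp0 => h.
have -> : a * (z + w) + b = (a * z + b) + a * w by ring.
rewrite cexpD; set E := cexp (a * z + b).
have -> : E * cexp (a * w) - (E + E * c1 * a * w + E * c2 * a ^+ 2 * w ^+ 2) =
    E * (cexp (a * w) - (1 + c1 * (a * w) + c2 * (a * w) ^+ 2)) by ring.
by rewrite normcM -!(mulrA (normc E)) ler_wpM2l ?normc_ge0// -mulrA -exprMn -normcM.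
Qed.

End ComplexSeries.

(** * Dirichlet series with nonnegative frequencies on the closed strip *)

Section DirichletSeries.
Context {R : realType}.
Local Notation C := (Cplx R).
Implicit Types (z w : C) (h : C -> C) (u : nat -> C).

Lemma bounded_series_tail (a : nat -> R) (M : R) : (forall n, 0 <= a n) ->
  (forall n, \sum_(i < n) a i <= M) ->
  forall e : R, 0 < e -> exists N, forall n,
    (N <= n)%N -> \sum_(N <= i < n) a i < e.
Proof.
move=> a0 aM e e0.
have cs : cvgn (series a).
  apply: nondecreasing_is_cvgn; first exact: nondecreasing_series.
  by exists M => _ [n _ <-]; rewrite /series /= big_mkord.
have /cvgrPdist_lt/(_ e e0)[N _ HN] := cs.
exists N => n Nn.
have le m : series a m <= limn (series a).
  by apply: nondecreasing_cvgn_le => //; exact: nondecreasing_series.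
have := HN N (leqnn N); rewrite /= ger0_norm ?subr_ge0// => lt.
have := le n; rewrite /series /= (@big_cat_nat _ _ _ N)//= => ln.
rewrite (le_lt_trans _ lt)// lerBrDr addrC; exact: ln.
Qed.

Lemma normc_series_dist u m n : (m <= n)%N ->
  normc (series u n - series u m) <= \sum_(m <= i < n) normc (u i).
Proof.
by move=> mn; rewrite sub_series_geq// normc_sum.
Qed.

Lemma abs_cvg_series u (M : R) :
  (forall n, \sum_(i < n) normc (u i) <= M) -> exists l : C, series u @ \oo --> l.
Proof.
move=> uM.
have part (f : C -> R) : (forall z, `|f z| <= normc z) ->
    cvgn (series (f \o u)).
  move=> fle; apply: normed_cvg; apply: nondecreasing_is_cvgn.
    by apply: nondecreasing_series => n; rewrite normr_ge0.
  exists M => _ [n _ <-]; apply: le_trans (uM n).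
  rewrite -(big_mkord predT (fun i => normc (u i))).
  by apply: ler_sum => i _; exact: fle.
have cR := part _ normc_Re; have cI := part _ normc_Im.
exists (limn (series (@complex.Re R \o u)) +i* limn (series (@complex.Im R \o u))).
apply/cvgn_normcP => e e0.
have e2 : 0 < e / 2 by rewrite divr_gt0.
have /cvgrPdist_lt/(_ _ e2)[N1 _ H1] := cR.
have /cvgrPdist_lt/(_ _ e2)[N2 _ H2] := cI.
exists (maxn N1 N2) => n; rewrite geq_max => /andP[/H1 h1 /H2 h2].
rewrite (le_lt_trans (normc_ReIm _))// ReD ImD /= (splitr e).
rewrite /series /= (raddf_sum (@complex.Re R)) (raddf_sum (@complex.Im R)) ltrD//.
  by move: h1; rewrite distrC.
by move: h2; rewrite distrC.
Qed.

Lemma cexp_poly_le N (w : C) : normc (cexp_poly N w) <= expR (normc w).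
Proof.
rewrite (le_trans (normc_sum _ _ _))//.
apply: (@le_trans _ _ (series (exp_coeff (normc w)) N)).
  rewrite /series /= big_mkord ler_sum// => i _.
  rewrite normcM normcX normc_real ger0_norm ?invr_ge0// mulrC.
  by rewrite /exp_coeff.
apply: nondecreasing_cvgn_le; last exact: is_cvg_series_exp_coeff.
by apply: nondecreasing_series => n; rewrite exp_coeff_ge0// normc_ge0.
Qed.

Lemma cexp_poly_cvg (w : C) (e : R) : 0 < e ->
  exists N0, forall N, (N0 <= N)%N -> normc (cexp w - cexp_poly N w) < e.
Proof.
move=> e0.
have /cvgrPdist_lt := cvg_exp_coeff (2 * normc w).
pose k := 2 * expR (normc w).
have k0 : 0 < k by rewrite mulr_gt0// expR_gt0.
have ek : 0 < e / k by rewrite divr_gt0.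
move=> /(_ _ ek)[N0 _ HN0]; exists N0 => N /HN0 /=.
rewrite sub0r normrN => h; rewrite (le_lt_trans (cexp_remainder _ _))//.
rewrite ger0_norm in h; last by rewrite exp_coeff_ge0// mulr_ge0 ?normc_ge0.
by move: h; rewrite ltr_pdivlMr// /exp_coeff /k mulrC !mulrA.
Qed.

Lemma continuous_cexp (a b z : C) (e : R) : 0 < e -> exists2 d : R, 0 < d &
  forall w, normc (w - z) < d ->
    normc (cexp (a * w + b) - cexp (a * z + b)) < e.
Proof.
move=> e0; have [c1 [c2 [K [r [r0 H]]]]] := taylor2_cexp a b z.
pose L := normc c1 + normc c2 + `|K| + 1.
have L0 : 0 < L by rewrite ltr_wpDl// !addr_ge0// normc_ge0.
exists (Num.min (Num.min r 1) (e / L)).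
  by rewrite !lt_min r0 ltr01 divr_gt0.
move=> w; rewrite !lt_min => /andP[/andP[wr w1]]; rewrite ltr_pdivlMr// => we.
have := H _ wr; rewrite [z + _]addrC subrK; set v := w - z => hv.
have v0 : 0 <= normc v by exact: normc_ge0.
apply: le_lt_trans we.
rewrite -[_ - _](_ : cexp (a * w + b) - (cexp (a * z + b) + c1 * v + c2 * v ^+ 2) +
   (c1 * v + c2 * v ^+ 2) = _); last by ring.
rewrite (le_trans (normcD _ _))//.
have v2 : normc v ^+ 2 <= normc v by rewrite expr2 ler_piMl// ltW.
have v3 : normc v ^+ 3 <= normc v.
  by rewrite exprS ler_piMr// exprn_ile1// ltW.
have h1 : normc (c1 * v + c2 * v ^+ 2) <= (normc c1 + normc c2) * normc v.
  rewrite (le_trans (normcD _ _))// mulrDl (normcM c1) (normcM c2) normcX lerD//.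
  by rewrite ler_wpM2l// normc_ge0.
have h2 : K * normc v ^+ 3 <= `|K| * normc v.
  by rewrite (le_trans (ler_norm _))// normrM (@ger0_norm _ (_ ^+ 3)) ?exprn_ge0// ler_wpM2l.
rewrite (le_trans (lerD hv h1))// (le_trans (lerD h2 (lexx _)))//.
by rewrite -mulrDl [leRHS]mulrC ler_wpM2r// /L; lra.
Qed.

Section Dirichlet.
Context (c : nat -> C) (s : nat -> R) (M : R) (h : C -> C).
Hypothesis s0 : forall n, 0 <= s n.
Hypothesis cM : forall n, \sum_(i < n) normc (c i) <= M.
Hypothesis hE : forall z, 0 <= complex.Re z <= 1 ->
  series (fun n => c n * cexp (- (s n)%:C * z)) @ \oo --> h z.

Let Re_mulr (a : R) z : complex.Re (- a%:C * z : C) = - (a * complex.Re z).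
Proof. by case: z => x y /=; rewrite oppr0 mul0r subr0 mulNr. Qed.

(** The sign of the frequencies enters here: no exponential exceeds 1 in modulus on the right half
    plane, so [normc (c n)] majorises the terms and the series converges uniformly on the closed
    strip. *)
Let term_le z n : 0 <= complex.Re z ->
  normc (c n * cexp (- (s n)%:C * z)) <= normc (c n).
Proof.
move=> z0; rewrite normcM normc_cexp ler_piMr ?normc_ge0// -expR0 ler_expR.
by rewrite Re_mulr oppr_le0 mulr_ge0.
Qed.

Lemma dirichlet_bounded z : 0 <= complex.Re z <= 1 -> normc (h z) <= M.
Proof.
move=> z01; rewrite -[h z]subr0; apply: (cvgn_normc_le (N := 0) (hE z01)) => n _.
rewrite subr0 /series /= big_mkord (le_trans (normc_sum _ _ _))//.
rewrite (le_trans _ (cM n))// ler_sum// => i _; apply: term_le.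
by case/andP: z01.
Qed.

Let tail_le z N (t : R) : 0 <= complex.Re z <= 1 ->
  (forall n, (N <= n)%N -> \sum_(N <= i < n) normc (c i) <= t) ->
  normc (h z - series (fun n => c n * cexp (- (s n)%:C * z)) N) <= t.
Proof.
move=> z01 H; apply: (cvgn_normc_le (N := N) (hE z01)) => n Nn.
rewrite (le_trans (normc_series_dist _ Nn))// (le_trans _ (H _ Nn))// ler_sum//.
by move=> i _; apply: term_le; case/andP: z01.
Qed.

Lemma dirichlet_continuous : {within closure (@strip R), continuous h}.
Proof.
rewrite closure_strip; apply/within_continuous_normcP => z z01 e e0.
have e3 : 0 < e / 4 by rewrite divr_gt0.
have [N HN] := bounded_series_tail (fun n => normc_ge0 (c n)) cM e3.
have HN' n : (N <= n)%N -> \sum_(N <= i < n) normc (c i) <= e / 4.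
  by move=> /HN/ltW.
have [d d0 Hd] : exists2 d : R, 0 < d & forall w, normc (w - z) < d ->
    normc (series (fun n => c n * cexp (- (s n)%:C * w)) N -
           series (fun n => c n * cexp (- (s n)%:C * z)) N) < e / 4.
  elim: (N) (e / 4) e3 => [|n ih] e' e'0.
    by exists 1 => // w _; rewrite /series /= !big_geq// subrr normc0.
  have e2 : 0 < e' / 2 by rewrite divr_gt0.
  have k0 : 0 < normc (c n) + 1 by rewrite ltr_wpDl// normc_ge0.
  have [d1 d10 H1] := ih _ e2.
  have ek : 0 < e' / 2 / (normc (c n) + 1) by rewrite divr_gt0.
  have [d2 d20 H2] := continuous_cexp (- (s n)%:C) 0 z ek.
  exists (Num.min d1 d2); first by rewrite lt_min d10.
  move=> w; rewrite lt_min => /andP[/H1 h1 /H2].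
  rewrite !addr0 ltr_pdivlMr// => h2.
  rewrite !seriesSr opprD addrACA (le_lt_trans (normcD _ _))// (splitr e') ltrD//.
  rewrite -mulrBr normcM mulrC (le_lt_trans _ h2)// ler_wpM2l ?normc_ge0//.
  by rewrite lerDl.
exists d => // w w01 /Hd wd.
have t1 := tail_le z01 HN'; have t2 := tail_le w01 HN'.
set Sz := series _ N in t1 wd; set Sw := series _ N in t2 wd.
have -> : h w - h z = (h w - Sw) + (Sw - Sz) - (h z - Sz) by ring.
rewrite (le_lt_trans (normcB _ _))//.
by have := normcD (h w - Sw) (Sw - Sz); lra.
Qed.

(** Expanding every exponential at [z0] yields a double series to be rearranged by powers of
    [w = z - z0]. The rearrangement rests on [normc (k j) * expR (s j * r) <= normc (c j)]: within
    the distance of [z0] to the edge no term outgrows [normc (c j)]. The remainders after [N] powers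
    are dominated by [2 * normc (c j)] and tend to 0 for each [j]. *)
Lemma dirichlet_analytic z0 : strip z0 -> analytic_at h z0.
Proof.
move=> /= /andP[z0_0 z0_1].
(* Distance from [z0] to the boundary: the disc stays in the closed strip, where the series
   represents [h]. *)
pose r := Num.min (complex.Re z0) (1 - complex.Re z0).
have r0 : 0 < r by rewrite lt_min z0_0 subr_gt0.
have rle : r <= complex.Re z0 by rewrite ge_min lexx.
have rle1 : r <= 1 - complex.Re z0 by rewrite ge_min lexx orbT.
pose k j := c j * cexp (- (s j)%:C * z0).
pose e j n : C := k j * ((n`!%:R^-1)%:C * (- (s j)%:C) ^+ n).
have kle j : normc (k j) * expR (s j * r) <= normc (c j).
  rewrite /k normcM normc_cexp Re_mulr -mulrA -expRD ler_piMr ?normc_ge0//.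
  by rewrite -expR0 ler_expR addrC -mulrBr mulr_ge0_le0// subr_le0.
have ele j n : normc (e j n) * r ^+ n <= normc (c j).
  rewrite (le_trans _ (kle j))// /e normcM -mulrA ler_wpM2l ?normc_ge0//.
  rewrite normcM normcX normc_real normc_oppr normc_real !ger0_norm ?invr_ge0//.
  rewrite -mulrA -exprMn mulrC.
  (* A single exponential term at the nonnegative real [s j * r] is at most the partial sum that
     ends with it. *)
  have : normc (cexp_poly n.+1 (s j * r)%:C) <= expR (s j * r).
    rewrite (le_trans (cexp_poly_le _ _))// normc_real ger0_norm//.
    by rewrite mulr_ge0// ltW.
  apply: le_trans.
  have -> : cexp_poly n.+1 (s j * r)%:C = (\sum_(i < n.+1) (i`!%:R)^-1 * (s j * r) ^+ i)%:C.
    by rewrite rmorph_sum; apply: eq_bigr => i _; rewrite [RHS]rmorphM (rmorphXn (real_complex R)).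
  have sr0 : 0 <= s j * r by rewrite mulr_ge0// ltW.
  rewrite normc_real ger0_norm; last first.
    by rewrite sumr_ge0// => i _; rewrite mulr_ge0 ?invr_ge0// exprn_ge0.
  rewrite big_ord_recr /= mulrC lerDr sumr_ge0// => i _.
  by rewrite mulr_ge0 ?invr_ge0// exprn_ge0.
have dex n : exists l : C, series (e ^~ n) @ \oo --> l.
  apply: (@abs_cvg_series _ (M / r ^+ n)) => m.
  rewrite ler_pdivlMr ?exprn_gt0// mulr_suml (le_trans _ (cM m))//.
  by apply: ler_sum => i _; exact: ele.
have [d dE] := choice dex.
exists d, r; split => // z zr.
set w := z - z0 in zr *.
have zE : z = z0 + w by rewrite /w addrC subrK.
clearbody w.
have z01 : 0 <= complex.Re z <= 1.
  rewrite zE ReD; have := le_lt_trans (normc_Re w) zr.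
  by rewrite ltr_norml => /andP[a b]; apply/andP; split; lra.
pose rho j N := k j * (cexp (- (s j)%:C * w) - cexp_poly N (- (s j)%:C * w)).
have rhole j N : normc (rho j N) <= 2 * normc (c j).
  rewrite /rho normcM (le_trans _ (ler_wpM2l _ (kle j)))// mulrCA.
  rewrite ler_wpM2l ?normc_ge0// (le_trans (normcB _ _))//.
  have lw : expR (normc (- (s j)%:C * w)) <= expR (s j * r).
    rewrite ler_expR normcM normc_oppr normc_real ger0_norm// ler_wpM2l//.
    exact: ltW.
  rewrite mulr_natl mulr2n lerD//; last exact: le_trans (cexp_poly_le _ _) lw.
  rewrite normc_cexp (le_trans _ lw)// ler_expR (le_trans (ler_norm _))//.
  exact: normc_Re.
have lim N : series (rho ^~ N) @ \oo --> h z - series (fun n => d n * w ^+ n) N.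
  have -> : series (rho ^~ N) = (fun m =>
      series (fun n => c n * cexp (- (s n)%:C * z)) m -
      \sum_(n < N) (series (e ^~ n) m * w ^+ n)).
    apply/funext => m; rewrite /series /=.
    under [X in _ = _ - X]eq_bigr do rewrite mulr_suml.
    rewrite exchange_big /= -sumrB; apply: eq_bigr => j _.
    rewrite /rho mulrBr /k zE mulrDr cexpD mulrA; congr (_ - _).
    rewrite /cexp_poly mulr_sumr; apply: eq_bigr => i _.
    by rewrite /e /k exprMn !mulrA.
  apply: cvgB; first exact: hE.
  rewrite /series /= big_mkord; elim: N => [|N ih].
    by under eq_fun do rewrite big_ord0; rewrite big_ord0; exact: cvg_cst.
  under eq_fun do rewrite big_ord_recr /=; rewrite big_ord_recr /=.
  exact: (cvgD ih (cvgM (dE N) (cvg_cst _))).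
apply/cvgn_normcP => eps eps0.
have eps4 : 0 < eps / 8 by rewrite divr_gt0.
(* Dominated convergence by hand: from [J] on the remainders contribute at most [2 * (eps / 8)] for
   every [N]; below [J] there are finitely many, made small by the choice of [N0]. *)
have [J HJ] := bounded_series_tail (fun n => normc_ge0 (c n)) cM eps4.
have [N0 HN0] : exists N0, forall N, (N0 <= N)%N ->
    \sum_(j < J) normc (rho j N) < eps / 4.
  have : 0 < eps / 4 by rewrite divr_gt0.
  elim: (J) (eps / 4) => [|m ih] e' e'0.
    by exists 0%N => N _; rewrite big_ord0.
  have e2 : 0 < e' / 2 by rewrite divr_gt0.
  have [N1 H1] := ih _ e2.
  have k0 : 0 < normc (k m) + 1 by rewrite ltr_wpDl// normc_ge0.
  have ek : 0 < e' / 2 / (normc (k m) + 1) by rewrite divr_gt0.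
  have [N2 H2] := cexp_poly_cvg (- (s m)%:C * w) ek.
  exists (maxn N1 N2) => N; rewrite geq_max => /andP[/H1 h1 /H2].
  rewrite ltr_pdivlMr// => h2.
  rewrite big_ord_recr /= (splitr e') ltrD// /rho normcM mulrC.
  by rewrite (le_lt_trans _ h2)// ler_wpM2l ?normc_ge0// lerDl.
exists N0 => N NN0; rewrite normc_distC.
apply: (@le_lt_trans _ _ (eps / 2)); last by lra.
rewrite -[_ - _]subr0; apply: (cvgn_normc_le (N := J) (lim N)) => m Jm.
rewrite subr0 /series /= (le_trans (normc_sum _ _ _))//.
rewrite (big_cat_nat (n:=J))//= big_mkord.
have t1 := HN0 _ NN0.
have t2 : \sum_(J <= i < m) normc (rho i N) <= 2 * \sum_(J <= i < m) normc (c i).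
  by rewrite mulr_sumr ler_sum// => i _; exact: rhole.
have := HJ _ Jm; set T := \sum_(J <= i < m) normc (c i) in t2 *; lra.
Qed.

End Dirichlet.
End DirichletSeries.

(** * The dyadic filtration of the tree *)

Lemma xget_eq {T : choiceType} (x0 : T) (P : set T) : P !=set0 -> P (xget x0 P).
Proof. by move=> [x Px]; exact: xgetPex (ex_intro _ x Px). Qed.

(** Cardinality at most [N], with an injection defined on all of [T] and constrained only on [A]:
    codes can then be combined arithmetically, and an induction on [N] removes one code at a
    time. *)
Definition small_set {T : Type} (A : set T) (N : nat) : Prop :=
  exists g : T -> nat, (forall x, A x -> (g x < N)%N) /\
    (forall x y, A x -> A y -> g x = g y -> x = y).

Section TreeCombinatorics.
Context {V : choiceType} (adj : rel V) (q : nat).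
Hypothesis htree : homogeneous_tree adj q.
Variable o : V.

Local Notation lev := (gdist adj o).
Local Notation pre := (predecessor adj o).

Lemma gdistP x y :
  walk adj x y (gdist adj x y) /\ forall m, walk adj x y m -> (gdist adj x y <= m)%N.
Proof.
apply: (@xget_eq _ 0%N
  [set n | walk adj x y n /\ forall m, walk adj x y m -> (n <= m)%N]).
have [s ps <-] := adj_connected htree x y.
have exW : exists n, `[< walk adj x (last x s) n >].
  by exists (size s); apply/asboolP; exists s.
case: (ex_minnP exW) => n /asboolP Wn Hn; exists n; split => // m Wm.
by apply: Hn; apply/asboolP.
Qed.

Lemma lev_o : lev o = 0%N.
Proof.
apply/eqP; rewrite -leqn0; have [_] := gdistP o o; apply.
by exists [::].
Qed.

Lemma lev_eq0 x : lev x = 0%N -> x = o.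
Proof.
move=> lx; have [+ _] := gdistP o x; rewrite lx => -[s _ [<-]].
by move/eqP; rewrite size_eq0 => /eqP ->.
Qed.

Lemma pre_o : pre o = o.
Proof.
rewrite /predecessor; apply: xgetPN => y [_]; by rewrite lev_o.
Qed.

(** The vertex before [x] on a shortest walk from the origin lies one level lower, so the set that
    defines [predecessor] is nonempty and the default is not taken. *)
Lemma preP x : x <> o -> adj x (pre x) /\ (lev (pre x)).+1 = lev x.
Proof.
move=> xo; apply: (@xget_eq _ o [set y | adj x y /\ (gdist adj o y).+1 = gdist adj o x]).
have [[s ps [sx ss]] Hmin] := gdistP o x.
case/lastP: s => [|s y] in ps sx ss *; first by case: xo.
rewrite last_rcons in sx; rewrite sx rcons_path in ps.
case/andP: ps => ps ax.
exists (last o s); split; first by rewrite (adj_sym htree).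
have [[s' ps' [sx' ss']] Hmin'] := gdistP o (last o s).
apply/eqP; rewrite eqn_leq -ss size_rcons ltnS Hmin' /=; last by exists s.
rewrite -(size_rcons s y) ss; apply: Hmin; exists (rcons s' x).
  by rewrite rcons_path ps' sx'.
by rewrite last_rcons size_rcons ss'.
Qed.

Lemma lev_pre x : lev (pre x) = (lev x).-1.
Proof.
have [->|/eqP xo] := eqVneq x o; first by rewrite pre_o lev_o.
by have [_ <-] := preP xo.
Qed.

Lemma lev_iter l x : lev (iter l pre x) = (lev x - l)%N.
Proof. by elim: l => [|l ih]; rewrite ?subn0//= lev_pre ih subnS. Qed.

(** Iterates drop one level at a time until they reach [o] and stay there: equal positive levels
    force equal exponents, and level 0 contains only [o]. *)
Lemma iter_pre_eq l l' x : lev (iter l pre x) = lev (iter l' pre x) ->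
  iter l pre x = iter l' pre x.
Proof.
wlog ll : l l' / (l <= l')%N => [W|].
  by have [/W//|/ltnW/W W' /esym/W' ->] := leqP l l'.
rewrite !lev_iter => E.
have [l'x|xl'] := leqP l' (lev x).
  by congr iter; rewrite -(subKn (leq_trans ll l'x)) E subKn.
have E0 : (lev x - l' = 0)%N by apply/eqP; rewrite subn_eq0 ltnW.
have -> : iter l' pre x = o by apply: lev_eq0; rewrite lev_iter.
by apply: lev_eq0; rewrite lev_iter E.
Qed.

(** From generation [n] to [n + 1] a sector whose root [v] has level [n] splits into the point [v]
    and the sectors of its children, while points stay points. Each [x] is thus a block of its own
    from generation [lev x + 1] on. *)
Definition block (n : nat) (x : V) : set V :=
  if (n <= lev x)%N then sector adj o (iter (lev x - n) pre x) else [set x].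

Lemma block_self n x : block n x x.
Proof. by rewrite /block; case: ifP => // _; exists (lev x - n)%N. Qed.

Lemma block0 x : block 0 x = setT.
Proof.
rewrite /block /= subn0; apply/seteqP; split => // y _; exists (lev y).
apply: (@etrans _ _ o); first by apply: lev_eq0; rewrite lev_iter subnn.
by apply/esym/lev_eq0; rewrite lev_iter subnn.
Qed.

Lemma block_eq n x y : block n x y -> block n y = block n x.
Proof.
rewrite {1}/block; case: ifPn => [nx [l vE]|_ -> //].
have lE : (lev y - l = n)%N.
  by rewrite -lev_iter vE lev_iter subKn.
have ny : (n <= lev y)%N by rewrite -lE leq_subr.
rewrite /block nx ny -vE; congr sector; apply: iter_pre_eq.
by rewrite !lev_iter subKn// lE.
Qed.

Lemma block_subset n x : block n.+1 x `<=` block n x.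
Proof.
rewrite {1}/block; case: ifPn => [nx|_ y ->]; last exact: block_self.
move=> y [l yE]; rewrite /block (ltnW nx); exists l.+1.
by rewrite /= yE -iterS subnSK.
Qed.

Lemma block_end n x : (lev x < n)%N -> block n x = [set x].
Proof. by rewrite /block ltnNge => /negbTE ->. Qed.

Lemma dyadic_block n x : dyadic adj o (block n x).
Proof.
rewrite /block; case: ifP => _; last by exists x; left.
by eexists; right.
Qed.

(** The condition on the level excludes the default [predecessor o = o], through which [o] would be
    its own descendant for every [k]. *)
Definition descendants (k : nat) (v : V) : set V :=
  [set y | iter k pre y = v /\ lev y = (lev v + k)%N].

Lemma sector_descendants v : sector adj o v = \bigcup_k descendants k v.
Proof.
apply/seteqP; split => [y [l yE]|y [k _ [yE _]]]; last by exists k.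
have [ly|yl] := leqP l (lev y).
  by exists l => //; split => //; rewrite -yE lev_iter subnK.
have vo : v = o.
  apply: lev_eq0; rewrite -yE lev_iter; apply/eqP.
  by rewrite subn_eq0 ltnW.
exists (lev y) => //; split; last by rewrite vo lev_o.
by rewrite vo; apply: lev_eq0; rewrite lev_iter subnn.
Qed.

Lemma small_adj x : small_set [set y | adj x y] q.+1.
Proof.
have := adj_degree htree x; rewrite card_eq_le => /andP[/pcard_leP/unsquash f _].
exists f; split => [y /= xy|y z /= xy xz].
  exact: (@funS _ _ _ _ f).
by move=> /(@inj _ _ _ f); apply; rewrite inE.
Qed.

Lemma small_children z : z <> o ->
  small_set [set y | adj z y /\ lev y = (lev z).+1] q.
Proof.
move=> zo; have [az lz] := preP zo; have [g [gq ginj]] := small_adj z.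
(* [unbump] closes the gap left in the codes of the [q.+1] neighbours by the predecessor of [z],
   which is not a child. *)
exists (fun y => unbump (g (pre z)) (g y)); split => [y [zy ly]|y y' [zy ly] [zy' ly']].
  have ne : g y != g (pre z).
    by apply/eqP => /(ginj _ _ zy az) yE; move: lz ly; rewrite yE; lia.
  have := gq _ zy; have := gq _ az; rewrite /unbump; move: ne.
  by case: ltngtP => //=; lia.
have ne u : adj z u -> lev u = (lev z).+1 -> g (pre z) != g u.
  move=> zu lu; apply/eqP => /esym/(ginj _ _ zu az) uE.
  by move: lz lu; rewrite uE; lia.
move=> E; apply: ginj => //.
have := unbumpK (h := g (pre z)); move=> K.
by rewrite -(K (g y)) ?inE 1?eq_sym ?ne// E K// inE eq_sym ne.
Qed.

Hypothesis q2 : (1 < q)%N.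

(** A generation is coded in mixed radix by the code of the predecessor and the code among its
    children. Only in the first step can the predecessor be [o], with [q.+1] children instead of
    [q]; the factor [q.+1] absorbs that step. *)
Lemma small_descendants k v : small_set (descendants k v) (q.+1 * q ^ k).
Proof.
elim: k => [|k [g [gb ginj]]].
  exists (fun=> 0%N); split => [x _|x y [/= -> _] [/= -> _] //].
  by rewrite muln_gt0.
have step N M : small_set (descendants k v) N ->
    (forall z, descendants k v z ->
       small_set [set y | adj z y /\ lev y = (lev z).+1] M) ->
    small_set (descendants k.+1 v) (N * M).
  move=> [f [fN finj]] H.
  have Hz z : exists h : V -> nat, descendants k v z ->
      (forall y, adj z y /\ lev y = (lev z).+1 -> (h y < M)%N) /\
      (forall y y', adj z y /\ lev y = (lev z).+1 ->
         adj z y' /\ lev y' = (lev z).+1 -> h y = h y' -> y = y').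
    have [/H[h Hh]|nz] := pselect (descendants k v z); first by exists h.
    by exists (fun=> 0%N).
  have [h hP] := choice Hz.
  have D y : descendants k.+1 v y -> descendants k v (pre y) /\
      (adj (pre y) y /\ lev y = (lev (pre y)).+1).
    move=> [yE ly]; have yo : y <> o.
      by move=> yo; move: ly; rewrite yo lev_o addnS.
    have [ay lpy] := preP yo; split; last by rewrite (adj_sym htree) lpy.
    split; first by rewrite -iterSr.
    by apply: succn_inj; rewrite lpy ly addnS.
  exists (fun y => f (pre y) * M + h (pre y) y)%N; split.
    move=> y /D[Dp ch]; have [hM _] := hP _ Dp.
    have := hM _ ch; have := fN _ Dp; nia.
  move=> y y' /D[Dp ch] /D[Dp' ch'] E.
  have [hM hinj] := hP _ Dp; have [hM' _] := hP _ Dp'.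
  have h1 := hM _ ch; have h2 := hM' _ ch'.
  have fE : f (pre y) = f (pre y') by nia.
  have pE : pre y = pre y' by exact: finj.
  apply: hinj => //; first by rewrite pE.
  by move: E; rewrite fE pE => /addnI.
have [k0|kn0] := eqVneq k 0%N.
  have [g' Hg'] : small_set (descendants k v) 1.
    rewrite k0; exists (fun=> 0%N); split => [//|x y [/= -> _] [/= -> _] //].
  have [|h [hb hinj]] := step 1%N q.+1 (ex_intro _ g' Hg').
    move=> z _; have [h [hb hinj]] := small_adj z; exists h; split.
      by move=> y [/hb].
    by move=> y y' [ay _] [ay' _]; exact: hinj.
  exists h; split => // x /hb hx; rewrite (leq_trans hx)// mul1n leq_pmulr//.
  by rewrite expn_gt0 (ltnW q2).
rewrite expnSr mulnA; apply: step; first by exists g.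
move=> z [_ lz]; apply: small_children => zo.
by move: lz; rewrite zo lev_o; lia.
Qed.

(** Every level is finite, so a vertex is coded by its level and its code within that level; these
    codes later label the stopping blocks. *)
Lemma countable_tree : exists code : V -> nat, injective code.
Proof.
have [g gP] := choice (fun k => small_descendants k o).
have D x : descendants (lev x) o x.
  split; last by rewrite lev_o.
  by apply: lev_eq0; rewrite lev_iter subnn.
exists (fun x => pickle (lev x, g (lev x) x)) => x y.
move=> /(pcan_inj pickleK)[lE gE]; have [_ ginj] := gP (lev x).
by apply: ginj; [exact: D|rewrite lE; exact: D|rewrite gE lE].
Qed.

End TreeCombinatorics.

(** * Measures of sectors and blocks *)

Section TreeMeasure.
Context {R : realType} {V : choiceType} (adj : rel V) (q : nat).
Hypothesis q2 : (1 < q)%N.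
Hypothesis htree : homogeneous_tree adj q.
Variables (o : V) (alpha : R).
Hypothesis alpha1 : 1 < alpha.

Local Notation lev := (gdist adj o).
Local Notation mu := (@mu_alpha R V adj o q alpha).
Local Notation wt := (@weight R V adj o q alpha).
Implicit Types (x : rooted o) (A : set (rooted o)).
Local Opaque gdist.

Let qR0 : 0 < q%:R :> R. Proof. by rewrite ltr0n ltnW. Qed.


Lemma weight_gt0 x : 0 < wt x.
Proof. by rewrite powR_gt0. Qed.

Lemma weight_lev x n k : lev x = (n + k)%N ->
  wt x = q%:R `^ (- (alpha * n%:R)) * (q%:R `^ (- alpha)) ^+ k.
Proof.
move=> lx; rewrite /weight lx natrD mulrDr opprD powRD; last first.
  by rewrite (gt_eqF qR0) implybT.
by rewrite -(mulNr alpha k%:R) (powRrM _ _ k%:R) powR_mulrn// powR_ge0.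
Qed.

Lemma mu_set1 x : mu [set x] = (wt x)%:E.
Proof. by rewrite /mu_alpha esum_set1// lee_fin ltW// weight_gt0. Qed.

Lemma mu_small N (w : R) A : 0 <= w -> small_set A N ->
  (forall x, A x -> wt x <= w) -> (mu A <= (N%:R * w)%:E)%E.
Proof.
move=> w0; elim: N A => [|N ih] A [g [gN ginj]] Aw.
  have -> : A = set0 by apply/seteqP; split => // x /gN.
  by rewrite measure0 mul0r.
have -> : A = (A `&` [set x | (g x < N)%N]) `|` (A `&` [set x | g x = N]).
  apply/seteqP; split => [x Ax|x [[]//|[]//]].
  have := gN _ Ax; rewrite ltnS leq_eqVlt => /orP[/eqP gx|gx]; [by right|by left].
have h1 : (mu (A `&` [set x | (g x < N)%N]) <= (N%:R * w)%:E)%E.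
  apply: ih; last by move=> x [/Aw].
  by exists g; split => [x []//|x y [Ax _] [Ay _]]; exact: ginj.
have h2 : (mu (A `&` [set x | g x = N]) <= w%:E)%E.
  have [->|/set0P[x [Ax gx]]] := eqVneq (A `&` [set x | g x = N]) set0.
    by rewrite measure0.
  have -> : A `&` [set x | g x = N] = [set x].
    apply/seteqP; split => [y [Ay gy]|_ ->//].
    by apply: ginj => //; rewrite gx gy.
  by rewrite mu_set1 lee_fin Aw.
rewrite -natr1 mulrDl mul1r EFinD.
apply: (le_trans (measureU2 _ _ _)) => //.
exact: leeD.
Qed.

(** The [k]-th generation below [v] has at most [q.+1 * q ^ k] points, each of weight
    [wt v * q ^ (- alpha k)]: its mass decays like [ratio ^+ k], and [alpha > 1] gives [ratio < 1].
    The geometric series sums to the constant [Ksec]. *)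
Let ratio : R := q%:R `^ (1 - alpha).

Let ratio01 : 0 <= ratio < 1.
Proof.
rewrite /ratio powR_ge0 /=.
rewrite /powR (gt_eqF qR0) -[ltRHS]expR0 ltr_expR nmulr_rlt0 ?subr_lt0//.
by rewrite ln_gt0// ltr1n.
Qed.

Let Ksec : R := q.+1%:R / (1 - ratio).

Lemma mu_sector (v : V) :
  (mu (sector adj o v) <= (Ksec * wt (v : rooted o))%:E)%E.
Proof.
rewrite (sector_descendants htree).
have bound k : (mu (descendants adj o k v) <=
    (q.+1%:R * wt (v : rooted o) * ratio ^+ k)%:E)%E.
  apply: (le_trans (mu_small _ (small_descendants htree o q2 k v)
      (w := wt (v : rooted o) * (q%:R `^ (- alpha)) ^+ k) _)).
  - by rewrite (mulr_ge0 (ltW (weight_gt0 _)))// exprn_ge0// powR_ge0.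
  - by move=> x [_ lx]; rewrite (weight_lev lx).
  rewrite lee_fin natrM natrX -!mulrA ler_wpM2l// mulrCA ler_wpM2l ?(ltW (weight_gt0 _))//.
  by rewrite -exprMn /ratio powRD ?(gt_eqF qR0) ?implybT// powRr1// ltW.
apply: (@le_trans _ _ (\sum_(k <oo) mu (descendants adj o k v))%E).
  exact: (@generalized_Boole_inequality _ _ _ mu (fun k => descendants adj o k v)).
apply: lime_le.
  by apply: is_cvg_nneseries => n _ _; exact: measure_ge0.
apply: nearW => n.
apply: (@le_trans _ _ (\sum_(0 <= k < n) (q.+1%:R * wt (v : rooted o) * ratio ^+ k)%:E)%E).
  by apply: lee_sum => k _; exact: bound.
have [r0 r1] := andP ratio01.
rewrite sumEFin lee_fin -mulr_sumr /Ksec [leRHS]mulrAC -mulrA.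
rewrite [leRHS]mulrA ler_wpM2l//.
  by rewrite mulr_ge0// ltW// weight_gt0.
rewrite -[leRHS]mul1r ler_pdivlMr ?subr_gt0//.
rewrite mulrC big_mkord -[leLHS](_ : 1 - ratio ^+ n = _); last first.
  by rewrite -{1}(expr1n _ n) subrXX; congr (_ * _); apply: eq_bigr => i _;
    rewrite expr1n mul1r.
by rewrite lerBlDr lerDl exprn_ge0.
Qed.

Lemma mu_finite : (mu setT < +oo)%E.
Proof.
rewrite -(block0 htree o o) /block leq0n subn0 (lev_o htree).
by rewrite (le_lt_trans (mu_sector _))// ltry.
Qed.

(** Three cases: a sector against the sector of a child, whose root is lighter by the factor
    [q ^ alpha]; a sector against its own root; a point against itself. In the first two the smaller
    block is bounded below by the weight of its root. *)
Lemma mu_block_doubling : exists2 K : R, 1 <= K & forall n x,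
  (mu (block adj o n x) <= K%:E * mu (block adj o n.+1 x))%E.
Proof.
have [r0 r1] := andP ratio01.
have K1 : 1 <= Ksec.
  rewrite /Ksec ler_pdivlMr ?subr_gt0// mul1r.
  by rewrite (le_trans (y := 1))// ?ler1n// lerBlDr lerDl.
have qa : 1 <= q%:R `^ alpha.
  rewrite -[leLHS](powRr0 q%:R) ler_powR ?ler1n ?(ltnW q2)//.
  exact/ltW/(lt_trans ltr01).
exists (Ksec * q%:R `^ alpha) => [|n x]; first exact: mulr_ege1 K1 qa.
have Kq0 : 0 <= Ksec * q%:R `^ alpha by rewrite mulr_ge0// (le_trans ler01).
have [nx|xn] := ltnP n (lev x).
  rewrite {1}/block (ltnW nx); apply: (le_trans (mu_sector _)).
  set v := iter _ _ _; set v' := iter (lev x - n.+1) (predecessor adj o) x.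
  have lv' : lev v' = (lev v + 1)%N.
    by rewrite /v /v' !(lev_iter htree) !subKn ?addn1// ltnW.
  have -> : (Ksec * wt (v : rooted o))%:E = ((Ksec * q%:R `^ alpha)%:E * (wt (v' : rooted o))%:E)%E.
    have wv : wt (v' : rooted o) = wt (v : rooted o) * q%:R `^ (- alpha).
      by rewrite (weight_lev lv') expr1.
    rewrite -EFinM wv powRN; congr EFin; field.
    by rewrite gt_eqF// powR_gt0.
  rewrite lee_pmul2l// ?lte_fin ?(lt_le_trans ltr01) ?(mulr_ege1 K1 qa)//.
  rewrite -mu_set1; apply: le_measure; rewrite ?inE// => y ->.
  by rewrite /block nx; exists 0%N.
move: (xn); rewrite leq_eqVlt => /orP[/eqP lx|lx]; last first.
  rewrite !(block_end)// ?ltnS// -[leLHS]mul1e lee_pmul//.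
  by rewrite lee_fin (mulr_ege1 K1 qa).
rewrite (@block_end _ adj o n.+1 x) ?ltnS// mu_set1 {1}/block -lx leqnn subnn /=.
apply: (le_trans (mu_sector _)).
rewrite -EFinM lee_fin; apply: ler_wpM2r; first exact: ltW (weight_gt0 _).
by rewrite ler_peMr// (le_trans ler01 K1).
Qed.

End TreeMeasure.

(** * Calderon-Zygmund decomposition *)

Section DiscreteIntegral.
Context d (T : measurableType d) {R : realType}.
Variable mu : {measure set T -> \bar R}.
Hypothesis mall : forall A : set T, measurable A.
Hypothesis mufin : (mu setT < +oo)%E.
Local Notation C := (Cplx R).
Implicit Types (A B D E : set T) (u v : T -> R) (f g : T -> C).

Definition rintegrable u := mu.-integrable setT (EFin \o u).

Let rS u D : rintegrable u -> mu.-integrable D (EFin \o u).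
Proof. by move=> ui; apply: (integrableS measurableT (mall D) _ ui). Qed.

Lemma mu_fin_num A : mu A \is a fin_num.
Proof.
rewrite ge0_fin_numE//; apply: le_lt_trans mufin.
by apply: le_measure; rewrite ?inE//; exact: mall.
Qed.

Lemma rintegrable_le u v :
  (forall x, `|u x| <= `|v x|) -> rintegrable v -> rintegrable u.
Proof.
move=> uv vi; apply: (le_integrable measurableT _ _ vi).
  by move=> _ B _; exact: mall.
by move=> x _; rewrite /= lee_fin.
Qed.

Lemma rintegrable_cst (k : R) : rintegrable (fun=> k).
Proof.
apply/integrableP; split; first by move=> _ B _; exact: mall.
rewrite (eq_integral (fun=> `|k|%:E))// integral_cst//.
by rewrite -(fineK (mu_fin_num setT)) -EFinM ltry.
Qed.

Lemma rintegrable_bounded u (k : R) : (forall x, `|u x| <= k) -> rintegrable u.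
Proof.
move=> uk; apply: rintegrable_le (rintegrable_cst k) => x.
by rewrite (le_trans (uk x))// ler_norm.
Qed.

Lemma rintegrableD u v : rintegrable u -> rintegrable v ->
  rintegrable (fun x => u x + v x).
Proof. by move=> ui vi; apply: (integrableD measurableT ui vi). Qed.

Lemma rintegrableZ (k : R) u : rintegrable u -> rintegrable (fun x => k * u x).
Proof. by move=> ui; apply: (integrableZl measurableT k ui). Qed.

Lemma rintegrable_ge0P u : (forall x, 0 <= u x) ->
  rintegrable u <-> (\int[mu]_x (u x)%:E < +oo)%E.
Proof.
move=> u0; have E : (\int[mu]_x `|(u x)%:E| = \int[mu]_x (u x)%:E)%E.
  by apply: eq_integral => x _; rewrite gee0_abs// lee_fin.
split=> [/integrableP[_]|h]; first by rewrite E.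
by apply/integrableP; split; [by move=> _ B _; exact: mall|rewrite E].
Qed.

Lemma EFin_Rintegral D u : rintegrable u ->
  (\int[mu]_(x in D) u x)%:E = (\int[mu]_(x in D) (u x)%:E)%E.
Proof.
move=> ui; rewrite /Rintegral fineK//; apply: integrable_fin_num => //.
exact: rS.
Qed.

Lemma RintD D u v : rintegrable u -> rintegrable v ->
  \int[mu]_(x in D) (u x + v x) = \int[mu]_(x in D) u x + \int[mu]_(x in D) v x.
Proof. by move=> ui vi; apply: RintegralD => //; exact: rS. Qed.

Lemma RintZ D (k : R) u : rintegrable u ->
  \int[mu]_(x in D) (k * u x) = k * \int[mu]_(x in D) u x.
Proof. by move=> ui; apply: RintegralZl => //; exact: rS. Qed.

Lemma Rint_le D u v : rintegrable u -> rintegrable v ->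
  (forall x, D x -> u x <= v x) ->
  \int[mu]_(x in D) u x <= \int[mu]_(x in D) v x.
Proof. by move=> ui vi; apply: le_Rintegral => //; exact: rS. Qed.

Lemma Rint_eq D u v : (forall x, D x -> u x = v x) ->
  \int[mu]_(x in D) u x = \int[mu]_(x in D) v x.
Proof. by move=> uv; apply: eq_Rintegral => x; rewrite inE; exact: uv. Qed.

Lemma Rint_cst D (k : R) : \int[mu]_(x in D) k = k * fine (mu D).
Proof. exact: Rintegral_cst. Qed.

Lemma Rint_split D E u : rintegrable u ->
  \int[mu]_(x in D) u x =
  \int[mu]_(x in D `&` E) u x + \int[mu]_(x in D `\` E) u x.
Proof.
move=> ui; rewrite -Rintegral_setU//.
- by rewrite setUIDK.
- exact: rS.
- by apply/disj_setPS => x [[_ ?] [_ ?]].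
Qed.

Lemma Rint_subset D E u : rintegrable u -> (forall x, 0 <= u x) -> D `<=` E ->
  \int[mu]_(x in D) u x <= \int[mu]_(x in E) u x.
Proof.
move=> ui u0 DE; rewrite (Rint_split E D ui).
have -> : E `&` D = D by apply/seteqP; split => [x []//|x Dx]; split => //; exact: DE.
by rewrite lerDl Rintegral_ge0.
Qed.

(** The labels cut [E] into countably many disjoint pieces, and bounds between integrals proved on
    each piece add up over [E]. Later the nonempty pieces are stopping blocks. *)
Definition piece (E : set T) (lab : T -> nat) n := E `&` [set x | lab x = n].

Lemma Rint_pieces_le E lab u v : rintegrable u -> rintegrable v ->
  (forall n, \int[mu]_(x in piece E lab n) u x <=
             \int[mu]_(x in piece E lab n) v x) ->
  \int[mu]_(x in E) u x <= \int[mu]_(x in E) v x.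
Proof.
move=> ui vi H.
pose w x := v x + (-1) * u x.
have wi : rintegrable w by apply: rintegrableD => //; exact: rintegrableZ.
have wE D : \int[mu]_(x in D) w x = \int[mu]_(x in D) v x - \int[mu]_(x in D) u x.
  by rewrite RintD ?RintZ ?mulN1r//; exact: rintegrableZ.
rewrite -subr_ge0 -wE -lee_fin EFin_Rintegral//.
have -> : E = \bigcup_n piece E lab n.
  by apply/seteqP; split => [x Ex|x [n _ []]//]; exists (lab x).
rewrite integral_bigcup//.
- apply: nneseries_ge0 => n _ _.
  by rewrite -EFin_Rintegral// lee_fin wE subr_ge0.
- by move=> i j _ _ [x [[_ <-] [_ <-]]].
- exact: rS.
Qed.

Definition cintegrable f := rintegrable (fun x => normc (f x)).

Definition cint D f : C :=
  (\int[mu]_(x in D) complex.Re (f x)) +i* (\int[mu]_(x in D) complex.Im (f x)).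

Lemma cintegrable_le f (v : T -> R) :
  (forall x, normc (f x) <= v x) -> rintegrable v -> cintegrable f.
Proof.
move=> fv; apply: rintegrable_le => x.
by rewrite ger0_norm ?normc_ge0// (le_trans (fv x))// ler_norm.
Qed.

Lemma cintegrable_bounded f (k : R) : (forall x, normc (f x) <= k) -> cintegrable f.
Proof. by move=> fk; apply: (cintegrable_le fk); exact: rintegrable_cst. Qed.

Lemma cintegrableD f g : cintegrable f -> cintegrable g ->
  cintegrable (fun x => f x + g x).
Proof.
move=> fi gi; apply: (cintegrable_le (fun x => normcD (f x) (g x))).
exact: rintegrableD.
Qed.

Lemma cintegrableMb f g (k : R) : (forall x, normc (f x) <= k) ->
  cintegrable g -> cintegrable (fun x => f x * g x).
Proof.
move=> fk gi; apply: (@cintegrable_le _ (fun x => k * normc (g x))).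
  by move=> x; rewrite normcM ler_wpM2r// normc_ge0.
exact: rintegrableZ.
Qed.

Lemma cintegrableZ (c : C) f : cintegrable f -> cintegrable (fun x => c * f x).
Proof. by move=> fi; exact: (cintegrableMb (k := normc c)). Qed.

Lemma rintegrable_Re f : cintegrable f -> rintegrable (fun x => complex.Re (f x)).
Proof.
apply: rintegrable_le => x; rewrite (le_trans (normc_Re _))//.
by rewrite ger0_norm// normc_ge0.
Qed.

Lemma rintegrable_Im f : cintegrable f -> rintegrable (fun x => complex.Im (f x)).
Proof.
apply: rintegrable_le => x; rewrite (le_trans (normc_Im _))//.
by rewrite ger0_norm// normc_ge0.
Qed.

Lemma cint_eq D f g : (forall x, D x -> f x = g x) -> cint D f = cint D g.
Proof.
by move=> fg; congr (_ +i* _); apply: Rint_eq => x /fg ->.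
Qed.

Lemma cintD D f g : cintegrable f -> cintegrable g ->
  cint D (fun x => f x + g x) = cint D f + cint D g.
Proof.
move=> fi gi; rewrite /cint.
under [in LHS]Rint_eq do rewrite ReD.
rewrite RintD; [|exact: rintegrable_Re..].
have -> : \int[mu]_(x in D) complex.Im (f x + g x) =
    \int[mu]_(x in D) (complex.Im (f x) + complex.Im (g x)).
  by apply: Rint_eq => x _; rewrite ImD.
by rewrite RintD; [|exact: rintegrable_Im..].
Qed.

Lemma cintZ D (c : C) f : cintegrable f ->
  cint D (fun x => c * f x) = c * cint D f.
Proof.
move=> fi; case: c => a b.
have fR := rintegrable_Re fi; have fI := rintegrable_Im fi.
have -> : cint D (fun x => (a +i* b) * f x) =
    (\int[mu]_(x in D) (a * complex.Re (f x) + (- b) * complex.Im (f x))) +i*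
    (\int[mu]_(x in D) (a * complex.Im (f x) + b * complex.Re (f x))).
  congr (_ +i* _); apply: Rint_eq => x _; case: (f x) => s t /=.
    by rewrite mulNr.
  by [].
rewrite !RintD ?RintZ//; try exact: rintegrableZ.
by rewrite /cint; apply/eqP; rewrite eq_complex /= mulNr !eqxx.
Qed.

Lemma cintB D f g : cintegrable f -> cintegrable g ->
  cint D (fun x => f x - g x) = cint D f - cint D g.
Proof.
move=> fi gi; rewrite -[X in _ = _ + X]mulN1r -cintZ// -cintD//.
  by apply: cint_eq => x _; rewrite mulN1r.
exact: cintegrableZ.
Qed.

Lemma cint_sum D (I : Type) (s : seq I) (F : I -> T -> C) :
  (forall i, cintegrable (F i)) ->
  cintegrable (fun x => \sum_(i <- s) F i x) /\
  cint D (fun x => \sum_(i <- s) F i x) = \sum_(i <- s) cint D (F i).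
Proof.
move=> Fi; elim: s => [|i s [ih1 ih2]].
  rewrite big_nil; split.
    by apply: (@cintegrable_bounded _ 0) => x; rewrite big_nil normc0.
  rewrite /cint (_ : 0 = 0 +i* 0)//; congr (_ +i* _).
    by under Rint_eq do rewrite big_nil /=; rewrite Rint_cst mul0r.
  by under Rint_eq do rewrite big_nil /=; rewrite Rint_cst mul0r.
have E : (fun x => \sum_(i <- i :: s) F i x) = fun x => F i x + \sum_(i <- s) F i x.
  by apply/funext => x; rewrite big_cons.
by rewrite E big_cons -ih2; split; [exact: cintegrableD|exact: cintD].
Qed.

Lemma cint_cst D (c : C) : cint D (fun=> c) = c * (fine (mu D))%:C.
Proof.
rewrite /cint !Rint_cst; case: c => a b; apply/eqP.
by rewrite eq_complex /= !mulr0 subr0 add0r !eqxx.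
Qed.

Lemma cint_split D E f : cintegrable f ->
  cint D f = cint (D `&` E) f + cint (D `\` E) f.
Proof.
move=> fi; rewrite /cint (Rint_split D E (rintegrable_Re fi)).
by rewrite (Rint_split D E (rintegrable_Im fi)).
Qed.

Lemma cint_set0 f : cint set0 f = 0.
Proof. by rewrite /cint !Rintegral_set0. Qed.

Lemma cint_restrict D E f : cintegrable f -> (forall x, D x -> ~ E x -> f x = 0) ->
  cint D f = cint (D `&` E) f.
Proof.
move=> fi f0; rewrite (cint_split D E fi) (@cint_eq (D `\` E) f (fun=> 0)).
  by rewrite cint_cst mul0r addr0.
by move=> x [Dx nEx]; exact: f0.
Qed.

(* The factor [2] comes from splitting into real and imaginary parts. *)
Lemma normc_cint D f : cintegrable f ->
  normc (cint D f) <= 2 * \int[mu]_(x in D) normc (f x).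
Proof.
move=> fi; rewrite (le_trans (normc_ReIm _))//= mulr_natl mulr2n lerD//.
  rewrite (le_trans (le_normr_Rintegral (mall D) (rS D (rintegrable_Re fi))))//.
  apply: Rint_le => //; last by move=> x _; exact: normc_Re.
  by apply: rintegrable_le (rintegrable_Re fi) => x; rewrite normr_id.
rewrite (le_trans (le_normr_Rintegral (mall D) (rS D (rintegrable_Im fi))))//.
apply: Rint_le => //; last by move=> x _; exact: normc_Im.
by apply: rintegrable_le (rintegrable_Im fi) => x; rewrite normr_id.
Qed.

(** Countable additivity is applied to the real and the imaginary part separately, which accounts
    for the factor 2. *)
Lemma cint_pieces_le E lab f v : cintegrable f -> rintegrable v ->
  (forall n, normc (cint (piece E lab n) f) <= \int[mu]_(x in piece E lab n) v x) ->
  normc (cint E f) <= 2 * \int[mu]_(x in E) v x.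
Proof.
move=> fi vi H.
have part (u : T -> R) : rintegrable u ->
    (forall n, `|\int[mu]_(x in piece E lab n) u x| <=
       \int[mu]_(x in piece E lab n) v x) ->
    `|\int[mu]_(x in E) u x| <= \int[mu]_(x in E) v x.
  move=> ui uv; rewrite ler_norml lerNl -mulN1r -RintZ//.
  have ui' := rintegrableZ (-1) ui.
  apply/andP; split; apply: (@Rint_pieces_le _ lab) => // n.
    by rewrite RintZ// mulN1r; have := uv n; rewrite ler_norml lerNl => /andP[].
  by have := uv n; rewrite ler_norml => /andP[].
rewrite (le_trans (normc_ReIm _))//= mulr_natl mulr2n lerD//.
  apply: part => [|n]; first exact: rintegrable_Re.
  by rewrite (le_trans _ (H n))// (le_trans _ (normc_Re _)).
apply: part => [|n]; first exact: rintegrable_Im.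
by rewrite (le_trans _ (H n))// (le_trans _ (normc_Im _)).
Qed.

Lemma cint_pieces0 E lab f : cintegrable f ->
  (forall n, cint (piece E lab n) f = 0) -> cint E f = 0.
Proof.
move=> fi H; apply/eqP; rewrite -normc_eq0 eq_le normc_ge0 andbT.
rewrite (le_trans (@cint_pieces_le E lab f (fun=> 0) fi (rintegrable_cst 0) _))//.
  by move=> n; rewrite H normc0 Rint_cst mul0r.
by rewrite Rint_cst mul0r mulr0.
Qed.

End DiscreteIntegral.

Lemma mulrVK_real {R : realType} (z : Cplx R) (a : R) :
  a != 0 -> z * (a^-1)%:C * a%:C = z.
Proof.
move=> a0; case: z => x y; apply/eqP; rewrite eq_complex /=.
by apply/andP; split; apply/eqP; field.
Qed.

(** The sum is geometric up to the last [j] with [A ^+ j < v], and such a sum is at most a constant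
    times its last term, itself at most [v ^ s]. It replaces the layer cake formula in the strong
    type estimate. *)
Lemma geometric_below_le {R : realType} (A v s : R) N : 1 < A -> 0 < s -> 0 <= v ->
  \sum_(j < N) (if A ^+ j < v then (A `^ s) ^+ j else 0) <=
  A `^ s / (A `^ s - 1) * v `^ s.
Proof.
move=> A1 s0 v0; set B := A `^ s.
have A0 : 0 < A by rewrite (lt_trans ltr01).
have B1 : 1 < B by rewrite /B /powR gt_eqF// -expR0 ltr_expR mulr_gt0// ln_gt0.
have B10 : 0 < B - 1 by rewrite subr_gt0.
have B0 : 0 < B by rewrite (lt_trans ltr01).
elim: N => [|N ih].
  by rewrite big_ord0 mulr_ge0 ?powR_ge0// divr_ge0 ?ltW.
rewrite big_ord_recr /=; case: ifPn => [lt|_]; last by rewrite addr0.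
have Bv : B ^+ N <= v `^ s.
  have -> : B ^+ N = (A ^+ N) `^ s.
    by rewrite -(powR_mulrn N (powR_ge0 A s)) -(powR_mulrn N (ltW A0)) -!powRrM mulrC.
  apply: ge0_ler_powR; rewrite ?nnegrE ?exprn_ge0 ?(ltW s0) ?(ltW A0)//.
  exact: ltW.
apply: (@le_trans _ _ (\sum_(j < N.+1) B ^+ j)).
  rewrite big_ord_recr /= lerD2r ler_sum// => i _.
  by case: ifP => // _; rewrite exprn_ge0// ltW.
apply: (le_trans _ (ler_wpM2l (divr_ge0 (ltW B0) (ltW B10)) Bv)).
rewrite mulrAC ler_pdivlMr// mulrC -subrX1 -exprS lerBlDr lerDl.
exact: ler01.
Qed.

(** * Stopping blocks and the pieces of the decomposition *)

Section StoppingTimes.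
Context d (T : measurableType d) {R : realType}.
Variable mu : {measure set T -> \bar R}.
Hypothesis mall : forall A : set T, measurable A.
Hypothesis mufin : (mu setT < +oo)%E.
Hypothesis mupos : forall x, (0 < mu [set x])%E.
Variable code : T -> nat.
Hypothesis code_inj : injective code.
Local Notation m A := (fine (mu A)).
Variable Q : nat -> T -> set T.
Hypothesis Q0 : forall x, Q 0 x = setT.
Hypothesis Q_self : forall n x, Q n x x.
Hypothesis Q_eq : forall n x y, Q n x y -> Q n y = Q n x.
Hypothesis Q_subset : forall n x, Q n.+1 x `<=` Q n x.
Hypothesis Q_end : forall x, exists n, Q n x = [set x].
Variable K : R.
Hypothesis K2 : 2 <= K.
Hypothesis Q_doubling : forall n x, m (Q n x) <= K * m (Q n.+1 x).
Variable f : T -> Cplx R.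
Hypothesis fi : cintegrable mu f.
Local Notation h := (fun x => normc (f x)).
Local Notation I D := (\int[mu]_(x in D) normc (f x)).
Hypothesis avgX : I setT <= 2 * m setT.

(** The factor 4 serves [cz_set_small]: on [E_(j+1)] the function carries more than [A ^+ j.+1] per
    unit of measure, while a stopping block of level [j] carries at most [K * A ^+ j], so [E_(j+1)]
    fills at most the fraction [K / A], a quarter, of the block. *)
Definition cz_base := 4 * K.
Local Notation A := cz_base.

Lemma cz_base_ge8 : 8 <= A.
Proof. by have := K2; rewrite /cz_base; lra. Qed.

Let A0 : 0 < A. Proof. by have := cz_base_ge8; lra. Qed.
Let A1 : 1 <= A. Proof. by have := cz_base_ge8; lra. Qed.
Let AX0 j : 0 < A ^+ j. Proof. exact: exprn_gt0. Qed.
Let AX1 j : 1 <= A ^+ j. Proof. exact: exprn_ege1. Qed.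
Let m0 D : 0 <= m D. Proof. exact: fine_ge0. Qed.
Let hi : rintegrable mu h. Proof. exact: fi. Qed.
Let h0 x : 0 <= normc (f x). Proof. exact: normc_ge0. Qed.

Let mE D : (m D)%:E = mu D. Proof. by rewrite fineK//; exact: mu_fin_num. Qed.

Let m_pos D x : D x -> 0 < m D.
Proof.
move=> Dx; rewrite -lte_fin mE (lt_le_trans (mupos x))//.
by apply: le_measure; rewrite ?inE//; [exact: mall..|move=> y ->].
Qed.

Let m_le D E : D `<=` E -> m D <= m E.
Proof.
by move=> DE; rewrite -lee_fin !mE; apply: le_measure; rewrite ?inE.
Qed.

Let I_le D E : D `<=` E -> I D <= I E.
Proof. by move=> DE; apply: (Rint_subset mall). Qed.

Let Q_mono n k x : (n <= k)%N -> Q k x `<=` Q n x.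
Proof.
elim: k => [|k ih]; first by rewrite leqn0 => /eqP ->.
rewrite leq_eqVlt => /predU1P[->//|]; rewrite ltnS => /ih.
by apply: subset_trans; exact: Q_subset.
Qed.

(** At level 0 every block stops, so the whole space is the only stopping block and the
    decomposition starts from a global mean. At the levels [j > 0] the hypothesis [avgX] keeps
    generation 0 from stopping, so a stopping block has a parent. *)
Definition stops j n x := (j == 0%N) || (A ^+ j * m (Q n x) < I (Q n x)).

Definition cz_set j := [set x | exists n, stops j n x].

Definition stop_time j x :=
  xget 0%N [set n | stops j n x /\ forall k, stops j k x -> (n <= k)%N].

Definition stop_block j x := Q (stop_time j x) x.
Local Notation E := cz_set.
Local Notation D := stop_block.

Lemma stop_timeP j x : E j x ->
  stops j (stop_time j x) x /\ forall k, stops j k x -> (stop_time j x <= k)%N.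
Proof.
move=> Ejx; apply: (@xget_eq _ 0%N
  [set n | stops j n x /\ forall k, stops j k x -> (n <= k)%N]).
by case: (ex_minnP Ejx) => n Pn Hn; exists n.
Qed.

Let stops_eq j n k x y : Q n x y -> (k <= n)%N -> stops j k y = stops j k x.
Proof. by move=> Qy kn; rewrite /stops (Q_eq (Q_mono kn Qy)). Qed.

Lemma stop_block_self j x : D j x x. Proof. exact: Q_self. Qed.

(** Points of a block of generation [n] share all blocks of generation at most [n], hence all
    stopping decisions up to [n]; the stopping time is thus constant on the stopping block. *)
Lemma stop_block_eq j x y : E j x -> D j x y -> E j y /\ D j y = D j x.
Proof.
move=> Ex Dy; have [Px mx] := stop_timeP Ex.
have Py : stops j (stop_time j x) y by rewrite (stops_eq _ Dy).
have Ey : E j y by exists (stop_time j x).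
split => //; have [Py' my] := stop_timeP Ey.
have le := my _ Py.
have ge : (stop_time j x <= stop_time j y)%N.
  by apply: mx; rewrite -(stops_eq j Dy le).
have tE : stop_time j y = stop_time j x by apply/eqP; rewrite eqn_leq le ge.
by rewrite /stop_block tE; apply: Q_eq.
Qed.

Lemma stop_blockS j x : E j.+1 x -> E j x /\ D j.+1 x `<=` D j x.
Proof.
move=> Ex; have [Px _] := stop_timeP Ex.
have Pj : stops j (stop_time j.+1 x) x.
  rewrite /stops; case: eqP => //= _; rewrite (le_lt_trans _ Px)//.
  by rewrite ler_wpM2r// ler_eXn2l// (lt_le_trans _ cz_base_ge8)// ltr1n.
have Ej : E j x by exists (stop_time j.+1 x).
split => //; apply: Q_mono; have [_] := stop_timeP Ej; exact.
Qed.

Lemma cz_set_le j k : (j <= k)%N -> E k `<=` E j.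
Proof.
elim: k => [|k ih]; first by rewrite leqn0 => /eqP ->.
rewrite leq_eqVlt => /predU1P[->//|]; rewrite ltnS => /ih kj x /stop_blockS[+ _].
exact: kj.
Qed.

Lemma cz_set0 : E 0%N = setT.
Proof. by apply/seteqP; split => // x _; exists 0%N. Qed.

Lemma stop_block_lt j x : (0 < j)%N -> E j x -> A ^+ j * m (D j x) < I (D j x).
Proof.
by move=> j0 /stop_timeP[]; rewrite /stops; case: eqP => //= j0'; rewrite j0' in j0.
Qed.

(** For [j > 0] the parent of the stopping block did not stop, so its average is at most [A ^+ j],
    and passing to the child costs the doubling constant [K]. For [j = 0] the block is the whole
    space and [avgX] applies with [2 <= K]. *)
Lemma stop_block_le j x : E j x -> I (D j x) <= K * A ^+ j * m (D j x).
Proof.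
move=> Ex; have [Px mx] := stop_timeP Ex; rewrite /stop_block.
case: j => [|j] in Ex Px mx *.
  have -> : stop_time 0 x = 0%N by apply/eqP; rewrite -leqn0; exact: mx.
  by rewrite Q0 expr0 mulr1 (le_trans avgX)// ler_wpM2r.
case: (stop_time j.+1 x) Px mx => [|t] Px mx.
  exfalso; move: Px; rewrite /stops /= Q0 ltNge => /negP; apply.
  rewrite (le_trans avgX)// ler_wpM2r//.
  rewrite (le_trans _ (_ : A <= _))//; first by have := cz_base_ge8; lra.
  by rewrite exprS ler_peMr// ltW.
have : ~~ stops j.+1 t x by apply/negP => /mx; rewrite ltnn.
rewrite /stops /= -leNgt => le.
rewrite (le_trans (I_le (Q_subset (n := t) (x := x))))// (le_trans le)//.
by rewrite mulrAC (mulrC (K * _)) ler_wpM2l// ltW.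
Qed.

(** Blocks shrink to single points, so the value [normc (f x)] is itself one of the block averages
    that stayed below the threshold. *)
Lemma cz_set_off j x : (0 < j)%N -> ~ E j x -> normc (f x) <= A ^+ j.
Proof.
move=> j0 nE; have [n Qn] := Q_end x.
have : ~~ stops j n x by apply/negP => ?; apply: nE; exists n.
rewrite /stops negb_or -leNgt Qn => /andP[_].
rewrite (@Rint_eq _ _ _ mu [set x] _ (fun=> normc (f x))); last by move=> y ->.
by rewrite Rint_cst// ler_pM2r// (m_pos (x := x)).
Qed.

Lemma cz_set_exit x : exists N, forall j, (N <= j)%N -> ~ E j x.
Proof.
have mx : 0 < m [set x] by exact: (m_pos (x := x)).
(* Every block average around [x] is at most the total integral divided by the mass of [x]; the
   threshold [A ^+ N] reaches this number because [A ^+ k] is at least [k]. *)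
pose N := (Num.bound (I setT / m [set x])).+1.
have nE : ~ E N x.
  move=> [n]; rewrite /stops /= ltNge => /negP; apply.
  have m_le' : m [set x] <= m (Q n x) by apply: m_le => y ->.
  rewrite (le_trans (I_le (@subsetT _ _)))//.
  rewrite (le_trans _ (ler_wpM2l (ltW (AX0 N)) m_le'))// -ler_pdivrMr//.
  have : I setT / m [set x] < (Num.bound (I setT / m [set x]))%:R.
    by rewrite archi_boundP// divr_ge0// Rintegral_ge0.
  move=> /ltW/le_trans; apply.
  have lin (k : nat) : k%:R <= A ^+ k.
    elim: k => [|k ih]; first by rewrite expr0 ler01.
    rewrite exprS -natr1; have := cz_base_ge8; have := AX1 k.
    by move=> a b; nra.
  by rewrite (le_trans (lin _))// ler_eXn2l// (lt_le_trans _ cz_base_ge8)// ltr1n.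
by exists N => j Nj /(cz_set_le Nj).
Qed.

Lemma cz_set_bounded j : (0 < j)%N -> (forall x, normc (f x) <= A ^+ j) -> E j = set0.
Proof.
move=> j0 fA; apply/seteqP; split => // x /(stop_block_lt j0).
rewrite ltNge => /negP; apply; rewrite -Rint_cst//.
by apply: Rint_le => //; exact: rintegrable_cst.
Qed.

(** The chosen point depends only on the block, so the label is constant on it; two blocks with the
    same label share that point and coincide. *)
Definition cz_label j x := code (xget point (D j x)).
Local Notation lab := cz_label.

Lemma cz_label_eq j x y : E j x -> E j y -> lab j x = lab j y -> D j x = D j y.
Proof.
move=> Ex Ey /code_inj.
have Dx : D j x (xget point (D j x)) by apply: xget_eq; exists x; exact: Q_self.
have Dy : D j y (xget point (D j y)) by apply: xget_eq; exists y; exact: Q_self.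
move=> e; have [_ <-] := stop_block_eq Ex Dx.
by rewrite e; have [_ ->] := stop_block_eq Ey Dy.
Qed.

Lemma cz_piece j x : E j x -> piece (E j) (lab j) (lab j x) = D j x.
Proof.
move=> Ex; apply/seteqP; split => [y [Ey /esym lxy]|y Dy].
  by rewrite (cz_label_eq Ex Ey lxy); exact: Q_self.
have [Ey De] := stop_block_eq Ex Dy.
by split => //; rewrite /= /lab De.
Qed.

Lemma cz_sub_piece j x n : E j x ->
  piece (D j x `&` E j.+1) (lab j.+1) n = set0 \/
  exists y, [/\ E j.+1 y, D j x y & piece (D j x `&` E j.+1) (lab j.+1) n = D j.+1 y].
Proof.
move=> Ex; have [->|/set0P[y [[Dy Ey] ly]]] :=
  eqVneq (piece (D j x `&` E j.+1) (lab j.+1) n) set0; first by left.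
right; exists y; split => //; apply/seteqP; split => [z [[Dz Ez] lz]|z Dz].
  have -> : D j.+1 y = D j.+1 z by apply: cz_label_eq => //; rewrite ly lz.
  exact: stop_block_self.
have [Ez De] := stop_block_eq Ey Dz.
have [_ De'] := stop_block_eq Ex Dy.
have [_ sub] := stop_blockS Ey.
by split; [split => //; rewrite -De'; exact: sub|rewrite /= -ly /lab De].
Qed.

Lemma cz_set_small j x : E j x -> 4 * m (D j x `&` E j.+1) <= m (D j x).
Proof.
move=> Ex.
have : \int[mu]_(y in D j x `&` E j.+1) A ^+ j.+1 <= I (D j x `&` E j.+1).
  apply: (Rint_pieces_le mall (lab := lab j.+1)) => //; first exact: rintegrable_cst.
  move=> n; have [->|[y [Ey _ ->]]] := cz_sub_piece n Ex.
    by rewrite !Rintegral_set0.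
  by rewrite Rint_cst// ltW// stop_block_lt.
rewrite Rint_cst// => le; have {}le := le_trans le (I_le (@subIsetl _ _ _)).
have Ka : 0 < K * A ^+ j by rewrite mulr_gt0// (lt_le_trans _ K2).
rewrite -(ler_pM2l Ka); apply: le_trans (le_trans le (stop_block_le Ex)).
by rewrite exprS {2}/cz_base le_eqVlt; apply/orP; left; apply/eqP; ring.
Qed.

Definition cz_mean : Cplx R := cint mu setT f * ((m setT)^-1)%:C.
Local Notation c0 := cz_mean.

Definition cz_fill j x : Cplx R :=
  cint mu (D j x `&` E j.+1) f * ((m (D j x `\` E j.+1))^-1)%:C.

(* With [g_j] equal to [0] on [E j.+1], to [f + cz_fill j] on the rest of
   [E j] and to [f] elsewhere, this is [g_j - f]; the filling constants make
   the integrals of [g_j] and [f] agree on every stopping block. *)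
Definition cz_defect j x : Cplx R :=
  if `[< E j.+1 x >] then - f x
  else if `[< E j x >] then cz_fill j x else 0.
Local Notation dd := cz_defect.

(** The difference [g_(j+1) - g_j], in which [f] cancels; for [j = 0] the constant [c0] replaces
    [g_0]. *)
Definition cz_bad j x : Cplx R :=
  if j is 0 then (f x - c0) + dd 1 x else dd j.+1 x - dd j x.
Local Notation b := cz_bad.

Definition cz_const := 12 * A ^+ 2.

(** At least three quarters of the block remain, and [normc_cint] costs a factor 2: the constant
    [2 * 4 / 3] is rounded up to 3. *)
Let fill_le j x : E j x -> normc (cz_fill j x) <= 3 * K * A ^+ j.
Proof.
move=> Ex; have sm := cz_set_small Ex.
have mS : m (D j x) = m (D j x `&` E j.+1) + m (D j x `\` E j.+1).
  rewrite -[LHS]mul1r -Rint_cst// (Rint_split mall _ (E j.+1)) ?Rint_cst//.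
    by rewrite !mul1r.
  exact: rintegrable_cst.
have mD : 0 < m (D j x) by exact: (m_pos (x := x) (@stop_block_self _ _)).
have m3 : 0 < m (D j x `\` E j.+1) by lra.
rewrite /cz_fill normcM normc_real ger0_norm ?invr_ge0// ler_pdivrMr//.
apply: (le_trans (normc_cint mall _ fi)).
have le1 := le_trans (I_le (@subIsetl _ (D j x) (E j.+1))) (stop_block_le Ex).
have Ka : 0 < K * A ^+ j by rewrite mulr_gt0// (lt_le_trans _ K2).
have : K * A ^+ j * m (D j x) <= K * A ^+ j * (4 / 3 * m (D j x `\` E j.+1)).
  by rewrite ler_pM2l//; lra.
have : 0 < K * A ^+ j * m (D j x `\` E j.+1) by rewrite mulr_gt0.
set a := I _ in le1 *; set u := m (D j x) in le1 *; set v := m (_ `\` _).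
set w := A ^+ j in le1 *; move=> h1 h2; lra.
Qed.

Let good_le j x : (0 < j)%N -> normc (f x + dd j x) <= 2 * A ^+ j.+1.
Proof.
move=> j0; rewrite /cz_defect; case: asboolP => [_|nE].
  by rewrite subrr normc0 mulr_ge0// ltW.
have le := cz_set_off (ltn0Sn j) nE.
rewrite mulr_natl mulr2n (le_trans (normcD _ _))// lerD//.
case: asboolP => [Ej|_]; last by rewrite normc0 ltW.
rewrite (le_trans (fill_le Ej))// exprS; apply: ler_wpM2r; first exact: ltW.
by have := K2; rewrite /cz_base; lra.
Qed.

Let cz_mean_int : cint mu setT (fun=> c0) = cint mu setT f.
Proof.
rewrite cint_cst /cz_mean; last exact: mall.
apply: mulrVK_real.
by rewrite gt_eqF// (m_pos (x := point)).
Qed.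

Lemma cz_mean_le : normc c0 <= 4.
Proof.
have mX : 0 < m setT by exact: (m_pos (x := point)).
rewrite /cz_mean normcM normc_real ger0_norm ?invr_ge0// ler_pdivrMr//.
rewrite (le_trans (normc_cint mall _ fi))//.
by have := avgX; lra.
Qed.

Let A_sq : 64 <= A ^+ 2.
Proof. by have := cz_base_ge8; rewrite expr2 => ?; nra. Qed.

Lemma cz_bad_le j x : normc (b j x) <= cz_const * A ^+ j.
Proof.
rewrite /cz_bad /cz_const; case: j => [|j].
  rewrite expr0 mulr1 addrAC (le_trans (normcB _ _))//.
  have := good_le x (isT : (0 < 1)%N); have := cz_mean_le; have := A_sq; lra.
rewrite -[_ - _](_ : (f x + dd j.+2 x) - (f x + dd j.+1 x) = _); last first.
  by rewrite opprD addrACA subrr add0r.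
rewrite (le_trans (normcB _ _))//.
have := good_le x (ltn0Sn j); have := good_le x (ltn0Sn j.+1).
have -> : A ^+ j.+3 = A ^+ 2 * A ^+ j.+1 by rewrite -exprD.
have -> : A ^+ j.+2 = A * A ^+ j.+1 by rewrite -exprS.
have : A * A ^+ j.+1 <= A ^+ 2 * A ^+ j.+1.
  by apply: ler_wpM2r; [exact: ltW|rewrite expr2 ler_peMr// ltW].
set a := A ^+ j.+1; set c := A ^+ 2; have : 0 <= c * a by apply: mulr_ge0; apply/ltW; exact: AX0.
by move=> h1 h2 h3 h4; lra.
Qed.

Let dd_off j x : ~ E j x -> dd j x = 0.
Proof.
move=> nE; rewrite /cz_defect; case: asboolP => [/stop_blockS[]//|_].
by case: asboolP.
Qed.

Lemma cz_bad_off j x : ~ E j x -> b j x = 0.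
Proof.
case: j => [|j] nE; first by exfalso; apply: nE; rewrite cz_set0.
by rewrite /cz_bad !dd_off ?subrr// => /stop_blockS[].
Qed.

(** On [E_(j+2)] both [g_(j+1)] and [g_j] are zero, that is, both defects equal [- f]. *)
Let cz_bad_deep j x : (0 < j)%N -> E j.+2 x -> b j x = 0.
Proof.
case: j => // j _ E3; have [E2 _] := stop_blockS E3.
rewrite /cz_bad /cz_defect; case: asboolP => // _; case: asboolP => // _.
by rewrite subrr.
Qed.

Lemma cz_bad_sum_le N x :
  \sum_(j < N) (A ^+ j)^-1 * normc (b j x) <= 3 * cz_const.
Proof.
have Ak : 0 <= cz_const by rewrite mulr_ge0// exprn_ge0// ltW.
(* A point contributes to a generation [j > 0] only if it lies in [E_j] and not in [E_(j+2)]. The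
   differences [e j - e j.+2] telescope to at most 2, and generation 0 adds 1: hence the factor
   3. *)
pose e j : R := (`[< E j x >])%:R.
have e01 j : 0 <= e j <= 1 by rewrite /e; case: asboolP; rewrite ?lexx ?ler01.
have tel n : \sum_(j < n) (e j - e j.+2) = e 0%N + e 1%N - e n - e n.+1.
  elim: n => [|n ih]; first by rewrite big_ord0; ring.
  by rewrite big_ord_recr /= ih; ring.
have term j : (A ^+ j)^-1 * normc (b j x) <= cz_const * ((j == 0%N)%:R + (e j - e j.+2)).
  have le1 : (A ^+ j)^-1 * normc (b j x) <= cz_const.
    by rewrite mulrC ler_pdivrMr// cz_bad_le.
  have sub : e j.+2 <= e j.
    rewrite /e; case: asboolP => [/stop_blockS[/stop_blockS[Ej _] _]|_].
      by case: asboolP.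
    by case: asboolP.
  have [j0|j0] := posnP j.
    by rewrite (le_trans le1)// ler_peMr// lerDl subr_ge0.
  have [Ej|nE] := pselect (E j x); last first.
    by rewrite cz_bad_off// normc0 mulr0 mulr_ge0// addr_ge0// subr_ge0.
  have [Ej2|nE2] := pselect (E j.+2 x).
    by rewrite cz_bad_deep// normc0 mulr0 mulr_ge0// addr_ge0// subr_ge0.
  rewrite add0r /e; case: asboolP => // _; case: asboolP => // _.
  by rewrite subr0 mulr1.
apply: (@le_trans _ _ (\sum_(j < N)
    cz_const * (((j : nat) == 0%N)%:R + (e j - e j.+2)))).
  by apply: ler_sum => j _; exact: term.
rewrite -mulr_sumr mulrC ler_wpM2r// big_split /= tel.
have : \sum_(i < N) ((i : nat) == 0%N)%:R <= 1 :> R.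
  case: N => [|n]; first by rewrite big_ord0.
  by rewrite big_ord_recl /= big1 ?addr0.
by have := e01 0%N; have := e01 1%N; have := e01 N; have := e01 N.+1; lra.
Qed.

(** The partial sums telescope to good functions, which agree with [f] at [x] once [x] has left the
    sets [E_j]. *)
Lemma cz_sum x : exists N, forall n, (N <= n)%N ->
  f x = c0 + \sum_(j < n) b j x.
Proof.
have [N HN] := cz_set_exit x; exists N.+1 => -[//|n]; rewrite ltnS => Nn.
have part k : c0 + \sum_(j < k.+1) b j x = f x + dd k.+1 x.
  elim: k => [|k ih]; first by rewrite big_ord1 /=; ring.
  by rewrite big_ord_recr /= addrA ih; ring.
by rewrite part dd_off ?addr0//; apply: HN; rewrite (leq_trans Nn).
Qed.

Let dd_int j : (0 < j)%N -> cintegrable mu (dd j).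
Proof.
move=> j0; rewrite (_ : dd j = fun x => (f x + dd j x) + (-1) * f x); last first.
  by apply/funext => x; ring.
apply: cintegrableD => //; last exact: cintegrableZ.
by apply: cintegrable_bounded => // x; exact: good_le.
Qed.

Let dd_block j x : (0 < j)%N -> E j x -> cint mu (D j x) (dd j) = 0.
Proof.
move=> j0 Ex; rewrite (cint_split mall _ (E j.+1) (dd_int j0)).
rewrite (@cint_eq _ _ _ mu (D j x `&` E j.+1) _ (fun y => (-1) * f y)); last first.
  by move=> y [_ Ey]; rewrite /cz_defect; case: asboolP => // _; rewrite mulN1r.
rewrite (@cint_eq _ _ _ mu (D j x `\` E j.+1) _ (fun=> cz_fill j x)); last first.
  move=> y [Dy nEy]; have [Ey De] := stop_block_eq Ex Dy.
  rewrite /cz_defect; case: asboolP => // _; case: asboolP => // _.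
  by rewrite /cz_fill De.
rewrite cint_cst// cintZ// mulN1r /cz_fill [X in _ + X]mulrVK_real ?addNr//.
have sm := cz_set_small Ex.
have mS : m (D j x) = m (D j x `&` E j.+1) + m (D j x `\` E j.+1).
  rewrite -[LHS]mul1r -Rint_cst// (Rint_split mall _ (E j.+1)) ?Rint_cst//.
    by rewrite !mul1r.
  exact: rintegrable_cst.
have mD : 0 < m (D j x) by exact: (m_pos (x := x) (@stop_block_self _ _)).
by rewrite gt_eqF//; lra.
Qed.

(** The defect of level [j + 1] lives on [E_(j+1)], and the part of that set in a stopping block of
    level [j] is a union of stopping blocks of level [j + 1], on each of which the defect integrates
    to zero. *)
Let dd_parent j x : E j x -> cint mu (D j x) (dd j.+1) = 0.
Proof.
move=> Ex; rewrite (cint_restrict mall (E := E j.+1)) ?dd_int//; last first.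
  by move=> y _; exact: dd_off.
apply: (cint_pieces0 mall mufin (lab := lab j.+1)); first exact: dd_int.
move=> n; have [->|[y [Ey _ ->]]] := cz_sub_piece n Ex; first by rewrite cint_set0.
exact: dd_block.
Qed.


Lemma cz_bad_mean j x : E j x -> cint mu (D j x) (b j) = 0.
Proof.
case: j => [|j] Ex; last first.
  rewrite /cz_bad (cintB mall)//; [|exact: dd_int..].
  by rewrite dd_parent// dd_block// subrr.
have -> : D 0 x = setT.
  by have [_ mx] := stop_timeP Ex; rewrite /stop_block (_ : stop_time 0 x = 0%N)//; apply/eqP; rewrite -leqn0 mx.
have ci : cintegrable mu (fun=> c0 : Cplx R).
  by apply: (cintegrable_bounded mall mufin (k := normc c0)).
have ci' : cintegrable mu (fun x => f x - c0).
  rewrite (_ : (fun _ => _) = fun x => f x + (-1) * c0); last first.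
    by apply/funext => y; rewrite mulN1r.
  by apply: cintegrableD => //; exact: cintegrableZ.
rewrite /cz_bad (cintD mall)//; last exact: dd_int.
rewrite (cintB mall)// cz_mean_int subrr add0r.
have D0 : D 0 point = setT.
  have E0 : E 0%N point by rewrite cz_set0.
  by have [_ mx] := stop_timeP E0; rewrite /stop_block (_ : stop_time 0 point = 0%N)//; apply/eqP; rewrite -leqn0 mx.
by rewrite -D0; apply: dd_parent; rewrite cz_set0.
Qed.


(** The Marcinkiewicz argument. On a stopping block the values of [normc (f x)] up to [A ^+ j / 2]
    account for at most half of the threshold, so the large values [u j] alone give the weak type
    bound. After exchanging sum and integral, the powers of [A ^ (r - 1)] over the [j] with
    [A ^+ j < 2 * normc (f x)] add up to a multiple of [normc (f x) ^ (r - 1)]. Level 0, where [E_0]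
    is the whole space, accounts for [m setT]. *)
Lemma cz_measure_sum (r : R) N : 1 < r -> rintegrable mu (fun x => normc (f x) `^ r) ->
  \sum_(j < N) (A `^ r) ^+ j * m (E j) <=
  m setT + 2 * (A `^ (r - 1) / (A `^ (r - 1) - 1) * 2 `^ (r - 1)) *
    \int[mu]_x (normc (f x) `^ r).
Proof.
move=> r1 hr; set B := A `^ (r - 1).
have A1' : 1 < A by rewrite (lt_le_trans _ cz_base_ge8)// ltr1n.
have r10 : 0 < r - 1 by rewrite subr_gt0.
have B0 : 0 <= B by exact: powR_ge0.
have AB : A `^ r = B * A by rewrite mulrC mulr_powRB1// ?ltW// (lt_trans ltr01).
pose u j x := if A ^+ j < 2 * normc (f x) then normc (f x) else 0.
have ui j : rintegrable mu (u j).
  apply: (rintegrable_le mall) hi => x; rewrite /u; case: ifP => // _.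
  by rewrite normr0.
have u0 j x : 0 <= u j x by rewrite /u; case: ifP.
have weak j : (0 < j)%N -> A ^+ j * m (E j) <= 2 * \int[mu]_x u j x.
  move=> j0.
  have : \int[mu]_(x in E j) (A ^+ j / 2) <= \int[mu]_(x in E j) u j x.
    apply: (Rint_pieces_le mall (lab := lab j)) => //; first exact: rintegrable_cst.
    move=> n; have [->|/set0P[x [Ex lx]]] := eqVneq (piece (E j) (lab j) n) set0.
      by rewrite !Rintegral_set0.
    rewrite -lx cz_piece// Rint_cst//.
    have lt := stop_block_lt j0 Ex.
    have : I (D j x) <= \int[mu]_(y in D j x) (A ^+ j / 2 + u j y).
      apply: Rint_le => //; first by apply: rintegrableD => //; exact: rintegrable_cst.
      move=> y _; rewrite /u; case: ltP => [_|le].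
        by rewrite lerDr divr_ge0 ?ltW.
      by rewrite addr0 ler_pdivlMr// mulrC.
    rewrite RintD//; last exact: rintegrable_cst.
    rewrite Rint_cst// => le; lra.
  rewrite Rint_cst// => le.
  have := Rint_subset mall (ui j) (u0 j) (@subsetT _ (E j)); lra.
have term j : (A `^ r) ^+ j * m (E j) <=
    (j == 0%N)%:R * m setT + 2 * (B ^+ j * \int[mu]_x u j x).
  have [->|j0] := posnP j.
    rewrite !expr0 cz_set0 !mul1r lerDl mulr_ge0// Rintegral_ge0//.
  rewrite mul0r add0r AB exprMn -mulrA [leRHS]mulrCA ler_wpM2l ?exprn_ge0//.
  exact: weak.
apply: (@le_trans _ _ (\sum_(j < N)
    (((j : nat) == 0%N)%:R * m setT + 2 * (B ^+ j * \int[mu]_x u j x)))).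
  by apply: ler_sum => j _; exact: term.
rewrite big_split /= lerD//.
  rewrite -mulr_suml ler_piMl//.
  case: N => [|n]; first by rewrite big_ord0.
  by rewrite big_ord_recl /= big1 ?addr0.
rewrite -mulr_sumr -mulrA ler_wpM2l//.
have sumE n : \sum_(j < n) B ^+ j * \int[mu]_x u j x =
    \int[mu]_x (\sum_(j < n) B ^+ j * u j x) /\
    rintegrable mu (fun x => \sum_(j < n) B ^+ j * u j x).
  elim: n => [|n [ih1 ih2]].
    rewrite big_ord0; split.
      by rewrite (@Rint_eq _ _ _ mu setT _ (fun=> 0)) ?Rint_cst ?mul0r// => x _; rewrite big_ord0.
    rewrite (_ : (fun _ => _) = fun=> 0); first exact: rintegrable_cst.
    by apply/funext => x; rewrite big_ord0.
  have E1 : (fun x => \sum_(j < n.+1) B ^+ j * u j x) =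
      fun x => \sum_(j < n) B ^+ j * u j x + B ^+ n * u n x.
    by apply/funext => x; rewrite big_ord_recr.
  have Zi : rintegrable mu (fun x => B ^+ n * u n x) by exact: rintegrableZ.
  by rewrite E1 big_ord_recr /= ih1 RintD// RintZ//; split => //; exact: rintegrableD.
have [-> si] := sumE N.
rewrite -RintZ//; apply: Rint_le => //; first exact: rintegrableZ.
move=> x _.
have -> : \sum_(j < N) B ^+ j * u j x =
    normc (f x) * \sum_(j < N) (if A ^+ j < 2 * normc (f x) then B ^+ j else 0).
  rewrite mulr_sumr; apply: eq_bigr => j _; rewrite /u.
  by case: ifP => _; rewrite ?mulr0// mulrC.
have := geometric_below_le N A1' r10 (mulr_ge0 (ler0n _ 2) (h0 x)).
rewrite -/B powRM// => le.
rewrite (le_trans (ler_wpM2l (h0 x) le))// mulrCA -mulrA ler_wpM2l//.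
  by rewrite divr_ge0// subr_ge0 -(powRr0 A) ler_powR ?ltW.
by rewrite mulrCA ler_wpM2l ?powR_ge0// mulr_powRB1// (lt_trans ltr01).
Qed.

End StoppingTimes.

(** What both interpolation families use of the construction. The constant [M] gathers all bounds
    and, in [cz_tree], is chosen before [f]. By [cz_exit] and [cz_off] the sums over [j] are finite
    at each point. *)
Record cz_decomposition {R : realType} {V : choiceType} (adj : rel V) (o : V) (q : nat)
    (alpha A M r : R) (f : rooted o -> Cplx R) (E : nat -> set (rooted o))
    (lab : nat -> rooted o -> nat) (b : nat -> rooted o -> Cplx R) (c : Cplx R)
    : Prop := CzDecomposition {
  cz_dyadic : forall j n, piece (E j) (lab j) n = set0 \/
    dyadic adj o (piece (E j) (lab j) n) ;
  cz_off : forall j x, ~ E j x -> b j x = 0 ;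
  cz_bound : forall j x, normc (b j x) <= M * A ^+ j ;
  cz_mean0 : forall j n,
    cint (mu_alpha adj q alpha) (piece (E j) (lab j) n) (b j) = 0 ;
  cz_sum_bound : forall N x, \sum_(j < N) (A ^+ j)^-1 * normc (b j x) <= M ;
  cz_exit : forall x, exists N, forall j, (N <= j)%N -> ~ E j x ;
  cz_eq : forall x, exists N, forall n, (N <= n)%N -> f x = c + \sum_(j < n) b j x ;
  cz_cst_bound : normc c <= M ;
  cz_measure : forall N,
    \sum_(j < N) (A `^ r) ^+ j * fine (mu_alpha adj q alpha (E j)) <= M ;
  cz_vanish : forall j, (0 < j)%N -> (forall x, normc (f x) <= A ^+ j) -> E j = set0
}.

(** * Norms on the weighted tree and the decomposition there *)

Section NormBridges.
Context {R : realType} {V : choiceType} (adj : rel V) (q : nat).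
Hypothesis q2 : (1 < q)%N.
Hypothesis htree : homogeneous_tree adj q.
Variables (o : V) (alpha : R).
Hypothesis alpha1 : 1 < alpha.
Local Opaque gdist.
Local Notation T := (rooted o).
Local Notation mu := (@mu_alpha R V adj o q alpha).
Local Notation C := (Cplx R).
Local Notation m A := (fine (mu A)).
Local Notation Lpn := (Lp_norm adj q alpha).
Implicit Types (f g : T -> C) (D : set T).

Let mall (A : set T) : measurable A. Proof. by []. Qed.
Let mufin : (mu setT < +oo)%E. Proof. exact: mu_finite. Qed.

Lemma mu_point_gt0 (x : T) : (0 < mu [set x])%E.
Proof. by rewrite mu_set1// lte_fin weight_gt0. Qed.

Lemma fine_mu_gt0 D x : D x -> 0 < m D.
Proof.
move=> Dx; rewrite -lte_fin fineK; last exact: mu_fin_num.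
apply: (lt_le_trans (mu_point_gt0 x)).
by apply: le_measure; rewrite ?inE// => y ->.
Qed.

Lemma dyadic_nonempty D : dyadic adj o D -> exists x, D x.
Proof. by move=> [v [->|->]]; exists v => //; exists 0%N. Qed.

Lemma dyadic_mu_gt0 D : dyadic adj o D -> 0 < m D.
Proof. by move=> /dyadic_nonempty[x]; exact: fine_mu_gt0. Qed.

Lemma dyadicT : dyadic adj o setT.
Proof. by rewrite -(block0 htree o o); exact: dyadic_block. Qed.

Lemma wsumE D f : wsum adj q alpha D f = cint mu D f.
Proof. by []. Qed.

Lemma Lp_norm1 f : Lpn 1 f = (\int[mu]_x (normc (f x))%:E)%E.
Proof.
rewrite /Lp_norm Lnorm1; apply: eq_integral => x _.
by rewrite gee0_abs// lee_fin normc_ge0.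
Qed.

Lemma L1P f : (Lpn 1 f < +oo)%E <-> cintegrable mu f.
Proof.
rewrite Lp_norm1; apply: iff_sym; apply: rintegrable_ge0P => // x.
exact: normc_ge0.
Qed.

Lemma Lp_norm1_EFin f : cintegrable mu f ->
  Lpn 1 f = (\int[mu]_x normc (f x))%:E.
Proof. by move=> fi; rewrite Lp_norm1 EFin_Rintegral. Qed.

(** Every point has positive mass, so the essential supremum is a supremum over all points. *)
Lemma Linfty_leP f (c : R) :
  (Lpn +oo f <= c%:E)%E <-> forall x, normc (f x) <= c.
Proof.
rewrite /Lp_norm unlock /Lnorm.
have -> : (0 < mu [set: T])%E.
  apply: (lt_le_trans (mu_point_gt0 (o : T))).
  by apply: le_measure; rewrite ?inE.
split=> [/ess_supP[N [mN N0 H]] x|H].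
  have xN : ~ N x.
    move=> Nx; have := mu_point_gt0 x; rewrite ltNge => /negP; apply.
    by rewrite -N0; apply: le_measure; rewrite ?inE// => y ->.
  rewrite -lee_fin; apply: contrapT => nle; apply: xN; apply: H => /= le.
  by apply: nle; move: le; rewrite ger0_norm// normc_ge0.
apply/ess_supP/nearW => x /=.
by rewrite lee_fin ger0_norm ?normc_ge0.
Qed.

Lemma Lp_leP f (p s : R) : 0 < p -> 0 <= s ->
  (Lpn p%:E f <= s%:E)%E <->
  (\int[mu]_x ((normc (f x)) `^ p)%:E <= (s `^ p)%:E)%E.
Proof.
move=> p0 s0; rewrite /Lp_norm unlock /Lnorm.
have -> : (\int[mu]_x (`|(normc (f x))%:E| `^ p) =
    \int[mu]_x ((normc (f x)) `^ p)%:E)%E.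
  by apply: eq_integral => x _; rewrite /= ger0_norm// normc_ge0.
set I := (\int[mu]_x _)%E.
have I0 : (0 <= I)%E by apply: integral_ge0 => x _; rewrite lee_fin powR_ge0.
have mem (u : \bar R) : (0 <= u)%E -> u \in `[0%E, +oo%E].
  by move=> u0; rewrite in_itv /= u0 leey.
split=> H.
  have -> : I = ((I `^ p^-1) `^ p)%E.
    by rewrite -poweRrM mulVf ?gt_eqF// poweRe1.
  rewrite -poweR_EFin; apply: gt0_ler_poweR => //; first exact: ltW.
  - exact/mem/poweR_ge0.
  - by apply: mem; rewrite lee_fin.
have -> : s%:E = ((s `^ p)%:E `^ p^-1)%E.
  by rewrite poweR_EFin -powRrM divff ?gt_eqF// powRr1.
apply: gt0_ler_poweR => //; first by rewrite invr_ge0 ltW.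
- exact: mem.
- by apply: mem; rewrite lee_fin powR_ge0.
Qed.

Lemma cz_tree (r : R) : 1 < r -> exists A M : R, [/\ 1 < A, 0 < M & forall f,
  (\int[mu]_x ((normc (f x)) `^ r)%:E <= 1)%E ->
  exists E lab b c, cz_decomposition adj q alpha A M r f E lab b c].
Proof.
move=> r1.
have [code' code_inj'] := countable_tree htree o q2.
pose code : T -> nat := code'.
have code_inj : injective code by exact: code_inj'.
have [K' K1 dbl] := mu_block_doubling q2 htree o alpha1.
(* The stopping argument asks for a constant at least 2, while the doubling lemma gives one at least
   1. *)
pose K := K' + 1.
have K2 : 2 <= K by rewrite /K; lra.
have mfn D : mu D \is a fin_num by exact: mu_fin_num.
have Qd n (x : T) : m (block adj o n x) <= K * m (block adj o n.+1 x).
  rewrite (@le_trans _ _ (K' * m (block adj o n.+1 x)))//.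
    by rewrite -lee_fin EFinM !fineK.
  by rewrite ler_wpM2r ?fine_ge0// /K lerDl.
have Qend (x : T) : exists n, block adj o n x = [set x].
  by exists (gdist adj o x).+1; apply: block_end.
pose A := cz_base K.
have A8 : 8 <= A by exact: cz_base_ge8.
pose M1 := m setT + 2 * (A `^ (r - 1) / (A `^ (r - 1) - 1) * 2 `^ (r - 1)).
pose M := 3 * cz_const K + `|M1| + 4.
have ck0 : 0 <= cz_const K by rewrite /cz_const mulr_ge0// sqr_ge0.
have M10 : 0 <= `|M1| by [].
have M0 : 0 < M by rewrite /M; lra.
exists A, M; split => //; first by lra.
move=> f hf.
have hr0 x : 0 <= normc (f x) `^ r by exact: powR_ge0.
have hr : rintegrable mu (fun x => normc (f x) `^ r).
  by apply/rintegrable_ge0P => //; apply: (le_lt_trans hf); rewrite ltry.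
have hr1 : \int[mu]_x (normc (f x) `^ r) <= 1.
  by rewrite -lee_fin EFin_Rintegral.
(* Since [r > 1], this gives integrability of [f] and, as the origin alone has mass 1, the
   normalisation of the average: the integral is at most [m setT + 1], hence at most
   [2 * m setT]. *)
have hle x : normc (f x) <= 1 + normc (f x) `^ r.
  have [le1|gt1] := leP (normc (f x)) 1.
    by rewrite (le_trans le1)// lerDl.
  by rewrite (le_trans (le1r_powR (ltW gt1) (ltW r1)))// lerDr.
have fi : cintegrable mu f.
  apply: (cintegrable_le mall hle); apply: rintegrableD => //.
  exact: rintegrable_cst.
have m1 : 1 <= m setT.
  have : m [set (o : T)] <= m setT.
    by rewrite -lee_fin !fineK//; apply: le_measure; rewrite ?inE.
  apply: le_trans.
  by rewrite mu_set1// /weight (lev_o htree) mulr0 oppr0 powRr0.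
have avg : \int[mu]_x (normc (f x)) <= 2 * m setT.
  apply: (@le_trans _ _ (\int[mu]_x (1 + normc (f x) `^ r))).
    apply: Rint_le => //; first exact: rintegrableD (rintegrable_cst mall mufin 1) hr.
  rewrite RintD//; last exact: rintegrable_cst.
  by rewrite Rint_cst//; lra.
pose Q : nat -> T -> set T := fun n x => block adj o n x.
have Q0 (x : T) : Q 0%N x = setT by exact: (block0 htree).
have Qs n (x : T) : Q n x x by exact: block_self.
have Qe n (x y : T) : Q n x y -> Q n y = Q n x by exact: (block_eq htree).
have Qb n (x : T) : Q n.+1 x `<=` Q n x by exact: (@block_subset _ adj o n x).
pose E := cz_set mu Q K f.
pose lab := cz_label mu code Q K f.
have pcE j n x : E j x -> lab j x = n ->
    piece (E j) (lab j) n = stop_block mu Q K f j x.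
  by move=> Ex <-; apply: (cz_piece code_inj Qs Qe Qb Ex).
have dich j n : piece (E j) (lab j) n = set0 \/
    exists2 x, E j x & piece (E j) (lab j) n = stop_block mu Q K f j x.
  have [->|/set0P[x [Ex lx]]] := eqVneq (piece (E j) (lab j) n) set0.
    by left.
  by right; exists x => //; exact: pcE.
exists E, lab, (cz_bad mu Q K f), (cz_mean mu f); split.
- move=> j n; have [->|[x Ex ->]] := dich j n; [by left|right].
  exact: dyadic_block.
- by move=> j x; exact: (cz_bad_off Qb K2).
- move=> j x; have := cz_bad_le mall mufin mu_point_gt0 code_inj Q0 Qs Qe Qb Qend K2 Qd fi avg j x.
  move=> /le_trans; apply; rewrite ler_wpM2r ?exprn_ge0//; last by rewrite /M; lra.
  by rewrite (le_trans _ A8).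
- move=> j n; have [->|[x Ex ->]] := dich j n; first by rewrite cint_set0.
  exact: (cz_bad_mean mall mufin mu_point_gt0 code_inj Q0 Qs Qe Qb Qend K2 Qd fi avg Ex).
- move=> N x; have := cz_bad_sum_le mall mufin mu_point_gt0 code_inj Q0 Qs Qe Qb Qend K2 Qd fi avg N x.
  by move=> /le_trans; apply; rewrite /M; lra.
- by move=> x; exact: (cz_set_exit mall mufin mu_point_gt0 Qs Qb K2 fi x).
- by move=> x; exact: (cz_sum mall mufin mu_point_gt0 Qs Qb K2 fi x).
- have := cz_mean_le mall mufin mu_point_gt0 fi avg.
  by move=> /le_trans; apply; rewrite /M; lra.
- move=> N; have := cz_measure_sum mall mufin code_inj Qs Qe Qb K2 fi N r1 hr.
  move=> /le_trans; apply; apply: (@le_trans _ _ M1).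
    rewrite /M1 lerD2l ler_piMr// mulr_ge0// mulr_ge0 ?powR_ge0// divr_ge0 ?powR_ge0//.
    rewrite subr_ge0 -[leLHS](powRr0 A); apply: ler_powR; first by lra.
    by rewrite subr_ge0 ltW.
  by rewrite (le_trans (ler_norm _))// /M; lra.
- by move=> j j0 fA; exact: (cz_set_bounded mall mufin Q fi j0 fA).
Qed.

End NormBridges.

(** * Atomic series *)

Section AtomicSums.
Context {R : realType} {V : choiceType} (adj : rel V) (q : nat).
Hypothesis q2 : (1 < q)%N.
Hypothesis htree : homogeneous_tree adj q.
Variables (o : V) (alpha : R).
Hypothesis alpha1 : 1 < alpha.
Local Opaque gdist.
Local Notation T := (rooted o).
Local Notation mu := (@mu_alpha R V adj o q alpha).
Local Notation C := (Cplx R).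
Local Notation m A := (fine (mu A)).
Local Notation Lpn := (Lp_norm adj q alpha).
Local Notation H1 := (H1_space adj o q alpha).
Implicit Types (f g : T -> C) (D : set T) (lam : nat -> C) (a : nat -> T -> C).

Let mall (A : set T) : measurable A. Proof. by []. Qed.
Let mufin : (mu setT < +oo)%E. Proof. exact: mu_finite. Qed.
Let mfn D : mu D \is a fin_num. Proof. exact: mu_fin_num. Qed.

Lemma mu_gt0T : 0 < m setT.
Proof. exact: (fine_mu_gt0 q2 htree alpha1 (x := o : T)). Qed.

Lemma atom_L1 (a : T -> C) : atom adj q alpha a ->
  cintegrable mu a /\ \int[mu]_x normc (a x) <= 1.
Proof.
move=> [->|[D [Dd aD aN _]]].
  split; first exact: (cintegrable_bounded mall mufin (k := normc (((m setT)^-1)%:C))).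
  rewrite Rint_cst// normc_real ger0_norm ?invr_ge0 ?(ltW mu_gt0T)//.
  by rewrite mulVf// gt_eqF// mu_gt0T.
have mD : 0 < m D by exact: (dyadic_mu_gt0 q2 htree alpha1 Dd).
have aN' := proj1 (Linfty_leP adj q2 alpha a _) aN.
have ai : cintegrable mu a by exact: (cintegrable_bounded mall mufin aN').
split => //.
rewrite (Rint_split mall setT D ai) setTI.
rewrite (@Rint_eq _ _ _ mu (setT `\` D) _ (fun=> 0)); last first.
  by move=> x [_ nDx]; rewrite aD// normc0.
rewrite Rint_cst// mul0r addr0.
apply: (@le_trans _ _ (\int[mu]_(x in D) (m D)^-1)).
  by apply: Rint_le => //; exact: rintegrable_cst.
by rewrite Rint_cst// mulVf// gt_eqF.
Qed.

Lemma Lp_norm1D f g :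
  (Lpn 1 (fun x => (f x + g x)%R : C) <= Lpn 1 f + Lpn 1 g)%E.
Proof.
rewrite !Lp_norm1 -ge0_integralD//.
- apply: ge0_le_integral => //.
  + by move=> x _; rewrite lee_fin normc_ge0.
  + by move=> x _; rewrite -EFinD lee_fin normcD.
- by move=> x _; rewrite lee_fin normc_ge0.
- by move=> x _; rewrite lee_fin normc_ge0.
Qed.

Section Series.
Variables (lam : nat -> C) (a : nat -> T -> C).
Hypothesis aA : forall k, atom adj q alpha (a k).
Local Notation S n := (fun x => \sum_(k < n) lam k * a k x).

Let ai k : cintegrable mu (a k). Proof. by have [] := atom_L1 (aA k). Qed.
Let a1 k : \int[mu]_x normc (a k x) <= 1. Proof. by have [] := atom_L1 (aA k). Qed.

Lemma atomic_partial_sum n : cintegrable mu (S n) /\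
  \int[mu]_x normc (S n x) <= \sum_(k < n) normc (lam k).
Proof.
elim: n => [|n [ih1 ih2]].
  have E0 : S 0%N = fun=> 0 by apply/funext => x; rewrite big_ord0.
  split; first by rewrite E0; exact: (cintegrable_bounded mall mufin (k := normc (0 : C))).
  rewrite (@Rint_eq _ _ _ mu setT _ (fun=> 0)); last first.
    by move=> x _; rewrite big_ord0 normc0.
  by rewrite Rint_cst// mul0r big_ord0.
have E1 : S n.+1 = fun x => S n x + lam n * a n x.
  by apply/funext => x; rewrite big_ord_recr.
have li : cintegrable mu (fun x => lam n * a n x) by exact: cintegrableZ.
have Sn1 : cintegrable mu (S n.+1) by rewrite E1; exact: cintegrableD.
split => //; rewrite [leRHS]big_ord_recr /=.
apply: (@le_trans _ _ (\int[mu]_x (normc (S n x) + normc (lam n) * normc (a n x)))).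
  apply: Rint_le => //.
    by apply: rintegrableD => //; apply: rintegrableZ => //; exact: ai.
  by move=> x _; rewrite big_ord_recr (le_trans (normcD _ _))// normcM.
rewrite RintD//; last by apply: rintegrableZ => //; exact: ai.
rewrite lerD// RintZ//; last exact: ai.
by rewrite ler_piMr// normc_ge0.
Qed.

Variable g : T -> C.
Hypothesis gE : forall x, exists N, forall n, (N <= n)%N -> g x = S n x.

(** At each point [g] minus the partial sum is a finite sum of later terms, so it is dominated by
    the full nonnegative series; integrating term by term leaves the tail of [normc (lam k)],
    because atoms have [L^1] norm at most 1. *)
Lemma atomic_tail (e : R) n :
  (forall k, (n <= k)%N -> \sum_(n <= i < k) normc (lam i) <= e) ->
  (Lpn 1 (fun x => (g x - S n x)%R : C) <= e%:E)%E.
Proof.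
move=> He; rewrite Lp_norm1.
pose F k x := (normc (lam (k + n)%N) * normc (a (k + n)%N x))%:E.
have F0 k x : (0 <= F k x)%E by rewrite lee_fin mulr_ge0// normc_ge0.
apply: (@le_trans _ _ (\int[mu]_x (\sum_(k <oo) F k x))%E).
  apply: ge0_le_integral => //.
  - by move=> x _; rewrite lee_fin normc_ge0.
  - move=> x _; have [N HN] := gE x.
    apply: (@le_trans _ _ (\sum_(0 <= k < N) F k x)%E); last first.
      by apply: nneseries_lim_ge.
    rewrite sumEFin lee_fin (HN (N + n)%N) ?leq_addr//.
    rewrite -(big_mkord predT (fun k => lam k * a k x)).
    rewrite -(big_mkord predT (fun k => lam k * a k x)) (big_cat_nat (n := n))//=; last first.
      by rewrite leq_addl.
    have addNKr (u v : C) : u + v - u = v by rewrite addrC addKr.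
    rewrite addNKr -{1}(add0n n) big_addn addnK (le_trans (normc_sum _ _ _))//.
    by apply: ler_sum => i _; rewrite normcM.
rewrite integral_nneseries//; apply: lime_le.
  by apply: is_cvg_nneseries => k _ _; apply: integral_ge0.
apply: nearW => N.
apply: (@le_trans _ _ (\sum_(0 <= k < N) (normc (lam (k + n)%N))%:E)%E).
  apply: lee_sum => k _; rewrite /F.
  have ri : rintegrable mu (fun x => normc (lam (k + n)%N) * normc (a (k + n)%N x)).
    by apply: rintegrableZ => //; exact: ai.
  rewrite -EFin_Rintegral// lee_fin RintZ//; last exact: ai.
  by rewrite ler_piMr// normc_ge0.
rewrite sumEFin lee_fin (le_trans _ (He (N + n)%N (leq_addl _ _)))//.
by rewrite -{2}(add0n n) big_addn addnK.
Qed.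

Variable M : R.
Hypothesis lamM : forall n, \sum_(k < n) normc (lam k) <= M.

Lemma atomic_sum : fcarrier H1 g /\ (fnorm H1 g <= M%:E)%E.
Proof.
have sum_le : (\sum_(0 <= j <oo) (normc (lam j))%:E <= M%:E)%E.
  apply: lime_le; first by apply: is_cvg_nneseries => k _ _; rewrite lee_fin normc_ge0.
  by apply: nearW => n; rewrite sumEFin lee_fin big_mkord.
have dec : atomic_decomposition adj q alpha g lam a.
  split => //; first by rewrite (le_lt_trans sum_le)// ltry.
  apply/fine_cvgP.
  have tail (e : R) : 0 < e -> exists n0, forall n, (n0 <= n)%N ->
      (Lpn 1 (fun x => (g x - S n x)%R : C) <= e%:E)%E.
    move=> e0.
    have [N HN] := bounded_series_tail (fun k => normc_ge0 (lam k)) lamM e0.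
    exists N => n Nn; apply: atomic_tail => k nk.
    rewrite (le_trans _ (ltW (HN k (leq_trans Nn nk))))//.
    rewrite (big_cat_nat (n := n) Nn nk) /= lerDr sumr_ge0// => *; exact: normc_ge0.
  have pos n : (0 <= Lpn 1 (fun x => (g x - S n x)%R : C))%E by exact: Lnorm_ge0.
  split.
    have [N HN] := tail 1 ltr01; exists N => // n /= Nn.
    by rewrite ge0_fin_numE; [exact: (le_lt_trans (HN n Nn) (ltry 1))|exact: pos].
  apply/cvgrPdist_le => e e0; have [N HN] := tail e e0.
  exists N => // n /= Nn; rewrite sub0r normrN (ger0_norm (fine_ge0 (pos n))).
  rewrite -lee_fin fineK; first exact: HN.
  by rewrite ge0_fin_numE; [exact: (le_lt_trans (HN n Nn) (ltry e))|exact: pos].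
split; last first.
  apply: le_trans sum_le; apply: ereal_inf_lbound.
  by exists lam, a.
split; last by exists lam, a.
(* Membership in [L^1] is the tail estimate taken from index 0, where the partial sum is empty. *)
have : (Lpn 1 (fun x => (g x - S 0%N x)%R : C) <= M%:E)%E.
  by apply: atomic_tail => k _; rewrite big_mkord.
rewrite /= (_ : (fun x => g x - S 0%N x) = g); last first.
  by apply/funext => x; rewrite big_ord0 subr0.
by move=> h; rewrite (le_lt_trans h)// ltry.
Qed.

End Series.

Lemma H1_sub_L1 g : fcarrier H1 g -> (Lpn 1 g <= fnorm H1 g)%E.
Proof.
move=> [gL1 _]; apply: le_ereal_inf_tmp => _ [lam [a [[aA lamf cvg0] ->]]].
apply/lee_addgt0Pr => e e0.
set s := (\sum_(0 <= j <oo) _)%E.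
have [n hn] : exists n, (Lpn 1 (fun x => (g x - \sum_(k < n) lam k * a k x)%R : C) <= e%:E)%E.
  have [[N1 _ H1'] /cvgrPdist_le/(_ _ e0)[N2 _ H2]] := proj1 (fine_cvgP _ _) cvg0.
  exists (maxn N1 N2).
  have := H2 _ (leq_maxr N1 N2); have := H1' _ (leq_maxl N1 N2) => /= fin.
  rewrite sub0r normrN ger0_norm ?fine_ge0 ?Lnorm_ge0// => le.
  by rewrite -(fineK fin) lee_fin.
rewrite addeC -[g](_ : (fun x => (g x - \sum_(k < n) lam k * a k x) + \sum_(k < n) lam k * a k x) = g); last first.
  by apply/funext => x; rewrite subrK.
apply: (le_trans (Lp_norm1D _ _)); apply: leeD => //.
have [Si Sle] := atomic_partial_sum lam aA n.
rewrite Lp_norm1_EFin//.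
apply: (@le_trans _ _ (\sum_(0 <= k < n) (normc (lam k))%:E)%E).
  by rewrite sumEFin lee_fin big_mkord.
by apply: nneseries_lim_ge => k _ _; rewrite lee_fin normc_ge0.
Qed.

End AtomicSums.

Lemma bij_nat_pair : exists (e : nat -> nat * nat) (e' : nat * nat -> nat),
  cancel e e' /\ cancel e' e.
Proof.
have : ([set: nat] #= [set: nat * nat])%card by rewrite card_eq_sym card_nat2.
move=> /pcard_eqP/unsquash e.
have es p : exists n, e n = p by have [n _ <-] := (@surj _ _ _ _ e) p I; exists n.
have [e' eK] := choice es; exists e, e'; split => // n.
have einj := @inj _ _ _ e; apply: einj; first by rewrite inE.
  by rewrite inE.
exact: eK.
Qed.

(** * Weighted sums of the pieces as atomic series *)

Section CzHardy.
Context {R : realType} {V : choiceType} (adj : rel V) (q : nat).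
Hypothesis q2 : (1 < q)%N.
Hypothesis htree : homogeneous_tree adj q.
Variables (o : V) (alpha : R).
Hypothesis alpha1 : 1 < alpha.
Local Opaque gdist.
Local Notation T := (rooted o).
Local Notation mu := (@mu_alpha R V adj o q alpha).
Local Notation C := (Cplx R).
Local Notation m A := (fine (mu A)).
Local Notation H1 := (H1_space adj o q alpha).

Let mall (A : set T) : measurable A. Proof. by []. Qed.
Let mufin : (mu setT < +oo)%E. Proof. exact: mu_finite. Qed.
Let mfn D : mu D \is a fin_num. Proof. exact: mu_fin_num. Qed.

Lemma mu_pieces (E : set T) lab : (\sum_(n <oo) mu (piece E lab n) = mu E)%E.
Proof.
have EE : E = \bigcup_n piece E lab n.
  by apply/seteqP; split => [x Ex|x [n _ []]//]; exists (lab x).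
rewrite {2}EE measure_semi_bigcup//.
by move=> i j _ _ [x [[_ <-] [_ <-]]].
Qed.

Variables (A M r : R) (f : T -> C) (E : nat -> set T) (lab : nat -> T -> nat).
Variables (b : nat -> T -> C) (c : C).
Hypothesis A1 : 1 < A.
Hypothesis M0 : 0 < M.
Hypothesis cz : cz_decomposition adj q alpha A M r f E lab b c.
Local Notation pc j n := (piece (E j) (lab j) n).

Let A0 : 0 < A. Proof. exact: lt_trans A1. Qed.

(** On a stopping block [b j] has mean zero and is at most [M * A ^+ j], so dividing it by [sz],
    this bound times the mass of the block, makes it an atom. The coefficients of generation [j]
    then add up to [normc (w j)] times [M * A ^+ j * m (E j)]. *)
Lemma cz_H1 (w : nat -> C) (c' : C) (S : R) (g : T -> C) :
  (forall N, \sum_(j < N) normc (w j) * (A ^+ j * m (E j)) <= S) ->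
  (forall x, exists N, forall n, (N <= n)%N ->
    g x = c' + \sum_(j < n) w j * b j x) ->
  fcarrier H1 g /\ (fnorm H1 g <= (normc c' * m setT + M * S)%:E)%E.
Proof.
move=> wS gE.
have [e [e' [eK e'K]]] := bij_nat_pair.
have m0 D : 0 <= m D by exact: fine_ge0.
pose sz j n := M * A ^+ j * m (pc j n).
have sz0 j n : 0 <= sz j n.
  by rewrite mulr_ge0// mulr_ge0 ?exprn_ge0 ?(ltW A0) ?(ltW M0).
pose cst_atom : T -> C := fun=> ((m setT)^-1)%:C.
(* Index 0 carries the constant part; the pairs of a generation and a label are enumerated by [e]
   from index 1 on. *)
pose lam k : C := if k is k'.+1 then w (e k').1 * (sz (e k').1 (e k').2)%:C
  else c' * (m setT)%:C.
(* An empty piece has [sz] equal to 0; the constant atom is put there so that every term is an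
   atom. *)
pose at_ j n : T -> C := if `[< pc j n = set0 >] then cst_atom
  else fun x => if `[< pc j n x >] then ((sz j n)^-1)%:C * b j x else 0.
pose a k : T -> C := if k is k'.+1 then at_ (e k').1 (e k').2 else cst_atom.
have szP j n : pc j n <> set0 -> 0 < sz j n.
  move=> /eqP/set0P[x px]; rewrite /sz mulr_gt0//.
    by rewrite mulr_gt0// exprn_gt0.
  exact: (fine_mu_gt0 q2 htree alpha1 px).
have aA k : atom adj q alpha (a k).
  case: k => [|k]; first by left.
  rewrite /a /at_; case: asboolP => [_|ne]; first by left.
  have [//|dy] := cz_dyadic cz (e k).1 (e k).2.
  set j := (e k).1 in ne dy *; set n := (e k).2 in ne dy *.
  have s0 := szP _ _ ne.
  right; exists (pc j n); split => //.
  - by move=> x nx; case: asboolP.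
  - apply/(Linfty_leP adj q2 alpha) => x; case: asboolP => [px|_]; last first.
      by rewrite normc0 invr_ge0.
    rewrite normcM normc_real ger0_norm ?invr_ge0 ?(ltW s0)//.
    rewrite mulrC ler_pdivrMr// (le_trans (cz_bound cz j x))//.
    rewrite /sz mulrCA mulVf ?mulr1//.
    by apply: contraTneq s0 => m00; rewrite /sz m00 mulr0 ltxx.
  - rewrite wsumE (@cint_eq _ _ _ mu (pc j n) _ (fun x => ((sz j n)^-1)%:C * b j x)); last first.
      by move=> x px; case: asboolP.
    rewrite cintZ//; last first.
      exact: (cintegrable_bounded mall mufin (cz_bound cz j)).
    by rewrite (cz_mean0 cz) mulr0.
have lamM N : \sum_(k < N) normc (lam k) <= normc c' * m setT + M * S.
  have S0 : 0 <= M * S.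
    rewrite mulr_ge0 ?(ltW M0)//; have := wS 0%N; by rewrite big_ord0.
  case: N => [|N].
    by rewrite big_ord0 addr_ge0// mulr_ge0// normc_ge0.
  rewrite big_ord_recl /= normcM normc_real ger0_norm// lerD2l.
  pose F (p : nat * nat) : \bar R := (normc (w p.1) * sz p.1 p.2)%:E.
  have F0 p : (0 <= F p)%E by rewrite lee_fin mulr_ge0// normc_ge0.
  rewrite -lee_fin; apply: (@le_trans _ _ (\sum_(k <oo) F (e k))%E).
    rewrite (eq_bigr (fun k : 'I_N => fine (F (e k)))); last first.
      by move=> k _; rewrite /= normcM normc_real ger0_norm.
    rewrite -sumEFin -(big_mkord predT (fun k => F (e k))).
    by apply: nneseries_lim_ge => k _ _.
  rewrite nneseries_esumT// -(reindex_esum setT setT e F); last first.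
    split => //; first by move=> x y _ _ /(can_inj eK).
    by move=> p _; exists (e' p).
  rewrite (_ : setT = setT `*`` (fun=> setT)); last first.
    by apply/seteqP; split.
  rewrite -(@esum_esum _ _ _ setT (fun=> setT) (fun j n => F (j, n)))//.
  rewrite -nneseries_esumT; last by move=> j; exact: esum_ge0.
  have row j : (\esum_(n in setT) F (j, n) = (M * (normc (w j) * (A ^+ j * m (E j))))%:E)%E.
    rewrite -nneseries_esumT// /F /sz /=.
    under eq_eseriesr => n _ do rewrite mulrA EFinM fineK//.
    rewrite nneseriesZl; last by move=> n _; exact: measure_ge0.
    rewrite mu_pieces -(fineK (mfn (E j))) -EFinM; congr EFin; ring.
  rewrite (eq_eseriesr (fun j _ => row j)).
  apply: lime_le.
    apply: is_cvg_nneseries => j _ _.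
    rewrite lee_fin mulr_ge0 ?(ltW M0)// mulr_ge0 ?normc_ge0//.
    by rewrite mulr_ge0// exprn_ge0// ltW.
  apply: nearW => n; rewrite sumEFin lee_fin -mulr_sumr big_mkord.
  by rewrite ler_wpM2l// ltW.
apply: (atomic_sum q2 htree alpha1 aA _ lamM) => x.
have [J HJ] := cz_exit cz x; have [N1 HN1] := gE x.
pose n0 := maxn J N1.
pose kap j := e' (j, lab j x).
(* [kap j] is the place of the piece of generation [j] labelled by [x]. One successor makes the
   bound strict, the other skips the constant atom at index 0. *)
exists (\max_(j < n0) (kap j)).+2 => -[//|K]; rewrite !ltnS => HK.
have kK (j : 'I_n0) : (kap j < K)%N.
  exact: leq_ltn_trans (leq_bigmax j) HK.
rewrite (HN1 n0) ?leq_maxr// big_ord_recl /=; congr (_ + _).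
  by apply/esym; rewrite /cst_atom mulrAC mulrVK_real ?gt_eqF// mu_gt0T.
have term k : lam k.+1 * a k.+1 x =
    \sum_(j < n0) (if k == kap j then w j * b j x else 0).
  rewrite /lam /a /at_.
  case Ek : (e k) => [j0 n] /=.
  have kE : k = e' (j0, n) by rewrite -Ek eK.
  have off (j : 'I_n0) : ~ pc j0 n x -> k == kap j -> b j x = 0.
    move=> np /eqP; rewrite kE => /(can_inj e'K)[jE nE].
    apply: (cz_off cz) => Ej; apply: np; rewrite jE nE.
    by split.
  have offz : ~ pc j0 n x ->
      \sum_(j < n0) (if k == kap j then w j * b j x else 0) = 0.
    move=> np; apply: big1 => j _; case: ifP => // kj.
    by rewrite off// mulr0.
  case: asboolP => [p0|pn0].
    by rewrite /sz p0 measure0 mulr0 !mulr0 mul0r offz// p0.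
  case: asboolP => [px|npx]; last by rewrite mulr0 offz.
  have [Ej lj] := px.
  have jn0 : (j0 < n0)%N.
    rewrite ltnNge; apply/negP => le; apply: (HJ j0) => //.
    by rewrite (leq_trans (leq_maxl J N1)).
  rewrite (bigD1 (Ordinal jn0))//= big1 ?addr0; last first.
    move=> j jne; case: eqP => // kj; move: kj jne; rewrite kE => /(can_inj e'K)[jE _].
    by move=> /eqP[]; apply: val_inj.
  have szn : sz j0 n != 0.
    by rewrite gt_eqF// szP// => p0; rewrite p0 in px.
  rewrite /kap lj kE eqxx -[in RHS](mulrVK_real (w j0) szn); ring.
transitivity (\sum_(k < K) \sum_(j < n0) (if (k : nat) == kap j then w j * b j x else 0)); last first.
  by apply: eq_bigr => k _; exact: esym (term k).
rewrite exchange_big /=; apply: eq_bigr => j _.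
rewrite (bigD1 (Ordinal (kK j)))//= eqxx big1 ?addr0// => k kne.
by case: eqP => // kE; move/eqP: kne; case; apply: val_inj.
Qed.

End CzHardy.

(** * Embedding of L^p into the interpolation space *)

Section OrdinalSums.
Context {U : zmodType}.
Implicit Types F : nat -> U.

Lemma sum_ord_eq_below F N n : (forall j, (N <= j)%N -> F j = 0) -> (N <= n)%N ->
  \sum_(j < n) F j = \sum_(j < N) F j.
Proof.
move=> F0 Nn; rewrite -(subnKC Nn) big_split_ord /= [X in _ + X]big1 ?addr0// => i _.
by apply: F0; exact: leq_addr.
Qed.

Lemma sum_ord_from F N n :
  \sum_(j < n) (if (N <= j)%N then F j else 0) = \sum_(N <= j < n) F j.
Proof.
elim: n => [|n ih]; first by rewrite big_ord0 big_geq.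
rewrite big_ord_recr /= ih; case: leqP => Nn; first by rewrite big_nat_recr.
by rewrite addr0 !big_geq// ltnW.
Qed.

Lemma sum_ord_cat F N n : (N <= n)%N ->
  \sum_(j < n) F j = \sum_(j < N) F j + \sum_(N <= j < n) F j.
Proof. by move=> Nn; rewrite -!(big_mkord predT F) -big_cat_nat. Qed.

End OrdinalSums.

Lemma sum_ord_below_le {R : numDomainType} (F : nat -> R) N n : (forall j, 0 <= F j) ->
  \sum_(j < n) (if (j < N)%N then F j else 0) <= \sum_(j < N) F j.
Proof.
move=> F0; have [nN|Nn] := leqP n N.
  rewrite (sum_ord_cat F nN) (eq_bigr (fun j : 'I_n => F j)); last first.
    by move=> j _; rewrite (leq_trans (ltn_ord j) nN).
  by rewrite lerDl sumr_ge0.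
rewrite (sum_ord_eq_below (F := fun j => if (j < N)%N then F j else 0) _ (ltnW Nn)); last first.
  by move=> j Nj; rewrite ltnNge Nj.
by apply: ler_sum => j _; rewrite ltn_ord.
Qed.

Section HardyInterpolation.
Context {R : realType} {V : choiceType} (adj : rel V) (q : nat).
Hypothesis q2 : (1 < q)%N.
Hypothesis htree : homogeneous_tree adj q.
Variables (o : V) (alpha : R).
Hypothesis alpha1 : 1 < alpha.
Local Opaque gdist.
Local Notation T := (rooted o).
Local Notation mu := (@mu_alpha R V adj o q alpha).
Local Notation C := (Cplx R).
Local Notation m A := (fine (mu A)).
Local Notation Lpn := (Lp_norm adj q alpha).
Local Notation L r := (Lp_space adj o q alpha r).
Local Notation H1 := (H1_space adj o q alpha).
Local Notation X := (sum_fspace H1 (L +oo%E)).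

Lemma H1_norm_ge0 (g : T -> C) : (0 <= fnorm H1 g)%E.
Proof.
apply: le_ereal_inf_tmp => _ [lam [a [_ ->]]].
by apply: nneseries_ge0 => k _ _; rewrite lee_fin normc_ge0.
Qed.

Lemma Linfty_bounded (g : T -> C) (k : R) : (forall x, normc (g x) <= k) ->
  fcarrier (L +oo%E) g /\ (fnorm (L +oo%E) g <= k%:E)%E.
Proof.
move=> gk; have le : (Lpn +oo g <= k%:E)%E by apply/(Linfty_leP adj q2 alpha).
by split => //; apply: (le_lt_trans le); exact: ltry.
Qed.

Lemma H1_sum_space (g : T -> C) (k : R) :
  fcarrier H1 g -> (fnorm H1 g <= k%:E)%E ->
  fcarrier X g /\ (fnorm X g <= k%:E)%E.
Proof.
move=> gH gk; pose z : T -> C := fun=> 0.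
have [zL zn] : fcarrier (L +oo%E) z /\ (fnorm (L +oo%E) z <= 0%:E)%E.
  by apply: Linfty_bounded => x; rewrite normc0.
have gz : g = g \+ z by apply/funext => x; rewrite /= addr0.
split; first by exists g, z.
apply: (@le_trans _ _ (fnorm H1 g + fnorm (L +oo%E) z)%E).
  by apply: ereal_inf_lbound; exists g, z.
by rewrite -[leRHS]adde0; exact: leeD.
Qed.

Lemma sum_norm_ge0 (g : T -> C) : (0 <= fnorm X g)%E.
Proof.
apply: le_ereal_inf_tmp => _ [f0 [f1 [_ _ _ ->]]].
by apply: adde_ge0; [exact: H1_norm_ge0|exact: Lnorm_ge0].
Qed.

Lemma dual_bound (l : (T -> C) -> C) : dual_fspace X l -> exists2 K : R, 0 <= K &
  forall g (k : R), fcarrier H1 g -> (fnorm H1 g <= k%:E)%E -> normc (l g) <= K * k.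
Proof.
move=> [_ [K HK]]; exists `|K| => // g k gH gk.
have [gX gn] := H1_sum_space gH gk.
rewrite -lee_fin (le_trans (HK _ gX))//.
apply: (@le_trans _ _ (`|K|%:E * fnorm X g)%E).
  by apply: lee_wpmul2r; [exact: sum_norm_ge0|rewrite lee_fin ler_norm].
by rewrite EFinM; apply: lee_wpmul2l.
Qed.

Section Family.
Variables (A M p s : R) (f : T -> C) (E : nat -> set T) (lab : nat -> T -> nat).
Variables (b : nat -> T -> C) (c : C).
Hypothesis A1 : 1 < A.
Hypothesis M0 : 0 < M.
Hypothesis p1 : 1 < p.
Hypothesis s0 : 0 < s.
Hypothesis cz : cz_decomposition adj q alpha A M p f E lab b c.

Let A0 : 0 < A. Proof. exact: lt_trans A1. Qed.

Let m0 D : 0 <= m D. Proof. exact: fine_ge0. Qed.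

(** A complex power of [A], entire in [z]; when [p * (1 - theta) = 1] the exponent vanishes at
    [theta]. *)
Definition cz_power (z : C) (j : nat) : C :=
  cexp ((j%:R * ln A)%:C * (p%:C * (1 - z) - 1)).

(* The terms beyond the truncation vanish at [x]. *)
Definition cz_family (z : C) (x : T) : C :=
  s%:C * (c + \sum_(j < projT1 (cid (cz_exit cz x))) cz_power z j * b j x).

Let Re_power (z : C) (j : nat) :
  complex.Re ((j%:R * ln A)%:C * (p%:C * (1 - z) - 1) : C) =
  j%:R * (ln A * (p * (1 - complex.Re z) - 1)).
Proof. by case: z => x y /=; ring. Qed.

Lemma normc_cz_power (z : C) j :
  normc (cz_power z j) = (A `^ (p * (1 - complex.Re z) - 1)) ^+ j.
Proof.
by rewrite /cz_power normc_cexp Re_power /powR gt_eqF// expRM_natl (mulrC (ln A)).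
Qed.


Lemma normc_cz_power_le (z : C) j : 0 <= complex.Re z ->
  normc (cz_power z j) * (A ^+ j * m (E j)) <= (A `^ p) ^+ j * m (E j).
Proof.
move=> z0; rewrite mulrA ler_wpM2r// normc_cz_power -exprMn.
rewrite lerXn2r ?nnegrE ?mulr_ge0 ?powR_ge0 ?(ltW A0)//.
rewrite -[X in _ * X](powRr1 (ltW A0)) -powRD ?(gt_eqF A0) ?implybT//.
apply: ler_powR; first exact: ltW.
by rewrite subrK ler_piMr ?(ltW (lt_trans ltr01 p1))// lerBlDr lerDl.
Qed.

Lemma cz_family_eq (z : C) x : exists N, forall n, (N <= n)%N ->
  cz_family z x = s%:C * c + \sum_(j < n) (s%:C * cz_power z j) * b j x.
Proof.
exists (projT1 (cid (cz_exit cz x))) => n; rewrite /cz_family.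
case: cid => N /= HN Nn; rewrite mulrDr mulr_sumr; congr (_ + _).
rewrite (sum_ord_eq_below (F := fun j => (s%:C * cz_power z j) * b j x) _ Nn).
  by apply: eq_bigr => j _; rewrite mulrA.
by move=> j /HN nE; rewrite (cz_off cz nE) mulr0.
Qed.

(** The modulus of the power is largest on [Re z = 0], so the estimate of that edge holds on the
    whole half plane. It also puts the family in the sum space at every point of the closed strip,
    as the Calderon space demands. *)
Lemma cz_family_H1 (z : C) : 0 <= complex.Re z ->
  fcarrier H1 (cz_family z) /\
  (fnorm H1 (cz_family z) <= (s * (M * m setT + M * M))%:E)%E.
Proof.
move=> z0.
have [|x|gH gn] := cz_H1 q2 htree alpha1 A1 M0 cz (w := fun j => s%:C * cz_power z j)
    (c' := s%:C * c) (S := s * M) (g := cz_family z).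
- move=> N; apply: (@le_trans _ _ (s * \sum_(j < N) (A `^ p) ^+ j * m (E j))).
    rewrite mulr_sumr ler_sum// => j _.
    rewrite normcM normc_real gtr0_norm// -mulrA ler_wpM2l ?(ltW s0)//.
    exact: normc_cz_power_le.
  by rewrite ler_wpM2l ?(ltW s0)// (cz_measure cz).
- exact: cz_family_eq.
split => //; apply: (le_trans gn); rewrite lee_fin.
rewrite normcM normc_real gtr0_norm// mulrDr lerD//; last by rewrite mulrCA.
by rewrite -mulrA ler_wpM2l ?(ltW s0)// ler_wpM2r// (cz_cst_bound cz).
Qed.

Lemma cz_family_Linfty (t : R) :
  fcarrier (L +oo%E) (cz_family (1 +i* t)) /\
  (fnorm (L +oo%E) (cz_family (1 +i* t)%R) <= (s * (M + M))%:E)%E.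
Proof.
apply: Linfty_bounded => x; have [N HN] := cz_family_eq (1 +i* t) x.
rewrite (HN N (leqnn N)) (le_trans (normcD _ _))// mulrDr lerD//.
  by rewrite normcM normc_real gtr0_norm// ler_wpM2l ?(ltW s0)// (cz_cst_bound cz).
rewrite (le_trans (normc_sum _ _ _))//.
apply: (@le_trans _ _ (s * \sum_(j < N) (A ^+ j)^-1 * normc (b j x))); last first.
  by rewrite ler_wpM2l ?(ltW s0)// (cz_sum_bound cz).
rewrite mulr_sumr ler_sum// => j _.
rewrite !normcM normc_real gtr0_norm// -mulrA ler_wpM2l ?(ltW s0)//.
rewrite normc_cz_power /= subrr mulr0 sub0r powR_inv1 ?(ltW A0)//.
by rewrite exprVn.
Qed.

Lemma cz_family_theta (theta : R) : p * (1 - theta) = 1 ->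
  cz_family theta%:C = fun x => s%:C * f x.
Proof.
move=> pt; apply/funext => x.
have [N1 H1'] := cz_family_eq theta%:C x; have [N2 H2] := cz_eq cz x.
rewrite (H1' (maxn N1 N2)) ?leq_maxl// (H2 (maxn N1 N2)) ?leq_maxr//.
rewrite mulrDr mulr_sumr; congr (_ + _); apply: eq_bigr => j _.
have -> : cz_power theta%:C j = 1.
  rewrite /cz_power; have -> : p%:C * (1 - theta%:C) - 1 = 0 :> C.
    apply/eqP; rewrite eq_complex /= pt.
    by apply/andP; split; apply/eqP; [ring|ring].
  by rewrite mulr0 cexp0.
by rewrite mulr1.
Qed.

Section Dual.
Variables (l : (T -> C) -> C).
Hypothesis lX : dual_fspace X l.

(** Splitting [A ^ (j (p - 1))] off the power leaves [A ^ (- j p z)]: under [l] the family is a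
    Dirichlet series with frequencies [j p ln A]. Index 0 holds the constant term, so generation [j]
    sits at [j.+1]. *)
Let coef n : C := if n is j.+1
  then (s%:C * cexp ((j%:R * ln A)%:C * (p - 1)%:C)) * l (b j)
  else l (fun=> s%:C * c).
Let freq n : R := if n is j.+1 then j%:R * ln A * p else 0.

(** The case of [cz_H1] with a single nonzero weight. *)
Let bH j : fcarrier H1 (b j) /\ (fnorm H1 (b j) <= (M * (A ^+ j * m (E j)))%:E)%E.
Proof.
have [|x|gH gn] := cz_H1 q2 htree alpha1 A1 M0 cz (w := fun i => (i == j)%:R)
    (c' := 0) (S := A ^+ j * m (E j)) (g := b j).
- move=> N; have t0 i : 0 <= A ^+ i * m (E i) by rewrite mulr_ge0// exprn_ge0// ltW.
  have [jN|Nj] := ltnP j N.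
    rewrite (bigD1 (Ordinal jN))//= eqxx normc1 mul1r big1 ?addr0// => i ij.
    by rewrite (_ : (i : nat) == j = false) ?normc0 ?mul0r//; apply: contraNF ij => /eqP ij; apply/eqP/val_inj.
  rewrite big1// => i _; rewrite (_ : (i : nat) == j = false) ?normc0 ?mul0r//.
  by apply: ltn_eqF; rewrite (leq_trans (ltn_ord i)).
- exists j.+1 => n jn; rewrite add0r (bigD1 (Ordinal jn))//= eqxx mul1r.
  rewrite big1 ?addr0// => i ij.
  by rewrite (_ : (i : nat) == j = false) ?mul0r//; apply: contraNF ij => /eqP ij; apply/eqP/val_inj.
by move: gn; rewrite normc0 mul0r add0r.
Qed.


Let inX g : fcarrier H1 g -> fcarrier X g.
Proof.
move=> gH; pose z : T -> C := fun=> 0; exists g, z; split => //.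
  by have [] := @Linfty_bounded z 0 (fun x => _); rewrite /z ?normc0.
by apply/funext => x; rewrite /= addr0.
Qed.

Let coef_sum : exists B : R, forall n, \sum_(i < n) normc (coef i) <= B.
Proof.
have [K K0 HK] := dual_bound lX.
exists (normc (coef 0%N) + s * (K * M) * M) => -[|n].
  rewrite big_ord0 addr_ge0 ?normc_ge0// !mulr_ge0// ?ltW//.
rewrite big_ord_recl lerD2l.
apply: (@le_trans _ _ (s * (K * M) * \sum_(j < n) (A `^ p) ^+ j * m (E j))); last first.
  by apply: ler_wpM2l; [rewrite !mulr_ge0 ?(ltW s0) ?(ltW M0)|exact: (cz_measure cz)].
rewrite mulr_sumr ler_sum// => j _ /=.
have [bh bn] := bH j; have := HK _ _ bh bn => lb.
rewrite !normcM normc_real gtr0_norm// -!mulrA ler_wpM2l ?(ltW s0)//.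
have := normc_cz_power_le j (lexx (0 : R) : 0 <= complex.Re (0 : C)).
rewrite /cz_power subr0 mulr1 => le.
have -> : (p - 1)%:C = p%:C - 1 :> C by rewrite rmorphB.
rewrite (le_trans (ler_wpM2l (normc_ge0 _) lb))//.
rewrite mulrCA; apply: ler_wpM2l => //.
by rewrite mulrCA; apply: ler_wpM2l => //; exact: ltW.
Qed.

Let cz_part (z : C) N x : C :=
  s%:C * c + \sum_(j < N) (s%:C * cz_power z j) * b j x.

Let part_H1 (z : C) N : fcarrier H1 (cz_part z N).
Proof.
  have [|x|//] := cz_H1 q2 htree alpha1 A1 M0 cz
      (w := fun j => if (j < N)%N then s%:C * cz_power z j else 0) (c' := s%:C * c)
      (S := \sum_(j < N) normc (s%:C * cz_power z j) * (A ^+ j * m (E j)))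
      (g := cz_part z N).
  - move=> n; pose G j := normc (s%:C * cz_power z j) * (A ^+ j * m (E j)).
    have G0 j : 0 <= G j.
      by rewrite mulr_ge0 ?normc_ge0// mulr_ge0// exprn_ge0// ltW.
    rewrite (eq_bigr (fun j : 'I_n => if (j < N)%N then G j else 0)); last first.
      by move=> j _; case: ifP => // _; rewrite normc0 mul0r.
    exact: sum_ord_below_le.
  - exists N => n Nn; rewrite /cz_part; congr (_ + _).
    rewrite (sum_ord_eq_below
      (F := fun j => (if (j < N)%N then s%:C * cz_power z j else 0) * b j x) _ Nn).
      by apply: eq_bigr => j _; rewrite ltn_ord.
    by move=> j Nj; rewrite ltnNge Nj mul0r.
Qed.

Let part_l (z : C) N :
  l (cz_part z N) = series (fun n => coef n * cexp (- (freq n)%:C * z)) N.+1.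
Proof.
have [lin _] := lX.
elim: N => [|N ih].
  rewrite /series /= big_nat1 /= (_ : - 0%:C * z = 0) ?cexp0 ?mulr1; last first.
    by rewrite rmorph0 oppr0 mul0r.
  by congr l; apply/funext => x; rewrite /cz_part big_ord0 addr0.
have -> : cz_part z N.+1 = fun x => (s%:C * cz_power z N) * b N x + cz_part z N x.
  by apply/funext => x; rewrite /cz_part big_ord_recr /=; ring.
rewrite lin; [|exact/inX/(proj1 (bH N))|exact/inX/part_H1].
rewrite ih [RHS]seriesSr addrC; congr (_ + _) => /=.
rewrite -[RHS]mulrA [in RHS]mulrAC -!mulrA; congr (_ * _).
rewrite [LHS]mulrC; congr (_ * _); rewrite -cexpD /cz_power.
by congr cexp; rewrite rmorphB rmorph1 !rmorphM; ring.
Qed.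

(** Linearity of [l] yields finite sums only. Passing to the whole family requires the [H^1] norm of
    the remainder, which is governed by the tail of the series in [cz_measure]. *)
Let tail_le (K : R) (z : C) N (t : R) : 0 <= complex.Re z ->
  (forall g (k : R), fcarrier H1 g -> (fnorm H1 g <= k%:E)%E -> normc (l g) <= K * k) ->
  (forall n, (N <= n)%N -> \sum_(N <= j < n) (A `^ p) ^+ j * m (E j) <= t) ->
  normc (l (cz_family z) - l (cz_part z N)) <= K * (M * (s * t)).
Proof.
move=> z0 HK Ht; have [lin _] := lX.
pose g x := cz_family z x - cz_part z N x.
have t0 : 0 <= t by have := Ht N (leqnn N); rewrite big_geq.
have [|x|gH gn] := cz_H1 q2 htree alpha1 A1 M0 cz
    (w := fun j => if (N <= j)%N then s%:C * cz_power z j else 0) (c' := 0)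
    (S := s * t) (g := g).
- move=> n; pose G j := normc (s%:C * cz_power z j) * (A ^+ j * m (E j)).
  rewrite (eq_bigr (fun j : 'I_n => if (N <= j)%N then G j else 0)); last first.
    by move=> j _; case: ifP => // _; rewrite normc0 mul0r.
  rewrite sum_ord_from; have [nN|Nn] := leqP n N.
    by rewrite big_geq// mulr_ge0 ?(ltW s0).
  apply: (@le_trans _ _ (s * \sum_(N <= j < n) (A `^ p) ^+ j * m (E j))).
    rewrite mulr_sumr ler_sum// => j _; rewrite /G.
    rewrite normcM normc_real gtr0_norm// -mulrA ler_wpM2l ?(ltW s0)//.
    exact: normc_cz_power_le.
  by rewrite ler_wpM2l ?(ltW s0)// Ht// ltnW.
- have [J HJ] := cz_family_eq z x; exists (maxn J N) => n.
  rewrite geq_max => /andP[Jn Nn]; rewrite add0r /g (HJ n Jn) /cz_part.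
  rewrite (sum_ord_cat (fun j => (s%:C * cz_power z j) * b j x) Nn).
  rewrite (eq_bigr (fun j : 'I_n =>
    if (N <= j)%N then (s%:C * cz_power z j) * b j x else 0)); last first.
    by move=> j _; case: ifP => // _; rewrite mul0r.
  rewrite (sum_ord_from (fun j => (s%:C * cz_power z j) * b j x)); ring.
rewrite normc0 mul0r add0r in gn.
have -> : cz_family z = fun x => 1 * g x + cz_part z N x.
  by apply/funext => x; rewrite /g mul1r subrK.
rewrite lin; [|exact: inX|exact/inX/part_H1].
by rewrite mul1r addrK; exact: HK.
Qed.

Lemma cz_family_series (z : C) : 0 <= complex.Re z ->
  series (fun n => coef n * cexp (- (freq n)%:C * z)) @ \oo --> l (cz_family z).
Proof.
move=> z0; have [K K0 HK] := dual_bound lX.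
apply/cvgn_normcP => e e0.
pose k := K * (M * s) + 1.
have k0 : 0 < k by rewrite ltr_wpDl// mulr_ge0// mulr_ge0// ltW.
have ek : 0 < e / k by rewrite divr_gt0.
have pos j : 0 <= (A `^ p) ^+ j * m (E j) by rewrite mulr_ge0// exprn_ge0// powR_ge0.
have [N HN] := bounded_series_tail pos (cz_measure cz) ek.
exists N.+1 => -[//|n]; rewrite ltnS => Nn; rewrite -part_l normc_distC.
rewrite (le_lt_trans (tail_le (t := e / k) z0 HK _))//.
  move=> i ni; rewrite (le_trans _ (ltW (HN i (leq_trans Nn ni))))//.
  by rewrite (big_cat_nat (n := n) Nn ni) /= lerDr sumr_ge0.
have -> : K * (M * (s * (e / k))) = K * (M * s) / k * e by ring.
by rewrite gtr_pMl// ltr_pdivrMr// mul1r /k ltrDl.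
Qed.

Let freq_ge0 n : 0 <= freq n.
Proof.
case: n => [//|n] /=; rewrite mulr_ge0 ?(ltW (lt_trans ltr01 p1))//.
by rewrite mulr_ge0// ltW// ln_gt0.
Qed.

Lemma cz_family_analytic : [/\ {within closure (@strip R), continuous (fun z => l (cz_family z))},
  exists B : R, forall z, closure (@strip R) z -> normc (l (cz_family z)) <= B &
  forall z, strip z -> analytic_at (fun w => l (cz_family w)) z].
Proof.
have [B HB] := coef_sum.
have HE z : 0 <= complex.Re z <= 1 ->
    series (fun n => coef n * cexp (- (freq n)%:C * z)) @ \oo --> l (cz_family z).
  by move=> /andP[z0 _]; exact: cz_family_series.
split.
- exact: (dirichlet_continuous freq_ge0 HB HE).
- exists B => z; rewrite closure_strip => z01.
  exact: (dirichlet_bounded freq_ge0 HB HE).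
- exact: (dirichlet_analytic freq_ge0 HB HE).
Qed.


End Dual.
End Family.
End HardyInterpolation.

Section LpIntoInterpolation.
Context {R : realType} {V : choiceType} (adj : rel V) (q : nat).
Hypothesis q2 : (1 < q)%N.
Hypothesis htree : homogeneous_tree adj q.
Variables (o : V) (alpha : R).
Hypothesis alpha1 : 1 < alpha.
Variables (theta p : R).
Hypothesis theta01 : 0 < theta < 1.
Hypothesis p_theta : p^-1 = 1 - theta.
Local Opaque gdist.
Local Notation T := (rooted o).
Local Notation mu := (@mu_alpha R V adj o q alpha).
Local Notation C := (Cplx R).
Local Notation m A := (fine (mu A)).
Local Notation Lpn := (Lp_norm adj q alpha).
Local Notation L r := (Lp_space adj o q alpha r).
Local Notation H1 := (H1_space adj o q alpha).

Lemma conjugate_exponent : 1 < p /\ p * (1 - theta) = 1.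
Proof.
have [t0 t1] := andP theta01.
have p0 : 0 < p by rewrite -invr_gt0 p_theta subr_gt0.
split; last by rewrite -p_theta divff// gt_eqF.
by rewrite -(invrK p) -[ltLHS]invr1 ltf_pV2 ?posrE// ?p_theta ?subr_gt0//; lra.
Qed.

Lemma Lp_scale (f : T -> C) (s r : R) : 0 < s -> 0 < r -> (Lpn r%:E f <= s%:E)%E ->
  (\int[mu]_x ((normc (s^-1%:C * f x)) `^ r)%:E <= 1)%E.
Proof.
move=> s0 r0 /(Lp_leP adj q alpha f r0 (ltW s0)) le.
have -> : (\int[mu]_x ((normc (s^-1%:C * f x)) `^ r)%:E =
    \int[mu]_x (((s `^ r)^-1)%:E * ((normc (f x)) `^ r)%:E))%E.
  apply: eq_integral => x _; rewrite normcM normc_real ger0_norm ?invr_ge0 ?(ltW s0)//.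
  rewrite powRM ?invr_ge0 ?normc_ge0 ?(ltW s0)// EFinM; congr (_%:E * _)%E.
  by rewrite -powR_inv1 ?(ltW s0)// -powRrM mulN1r powRN.
rewrite ge0_integralZl//; last 2 first.
- by move=> x _; rewrite lee_fin powR_ge0.
- by rewrite lee_fin invr_ge0 powR_ge0.
have sr : 0 < s `^ r by rewrite powR_gt0.
apply: (@le_trans _ _ (((s `^ r)^-1)%:E * (s `^ r)%:E)%E).
  by apply: lee_wpmul2l => //; rewrite lee_fin invr_ge0 ltW.
by rewrite -EFinM mulVf// gt_eqF.
Qed.

Lemma Lp_sub_H1_Linfty : exists2 K : R, 0 < K & forall f : T -> C,
  (Lpn p%:E f < +oo)%E ->
  fcarrier (complex_interpolation H1 (L +oo%E) theta) f /\
  (fnorm (complex_interpolation H1 (L +oo%E) theta) f <= K%:E * Lpn p%:E f)%E.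
Proof.
have [p1 pt] := conjugate_exponent.
have p0 : 0 < p by rewrite (lt_trans ltr01).
have [A [M [A1 M0 H]]] := cz_tree q2 htree o alpha1 p1.
have mT0 : 0 <= m setT by exact: fine_ge0.
pose K := M * m setT + M * M + (M + M).
have h1 : 0 <= M * m setT by rewrite mulr_ge0// ltW.
have h2 : 0 <= M * M by rewrite mulr_ge0// ltW.
have K0 : 0 < K by rewrite /K; lra.
exists K => // f ffin.
have f0 : (0 <= Lpn p%:E f)%E by exact: Lnorm_ge0.
have fE : Lpn p%:E f = (fine (Lpn p%:E f))%:E.
  by rewrite fineK// ge0_fin_numE.
set N := fine (Lpn p%:E f) in fE.
have N0 : 0 <= N by exact: fine_ge0.
(* The scale [s] may exceed the norm [N], which can be zero while the rescaling needs [0 < s]; an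
   excess [e / K] is removed at the end. *)
have main s : 0 < s -> N <= s -> exists2 F, calderon_space H1 (L +oo%E) F &
    F theta%:C = f /\ (calderon_norm H1 (L +oo%E) F <= (s * K)%:E)%E.
  move=> s0 Ns.
  have /H[E [lab [b [c cz]]]] : (\int[mu]_x ((normc (s^-1%:C * f x)) `^ p)%:E <= 1)%E.
    by apply: Lp_scale => //; rewrite fE lee_fin.
  pose F := cz_family s cz.
  have FH z := cz_family_H1 q2 htree alpha1 A1 M0 p1 s0 cz (z := z).
  have FL t := cz_family_Linfty q2 A1 s0 cz t.
  have le : (calderon_norm H1 (L +oo%E) F <= (s * K)%:E)%E.
    apply: ge_ereal_sup => _ [t _ <-]; rewrite ge_max; apply/andP; split.
      have [_ le] := FH (0 +i* t) (lexx _); apply: (le_trans le).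
      by rewrite lee_fin ler_wpM2l ?(ltW s0)// /K; lra.
    have [_ le] := FL t; apply: (le_trans le).
    by rewrite lee_fin ler_wpM2l ?(ltW s0)// /K; lra.
  exists F; last first.
    split => //; rewrite /F (cz_family_theta s cz pt); apply/funext => x.
    rewrite mulrA -rmorphM divff ?gt_eqF// rmorph1 mul1r//.
  split.
  - move=> z; rewrite closure_strip => /andP[z0 _].
    have [FH1 FH2] := FH z z0.
    by have [] := H1_sum_space q2 FH1 FH2.
  - move=> l lX; exact: (cz_family_analytic q2 htree alpha1 A1 M0 p1 s0 cz lX).
  - by move=> t; split; [have [] := FH (0 +i* t) (lexx _)|have [] := FL t].
  - by apply: (le_lt_trans le); exact: ltry.
split.
  have [F FC [Ff _]] := main (N + 1) (ltr_wpDl N0 ltr01) (ler_wpDr ler01 (lexx _)).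
  by exists F.
rewrite fE -EFinM; apply/lee_addgt0Pr => e e0.
have eK : 0 < e / K by rewrite divr_gt0.
have [F FC [Ff Fle]] := main (N + e / K) (ltr_wpDl N0 eK) (ler_wpDr (ltW eK) (lexx _)).
apply: (@le_trans _ _ (calderon_norm H1 (L +oo%E) F)).
  by apply: ereal_inf_lbound; exists F.
by rewrite (le_trans Fle)// lee_fin mulrDl divfK ?gt_eqF// mulrC.
Qed.

End LpIntoInterpolation.

(** * Embedding of the interpolation space into L^p *)

Section TameFunctions.
Context {R : realType}.
Local Notation C := (Cplx R).
Implicit Types (h g : C -> C).

(** The regularity that [strip_max_principle] asks for. It is stable under sums and products, so a
    pairing of two moving families can be assembled from its factors. *)
Record strip_tame h : Prop := StripTame {
  tame_continuous : {within closure (@strip R), continuous h} ;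
  tame_bounded : exists B : R, forall z, closure (@strip R) z -> normc (h z) <= B ;
  tame_taylor2 : forall z, strip z -> taylor2 h z
}.

Lemma strip_tameD h g : strip_tame h -> strip_tame g ->
  strip_tame (fun z => h z + g z).
Proof.
move=> [hc [B hB] ht] [gc [B' gB] gt]; split.
- by move=> z; apply: cvgD; [exact: hc|exact: gc].
- exists (B + B') => z zS; rewrite (le_trans (normcD _ _))// lerD//.
    exact: hB.
  exact: gB.
- by move=> z zS; apply: taylor2D; [exact: ht|exact: gt].
Qed.

Lemma strip_tameM h g : strip_tame h -> strip_tame g ->
  strip_tame (fun z => h z * g z).
Proof.
move=> [hc [B hB] ht] [gc [B' gB] gt]; split.
- by move=> z; apply: cvgM; [exact: hc|exact: gc].
- exists (B * B') => z zS; rewrite normcM ler_pM ?normc_ge0//.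
    exact: hB.
  exact: gB.
- by move=> z zS; apply: taylor2M; [exact: ht|exact: gt].
Qed.

Lemma strip_tame_cst (a : C) : strip_tame (fun=> a).
Proof.
split; first by move=> z; exact: cvg_cst.
  by exists (normc a).
by move=> z _; exact: taylor2_cst.
Qed.

Lemma strip_tame_sum (I : Type) (s : seq I) (F : I -> C -> C) :
  (forall i, strip_tame (F i)) -> strip_tame (fun z => \sum_(i <- s) F i z).
Proof.
move=> H; elim: s => [|i s ih].
  rewrite (_ : (fun _ => _) = fun=> 0); first exact: strip_tame_cst.
  by apply/funext => z; rewrite big_nil.
rewrite (_ : (fun _ => _) = fun z => F i z + \sum_(j <- s) F j z).
  exact: strip_tameD.
by apply/funext => z; rewrite big_cons.
Qed.

Lemma strip_tame_cexp (a b : R) : strip_tame (fun z => cexp (a%:C * z + b%:C)).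
Proof.
split.
- apply/within_continuous_normcP => z _ e e0.
  by have [d d0 H] := continuous_cexp a%:C b%:C z e0; exists d => // w _; exact: H.
- exists (expR (`|a| + `|b|)) => z; rewrite closure_strip => /andP[z0 z1].
  rewrite normc_cexp ler_expR.
  have -> : complex.Re (a%:C * z + b%:C : C) = a * complex.Re z + b.
    by case: (z) => x y /=; ring.
  rewrite lerD ?ler_norm// (le_trans (ler_norm _))// normrM ler_piMr//.
  by rewrite ger0_norm.
- by move=> z _; exact: taylor2_cexp.
Qed.

End TameFunctions.

(** * BMO, the sum space and bounded test functions *)

Section BMO.
Context {R : realType} {V : choiceType} (adj : rel V) (q : nat).
Hypothesis q2 : (1 < q)%N.
Hypothesis htree : homogeneous_tree adj q.
Variables (o : V) (alpha : R).
Hypothesis alpha1 : 1 < alpha.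
Local Opaque gdist.
Local Notation T := (rooted o).
Local Notation mu := (@mu_alpha R V adj o q alpha).
Local Notation C := (Cplx R).
Local Notation m A := (fine (mu A)).
Local Notation Lpn := (Lp_norm adj q alpha).
Local Notation L r := (Lp_space adj o q alpha r).
Local Notation BMO := (BMO_space adj o q alpha).
Local Notation bmon := (BMO_norm adj q alpha).
Local Notation avg := (average adj q alpha).
Local Notation S := (sum_fspace (L 1%E) BMO).
Implicit Types (f g h : T -> C).

Let mall (A : set T) : measurable A. Proof. by []. Qed.
Let mufin : (mu setT < +oo)%E. Proof. exact: mu_finite. Qed.
Let mfn D : mu D \is a fin_num. Proof. exact: mu_fin_num. Qed.
Let mT0 : 0 < m setT. Proof. exact: mu_gt0T. Qed.

Lemma cintegrable_sub_cst f (a : C) : cintegrable mu f ->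
  cintegrable mu (fun x => f x - a).
Proof.
move=> fi; rewrite (_ : (fun _ => _) = fun x => f x + (- a))//.
by apply: cintegrableD => //; exact: (cintegrable_bounded mall mufin (k := normc (- a))).
Qed.

Lemma oscillation_ge0 f D : (0 <= oscillation adj q alpha f D)%E.
Proof.
apply: mule_ge0; first by rewrite lee_fin invr_ge0 fine_ge0.
by apply: integral_ge0 => x _; rewrite lee_fin normc_ge0.
Qed.

Lemma BMO_sup_ge0 f :
  (0 <= ereal_sup [set oscillation adj q alpha f D | D in dyadic adj o])%E.
Proof.
apply: (le_trans (oscillation_ge0 f setT)).
apply: ereal_sup_ubound; exists setT => //; exact: (dyadicT htree o).
Qed.

Lemma BMO_norm_ge0 f : (0 <= bmon f)%E.
Proof. by apply: adde_ge0; [exact: BMO_sup_ge0|rewrite lee_fin normc_ge0]. Qed.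

Lemma BMO_oscillation f (k : R) (D : set T) : cintegrable mu f ->
  (bmon f <= k%:E)%E -> dyadic adj o D ->
  \int[mu]_(x in D) normc (f x - avg D f) <= k * m D.
Proof.
move=> fi fk Dd.
have mD : 0 < m D by exact: (dyadic_mu_gt0 q2 htree alpha1 Dd).
have ci := cintegrable_sub_cst (avg D f) fi.
have : (oscillation adj q alpha f D <= k%:E)%E.
  apply: le_trans fk; apply: (@le_trans _ _
    (ereal_sup [set oscillation adj q alpha f D | D in dyadic adj o])).
    by apply: ereal_sup_ubound; exists D.
  by apply: leeDl; rewrite lee_fin normc_ge0.
rewrite /oscillation -(EFin_Rintegral mall _ ci) -EFinM lee_fin.
by rewrite mulrC ler_pdivrMr.
Qed.

Lemma BMO_mean f (k : R) : (bmon f <= k%:E)%E -> normc (cint mu setT f) <= k.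
Proof.
move=> fk; rewrite -lee_fin; apply: le_trans fk.
by apply: leeDr; exact: BMO_sup_ge0.
Qed.

(** The whole space is dyadic, so the oscillation over it and the modulus of the mean, both part of
    the norm, control the [L^1] norm. *)
Lemma BMO_L1 f (k : R) : cintegrable mu f -> (bmon f <= k%:E)%E ->
  \int[mu]_x normc (f x) <= (1 + m setT) * k.
Proof.
move=> fi fk; pose a := avg setT f.
have ci := cintegrable_sub_cst a fi.
have ai : rintegrable mu (fun=> normc a) by exact: rintegrable_cst.
apply: (@le_trans _ _ (\int[mu]_x (normc (f x - a) + normc a))).
  apply: Rint_le => //; first exact: rintegrableD.
  by move=> x _; rewrite -{1}(subrK a (f x)) normcD.
rewrite RintD// Rint_cst// addrC mulrDl mul1r lerD//.
  rewrite /a /average normcM normc_real ger0_norm ?invr_ge0 ?(ltW mT0)//.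
  rewrite mulrAC mulVf ?gt_eqF// mul1r; exact: BMO_mean.
by rewrite mulrC; exact: (BMO_oscillation fi fk (dyadicT htree o)).
Qed.

Lemma sum_space_L1 g : fcarrier S g -> cintegrable mu g.
Proof.
move=> [f0 [f1 [/L1P f0i [/L1P f1i _] ->]]].
exact: cintegrableD.
Qed.

Lemma sum_norm_L1 g : fcarrier S g ->
  ((\int[mu]_x normc (g x))%:E <= (1 + m setT)%:E * fnorm S g)%E.
Proof.
move=> gS; have m1 : 0 < 1 + m setT by rewrite ltr_wpDl// ltW.
rewrite -lee_pdivrMl//; apply: le_ereal_inf_tmp => _ [f0 [f1 [f0L [f1L f1B] gE ->]]].
have f0i := proj1 (L1P _ _ _ _) f0L; have f1i := proj1 (L1P _ _ _ _) f1L.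
have bE : bmon f1 = (fine (bmon f1))%:E.
  by rewrite fineK// ge0_fin_numE//; exact: BMO_norm_ge0.
rewrite lee_pdivrMl//= (Lp_norm1_EFin f0i) bE -EFinD -EFinM lee_fin.
apply: (@le_trans _ _ (\int[mu]_x (normc (f0 x) + normc (f1 x)))).
  rewrite gE; apply: Rint_le => //; first exact: cintegrableD.
    exact: rintegrableD.
  by move=> x _; exact: normcD.
rewrite RintD// mulrDr lerD//.
  by rewrite ler_peMl ?Rintegral_ge0// ?lerDl ?(ltW mT0)// => x _; exact: normc_ge0.
by apply: BMO_L1 => //; rewrite -bE.
Qed.

Definition pairing h g : C := cint mu setT (fun x => h x * g x).

(** Both spaces of the couple embed into [L^1], against which a bounded function pairs continuously;
    the weak analyticity in the Calderon space therefore covers such pairings. *)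
Lemma pairing_dual h (B : R) : (forall x, normc (h x) <= B) ->
  dual_fspace S (pairing h).
Proof.
move=> hB; have B0 : 0 <= B by rewrite (le_trans _ (hB (o : T)))// normc_ge0.
split.
  move=> c f g /sum_space_L1 fi /sum_space_L1 gi.
  have hf : cintegrable mu (fun x => h x * f x) by exact: (cintegrableMb mall hB).
  have hg : cintegrable mu (fun x => h x * g x) by exact: (cintegrableMb mall hB).
  rewrite /pairing -cintZ// -cintD//; last exact: cintegrableZ.
  by apply: cint_eq => x _; ring.
exists (2 * B * (1 + m setT)) => g gS.
have gi := sum_space_L1 gS.
have hg : cintegrable mu (fun x => h x * g x) by exact: (cintegrableMb mall hB).
apply: (@le_trans _ _ ((2 * B)%:E * (\int[mu]_x normc (g x))%:E)%E).
  rewrite -EFinM lee_fin (le_trans (normc_cint mall _ hg))// -mulrA ler_wpM2l//.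
  rewrite -RintZ//; apply: Rint_le => //; first exact: rintegrableZ.
  by move=> x _; rewrite normcM ler_wpM2r// normc_ge0.
rewrite (EFinM (2 * B)) -muleA; apply: lee_wpmul2l; first by rewrite lee_fin mulr_ge0.
exact: sum_norm_L1.
Qed.

Lemma calderon_tame (F : C -> T -> C) h (B : R) : (forall x, normc (h x) <= B) ->
  calderon_space (L 1%E) BMO F -> strip_tame (fun z => pairing h (F z)).
Proof.
move=> hB [_ Fl _ _]; have [c b a] := Fl _ (pairing_dual hB).
by split => // z /a /analytic_taylor2.
Qed.

End BMO.

(** * The pairing of two analytic families *)

Section PairingBound.
Context {R : realType} {V : choiceType} (adj : rel V) (q : nat).
Hypothesis q2 : (1 < q)%N.
Hypothesis htree : homogeneous_tree adj q.
Variables (o : V) (alpha : R).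
Hypothesis alpha1 : 1 < alpha.
Local Opaque gdist.
Local Notation T := (rooted o).
Local Notation mu := (@mu_alpha R V adj o q alpha).
Local Notation C := (Cplx R).
Local Notation m A := (fine (mu A)).
Local Notation Lpn := (Lp_norm adj q alpha).
Local Notation L r := (Lp_space adj o q alpha r).
Local Notation BMO := (BMO_space adj o q alpha).
Local Notation bmon := (BMO_norm adj q alpha).
Local Notation avg := (average adj q alpha).
Local Notation pair := (@pairing R V adj q o alpha).
Implicit Types (f g : T -> C).

Let mall (A : set T) : measurable A. Proof. by []. Qed.
Let mufin : (mu setT < +oo)%E. Proof. exact: mu_finite. Qed.

Variables (A M r s theta : R) (h : T -> C) (E : nat -> set T) (lab : nat -> T -> nat).
Variables (b : nat -> T -> C) (c : C) (J : nat) (F : C -> T -> C).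
Hypothesis A1 : 1 < A.
Hypothesis M0 : 0 < M.
Hypothesis r1 : 1 < r.
Hypothesis s0 : 0 <= s.
Hypothesis cz : cz_decomposition adj q alpha A M r h E lab b c.
Hypothesis EJ : forall j, (J <= j)%N -> E j = set0.
Hypothesis FC : calderon_space (L 1%E) BMO F.
Hypothesis Fs : (calderon_norm (L 1%E) BMO F <= s%:E)%E.

Let A0 : 0 < A. Proof. exact: lt_trans A1. Qed.
Let m0 D : 0 <= m D. Proof. exact: fine_ge0. Qed.
Let AX0 j : 0 <= A ^+ j. Proof. by rewrite exprn_ge0// ltW. Qed.

(** The mirror image of [cz_power]: the modulus is [A ^ (- j)] on [Re z = 0] and [A ^ (j (r - 1))]
    on [Re z = 1], and the value at [theta] is 1 when [r * theta = 1]. *)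
Let P j (z : C) : C := cexp ((j%:R * ln A * r)%:C * z + (- (j%:R * ln A))%:C).

Let normcP j (z : C) : normc (P j z) = (A `^ (r * complex.Re z - 1)) ^+ j.
Proof.
rewrite /P normc_cexp.
have -> : complex.Re ((j%:R * ln A * r)%:C * z + (- (j%:R * ln A))%:C : C) =
    j%:R * ((r * complex.Re z - 1) * ln A) by case: (z) => x y /=; ring.
by rewrite expRM_natl /powR gt_eqF.
Qed.

(** The pairing of [G z] with [F z], expanded so that each summand is an exponential or a constant
    times the pairing of [F z] with a fixed bounded function; tameness is read off this form. *)
Let Phi z := c * pair (fun=> 1) (F z) + \sum_(j < J) P j z * pair (b j) (F z).
Let G z (x : T) : C := c + \sum_(j < J) P j z * b j x.

Let bounded_one (x : T) : normc ((fun=> 1 : C) x) <= 1.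
Proof. by rewrite normc1. Qed.

Let Phi_tame : strip_tame Phi.
Proof.
apply: strip_tameD.
  apply: strip_tameM; first exact: strip_tame_cst.
  exact: (calderon_tame q2 htree alpha1 bounded_one FC).
apply: strip_tame_sum => j; apply: strip_tameM; first exact: strip_tame_cexp.
exact: (calderon_tame q2 htree alpha1 (cz_bound cz j) FC).
Qed.

Let Phi_pair z : cintegrable mu (F z) -> Phi z = pair (G z) (F z).
Proof.
move=> Fi; have bi j : cintegrable mu (fun x => b j x * F z x).
  exact: (cintegrableMb mall (cz_bound cz j)).
have Pbi (j : 'I_J) : cintegrable mu (fun x => P j z * (b j x * F z x)).
  exact: cintegrableZ.
have oneF : cintegrable mu (fun x => 1 * F z x) by exact: cintegrableZ.
have [si sE] := cint_sum mall mufin setT (index_enum 'I_J) Pbi.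
rewrite /Phi /pairing -cintZ//.
under eq_bigr do rewrite -(cintZ mall _ _ (bi _)).
rewrite -sE -cintD//; last exact: cintegrableZ.
apply: cint_eq => x _; rewrite /G mulrDl mulr_suml mul1r; congr (_ + _).
by apply: eq_bigr => j _; rewrite mulrA.
Qed.

Let F0 (t : R) : cintegrable mu (F (0 +i* t)) /\
  \int[mu]_x normc (F (0 +i* t) x) <= s.
Proof.
have [_ _ edge _] := FC; have [F0L _] := edge t.
have F0i := proj1 (L1P _ _ _ _) F0L; split => //.
rewrite -lee_fin -(Lp_norm1_EFin F0i); apply: le_trans Fs.
apply: (@le_trans _ _ (maxe (fnorm (L 1%E) (F (0 +i* t)%R)) (fnorm BMO (F (1 +i* t)%R)))).
  by rewrite le_max lexx.
by apply: ereal_sup_ubound; exists t.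
Qed.

Let F1 (t : R) : cintegrable mu (F (1 +i* t)) /\ (bmon (F (1 +i* t)%R) <= s%:E)%E.
Proof.
have [_ _ edge _] := FC; have [_ [F1L _]] := edge t.
have F1i := proj1 (L1P _ _ _ _) F1L; split => //; apply: le_trans Fs.
apply: (@le_trans _ _ (maxe (fnorm (L 1%E) (F (0 +i* t)%R)) (fnorm BMO (F (1 +i* t)%R)))).
  by rewrite le_max lexx orbT.
by apply: ereal_sup_ubound; exists t.
Qed.

(** The first term bounds the edge [Re z = 0]: a factor 2 from [normc_cint] times the bound [2 * M]
    of [G]. The other two come from the mean and from the generations on [Re z = 1]. *)
Definition pairing_const : R := 4 * M + (M + 4 * (M * M)).

Let Phi0 (t : R) : normc (Phi (0 +i* t)) <= s * pairing_const.
Proof.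
have [Fi Fle] := F0 t; set z := 0 +i* t in Fi Fle *.
rewrite Phi_pair// /pairing.
have Gle x : normc (G z x) <= 2 * M.
  rewrite /G (le_trans (normcD _ _))// mulr_natl mulr2n lerD// ?(cz_cst_bound cz)//.
  rewrite (le_trans (normc_sum _ _ _))//.
  rewrite (le_trans _ (cz_sum_bound cz J x))// ler_sum// => j _.
  rewrite normcM normcP /= mulr0 sub0r powR_inv1 ?(ltW A0)// exprVn.
  exact: lexx.
have GFi : cintegrable mu (fun x => G z x * F z x) by exact: (cintegrableMb mall Gle).
rewrite (le_trans (normc_cint mall _ GFi))//.
have le : \int[mu]_x normc (G z x * F z x) <= 2 * M * \int[mu]_x normc (F z x).
  rewrite -RintZ//; apply: Rint_le => //; first exact: rintegrableZ.
  by move=> x _; rewrite normcM ler_wpM2r// normc_ge0.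
have le2 : 2 * M * \int[mu]_x normc (F z x) <= 2 * M * s.
  by rewrite ler_wpM2l// mulr_ge0// ltW.
have MM : 0 <= s * (M + 4 * (M * M)).
  by rewrite mulr_ge0// addr_ge0 ?(ltW M0)// !mulr_ge0// ltW.
rewrite /pairing_const mulrDr; lra.
Qed.

(** Duality of atoms and oscillation: [b j] has mean zero on each block, so the block average of [F]
    can be subtracted, and the remaining oscillation is at most [s] times the mass of the block. The
    factor 4 is 2 from [normc_cint] and 2 from [cint_pieces_le]. *)
Let pair_b j (t : R) :
  normc (pair (b j) (F (1 +i* t))) <= s * (4 * (M * (A ^+ j * m (E j)))).
Proof.
have [Fi Fle] := F1 t; set z := 1 +i* t in Fi Fle *.
have bi : cintegrable mu (b j) by exact: (cintegrable_bounded mall mufin (cz_bound cz j)).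
have bFi : cintegrable mu (fun x => b j x * F z x).
  exact: (cintegrableMb mall (cz_bound cz j)).
rewrite /pairing (cint_restrict mall (E := E j) bFi) ?setTI; last first.
  by move=> x _ nE; rewrite (cz_off cz nE) mul0r.
pose k := 2 * (M * A ^+ j * s).
have k0 : 0 <= k by rewrite !mulr_ge0// ltW.
apply: (le_trans (cint_pieces_le mall (lab := lab j) (v := fun=> k) bFi _ _)).
- exact: rintegrable_cst.
- move=> n; have [->|dy] := cz_dyadic cz j n.
    by rewrite cint_set0 Rintegral_set0 normc0.
  set D := piece _ _ _ in dy *.
  have Fai := cintegrable_sub_cst q2 htree alpha1 (avg D (F z)) Fi.
  have bFai : cintegrable mu (fun x => b j x * (F z x - avg D (F z))).
    exact: (cintegrableMb mall (cz_bound cz j)).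
  have -> : cint mu D (fun x => b j x * F z x) =
      cint mu D (fun x => b j x * (F z x - avg D (F z))).
    transitivity (cint mu D (fun x => b j x * (F z x - avg D (F z)) + avg D (F z) * b j x)).
      by apply: cint_eq => x _; ring.
    rewrite cintD//; last exact: cintegrableZ.
    by rewrite cintZ// (cz_mean0 cz) mulr0 addr0.
  rewrite (le_trans (normc_cint mall _ bFai))// Rint_cst// /k -mulrA ler_wpM2l//.
  have osc := BMO_oscillation q2 htree alpha1 Fi Fle dy.
  apply: (@le_trans _ _ (M * A ^+ j * \int[mu]_(x in D) normc (F z x - avg D (F z)))).
    rewrite -RintZ//; apply: Rint_le => //; first exact: rintegrableZ.
    by move=> x _; rewrite normcM ler_wpM2r ?normc_ge0// (cz_bound cz).
  by rewrite -(mulrA (M * A ^+ j)) ler_wpM2l// mulr_ge0// ltW.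
- rewrite Rint_cst// /k le_eqVlt; apply/orP; left; apply/eqP; ring.
Qed.

Let Phi1 (t : R) : normc (Phi (1 +i* t)) <= s * pairing_const.
Proof.
have [Fi Fle] := F1 t; rewrite /Phi (le_trans (normcD _ _))//.
have h1 : normc (c * pair (fun=> 1) (F (1 +i* t))) <= s * M.
  rewrite normcM mulrC ler_pM ?normc_ge0 ?(cz_cst_bound cz)//.
  have -> : pair (fun=> 1) (F (1 +i* t)) = cint mu setT (F (1 +i* t)).
    by apply: cint_eq => x _; rewrite mul1r.
  exact: (BMO_mean htree Fle).
have h2 : normc (\sum_(j < J) P j (1 +i* t) * pair (b j) (F (1 +i* t))) <=
    s * (4 * (M * M)).
  rewrite (le_trans (normc_sum _ _ _))//.
  apply: (@le_trans _ _ (s * (4 * (M * \sum_(j < J) (A `^ r) ^+ j * m (E j))))); last first.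
    by rewrite ler_wpM2l// ler_wpM2l// ler_wpM2l ?(ltW M0)// (cz_measure cz).
  rewrite !mulr_sumr ler_sum// => j _; rewrite normcM normcP /= mulr1.
  rewrite (le_trans (ler_wpM2l (exprn_ge0 j (powR_ge0 _ _)) (pair_b j t)))//.
  have -> : A `^ r = A `^ (r - 1) * A.
    by rewrite mulrC mulr_powRB1 ?(ltW A0)// (lt_trans ltr01).
  by rewrite exprMn le_eqVlt; apply/orP; left; apply/eqP; ring.
have h3 : 0 <= s * (4 * M) by rewrite mulr_ge0// mulr_ge0// ltW.
rewrite /pairing_const !mulrDr; lra.
Qed.

Lemma pairing_bound : 0 < theta < 1 -> r * theta = 1 ->
  normc (pair h (F theta%:C)) <= s * pairing_const.
Proof.
move=> t01 rt; have st : strip (theta%:C : C) by [].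
have [c_ [B HB] ta] := Phi_tame.
have := strip_max_principle c_ HB ta Phi0 Phi1 st.
have Fi : cintegrable mu (F theta%:C).
  have [FX _ _ _] := FC.
  have cl : closure (@strip R) theta%:C by apply: subset_closure.
  exact: sum_space_L1 (FX _ cl).
(* At [theta] all powers equal 1, and the terms from [J] on vanish since [E j] is empty, so [G]
   takes the value [h]. *)
rewrite Phi_pair// (_ : G theta%:C = h)//; apply/funext => x.
have [N HN] := cz_eq cz x; rewrite (HN (maxn N J)) ?leq_maxl// /G; congr (_ + _).
rewrite (sum_ord_eq_below (F := fun j => b j x) _ (leq_maxr N J)).
  apply: eq_bigr => j _; rewrite /P (_ : _ + _ = 0) ?cexp0 ?mul1r//.
  apply/eqP; rewrite eq_complex /=; apply/andP; split; apply/eqP; last by ring.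
  by rewrite -(mulrA _ r) rt; ring.
by move=> j /EJ Ej; apply: (cz_off cz); rewrite Ej.
Qed.

End PairingBound.

(** * Duality and the bound in [L^p] *)

Section InterpolationIntoLp.
Context {R : realType} {V : choiceType} (adj : rel V) (q : nat).
Hypothesis q2 : (1 < q)%N.
Hypothesis htree : homogeneous_tree adj q.
Variables (o : V) (alpha : R).
Hypothesis alpha1 : 1 < alpha.
Variables (theta p : R).
Hypothesis theta01 : 0 < theta < 1.
Hypothesis p_theta : p^-1 = 1 - theta.
Local Opaque gdist.
Local Notation T := (rooted o).
Local Notation mu := (@mu_alpha R V adj o q alpha).
Local Notation C := (Cplx R).
Local Notation m A := (fine (mu A)).
Local Notation Lpn := (Lp_norm adj q alpha).
Local Notation L r := (Lp_space adj o q alpha r).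
Local Notation BMO := (BMO_space adj o q alpha).
Local Notation pair := (@pairing R V adj q o alpha).

Let mall (A : set T) : measurable A. Proof. by []. Qed.
Let mufin : (mu setT < +oo)%E. Proof. exact: mu_finite. Qed.

Local Notation r := (theta^-1).

Let r1 : 1 < r.
Proof. by have [t0 t1] := andP theta01; rewrite invf_gt1. Qed.

Let p1 : 1 < p. Proof. exact: (conjugate_exponent theta01 p_theta).1. Qed.
Let p0 : 0 < p. Proof. exact: lt_trans p1. Qed.
Let t0 : 0 < theta. Proof. by case/andP: theta01. Qed.

(** Since [1 / r = theta = 1 - 1 / p], the exponent [r] is conjugate to [p]. *)
Let p1r : (p - 1) * r = p.
Proof.
have [_ pt] := conjugate_exponent theta01 p_theta.
have -> : p - 1 = p * theta by rewrite -pt; ring.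
by rewrite mulfK// gt_eqF.
Qed.

(** The test function is the extremal one of the Holder inequality, the conjugate of [f] times
    [|f| ^ (p - 2) / I ^ theta], cut to the set where [normc (f x) <= N] to be bounded. Its
    [r]-integral is 1 because [(p - 1) * r = p], and its pairing with [f] is
    [I ^ (1 - theta) = I ^ (1 / p)]. *)
Lemma duality_truncated (f : T -> C) (k : R) (N : nat) : 0 <= k ->
  (forall h (B : R), (forall x, normc (h x) <= B) ->
    (\int[mu]_x ((normc (h x)) `^ r)%:E <= 1)%E -> normc (pair h f) <= k) ->
  \int[mu]_x (if normc (f x) <= N%:R then normc (f x) `^ p else 0) <= k `^ p.
Proof.
move=> k0 H.
pose u x : R := if normc (f x) <= N%:R then normc (f x) `^ p else 0.
have f0 x : 0 <= normc (f x) by exact: normc_ge0.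
have u0 x : 0 <= u x by rewrite /u; case: ifP => // _; exact: powR_ge0.
have uN x : u x <= N%:R `^ p.
  rewrite /u; case: ifP => [le|_]; last exact: powR_ge0.
  by apply: ge0_ler_powR => //; rewrite ?nnegrE// ltW.
have ui : rintegrable mu u.
  by apply: (rintegrable_bounded mall mufin (k := N%:R `^ p)) => x; rewrite ger0_norm.
pose I := \int[mu]_x u x.
have I0 : 0 <= I by apply: Rintegral_ge0.
rewrite -/I; move: I0; rewrite le_eqVlt => /predU1P[<-|I0]; first exact: powR_ge0.
have It : 0 < I `^ theta by exact: powR_gt0.
(* Where [f] vanishes, the convention on inverses makes [w] zero. *)
pose w x : R := normc (f x) `^ (p - 1) / normc (f x) / I `^ theta.
pose h x : C := if normc (f x) <= N%:R then (w x)%:C * conjc (f x) else 0.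
have w0 x : 0 <= w x by rewrite !divr_ge0// powR_ge0.
have hN x : normc (h x) = (if normc (f x) <= N%:R then normc (f x) `^ (p - 1) else 0) / I `^ theta.
  rewrite /h; case: ifP => _; last by rewrite normc0 mul0r.
  rewrite normcM normc_conjc normc_real ger0_norm// /w.
  have [f00|fn0] := eqVneq (normc (f x)) 0.
    by rewrite f00 mulr0 powR0 ?mul0r// subr_eq0 gt_eqF.
  by rewrite mulrAC divfK.
have hb x : normc (h x) <= N%:R `^ (p - 1) / I `^ theta.
  rewrite hN ler_wpM2r ?invr_ge0 ?(ltW It)//; case: ifP => [le|_]; last exact: powR_ge0.
  by apply: ge0_ler_powR => //; rewrite ?nnegrE ?subr_ge0 ?(ltW p1).
have hr x : normc (h x) `^ r = I^-1 * u x.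
  rewrite hN /u; case: ifP => _; last by rewrite mul0r powR0 ?mulr0// gt_eqF// invr_gt0.
  rewrite powRM ?powR_ge0 ?invr_ge0 ?(ltW It)// -powRrM p1r mulrC; congr (_ * _).
  by rewrite -powRN -powRrM mulNr divff ?gt_eqF// powR_inv1// ltW.
have h1 : (\int[mu]_x ((normc (h x)) `^ r)%:E <= 1)%E.
  under eq_integral do rewrite hr.
  rewrite -EFin_Rintegral//; last exact: rintegrableZ.
  by rewrite RintZ// -/I mulVf ?gt_eqF.
have pe : pair h f = (I `^ (p^-1))%:C.
  have -> : pair h f = cint mu setT (fun x => ((I `^ theta)^-1)%:C * (u x)%:C).
    apply: cint_eq => x _; rewrite /h /u; case: ifP => _; last by rewrite mul0r mulr0.
    rewrite -mulrA mulcJ_normc -!rmorphM; congr (_%:C); rewrite /w.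
    have [f00|fn0] := eqVneq (normc (f x)) 0.
      by rewrite f00 !expr0n mulr0 powR0 ?mulr0// gt_eqF.
    have fpos : 0 < normc (f x) by rewrite lt_neqAle eq_sym fn0 f0.
    rewrite -(mulr_powRB1 (f0 x) p0); field.
    by rewrite fn0 gt_eqF.
  have uc : cintegrable mu (fun x => (u x)%:C).
    by apply: (cintegrable_le mall (v := u)) => // x; rewrite normc_real ger0_norm.
  rewrite cintZ//.
  have -> : cint mu setT (fun x => (u x)%:C) = I%:C.
    rewrite /cint /= -/I (_ : \int[mu]_(x in setT) 0 = 0)//.
    by rewrite Rint_cst// mul0r.
  rewrite -rmorphM; congr (_%:C).
  rewrite p_theta powRB ?(gt_eqF I0) ?implybT// powRr1 ?(ltW I0)//.
  by rewrite mulrC.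
have := H h _ hb h1; rewrite pe normc_real ger0_norm ?powR_ge0// => le.
have -> : I = (I `^ p^-1) `^ p by rewrite -powRrM mulVf ?gt_eqF// powRr1// ltW.
by apply: ge0_ler_powR => //; rewrite ?nnegrE ?powR_ge0// ltW.
Qed.

(** The function [f] is not assumed to be in [L^p], so finiteness must come from the truncations:
    their integrals are bounded uniformly in [N] and increase to that of [f]. *)
Lemma duality_Lp (f : T -> C) (k : R) : 0 <= k ->
  (forall h (B : R), (forall x, normc (h x) <= B) ->
    (\int[mu]_x ((normc (h x)) `^ r)%:E <= 1)%E -> normc (pair h f) <= k) ->
  (Lpn p%:E f <= k%:E)%E.
Proof.
move=> k0 H; apply/(Lp_leP adj q alpha f p0 k0).
pose u (N : nat) x : R := if normc (f x) <= N%:R then normc (f x) `^ p else 0.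
have u0 N x : 0 <= u N x by rewrite /u; case: ifP => // _; exact: powR_ge0.
have uN N x : u N x <= N%:R `^ p.
  rewrite /u; case: ifP => [le|_]; last exact: powR_ge0.
  by apply: ge0_ler_powR => //; rewrite ?nnegrE ?normc_ge0// ltW.
have ui N : rintegrable mu (u N).
  by apply: (rintegrable_bounded mall mufin (k := N%:R `^ p)) => x; rewrite ger0_norm.
have lim x : limn (fun N => (u N x)%:E) = ((normc (f x)) `^ p)%:E.
  apply: cvg_lim => //.
  pose N0 := Num.bound (normc (f x)).
  have HN N : (N0 <= N)%N -> u N x = normc (f x) `^ p.
    move=> N0N; rewrite /u ifT// (le_trans (ltW (archi_boundP (normc_ge0 (f x)))))//.
    by rewrite ler_nat.
  apply: cvg_near_cst.
  by exists N0 => // N /= N0N; rewrite HN.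
have -> : (\int[mu]_x ((normc (f x)) `^ p)%:E = \int[mu]_x limn (fun N => (u N x)%:E))%E.
  by apply: eq_integral => x _; rewrite lim.
rewrite (@monotone_convergence _ _ _ mu setT measurableT (fun N x => (u N x)%:E))//.
- apply: lime_le.
    apply: ereal_nondecreasing_is_cvgn => N N' NN'.
    apply: ge0_le_integral => //; first by move=> x _; rewrite lee_fin.
    move=> x _; rewrite lee_fin /u; case: ifP => [le|_].
      by rewrite ifT// (le_trans le)// ler_nat.
    by case: ifP => // _; exact: powR_ge0.
  apply: nearW => N; rewrite -EFin_Rintegral// lee_fin.
  exact: duality_truncated.
- by move=> N x _; rewrite lee_fin.
- move=> x _ N N' NN'; rewrite lee_fin /u; case: ifP => [le|_].
    by rewrite ifT// (le_trans le)// ler_nat.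
  by case: ifP => // _; exact: powR_ge0.
Qed.

Lemma L1_BMO_sub_Lp : exists2 K : R, 0 < K & forall f : T -> C,
  fcarrier (complex_interpolation (L 1%E) BMO theta) f ->
  (Lpn p%:E f < +oo)%E /\
  (Lpn p%:E f <= K%:E * fnorm (complex_interpolation (L 1%E) BMO theta) f)%E.
Proof.
have [A [M [A1 M0 H]]] := cz_tree q2 htree o alpha1 r1.
pose K := pairing_const M.
have K0 : 0 < K by rewrite /K /pairing_const !addr_gt0// !mulr_gt0.
have cald0 F : (0 <= calderon_norm (L 1%E) BMO F)%E.
  apply: (@le_trans _ _ (maxe (fnorm (L 1%E) (F (0 +i* 0)%R)) (fnorm BMO (F (1 +i* 0)%R)))).
    by rewrite le_max; apply/orP; left; exact: Lnorm_ge0.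
  by apply: ereal_sup_ubound; exists 0.
have main F : calderon_space (L 1%E) BMO F ->
    (Lpn p%:E (F theta%:C) <= K%:E * calderon_norm (L 1%E) BMO F)%E.
  move=> FC; have [_ _ _ Ffin] := FC.
  have sE : calderon_norm (L 1%E) BMO F = (fine (calderon_norm (L 1%E) BMO F))%:E.
    by rewrite fineK// ge0_fin_numE.
  have s0 := fine_ge0 (cald0 F).
  set s := fine _ in sE s0; rewrite sE -EFinM mulrC.
  apply: duality_Lp; first by rewrite mulr_ge0// ltW.
  move=> h B hB /H[E [lab [b [c cz]]]].
  have A10 : 0 < A - 1 by rewrite subr_gt0.
  (* The Bernoulli inequality gives [B <= A ^+ j] from [J] on, so [cz_vanish] empties [E j]; the
     successor ensures the condition [0 < j] of [cz_vanish]. *)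
  pose J := (Num.bound (`|B| / (A - 1))).+1.
  have bernoulli j : 1 + j%:R * (A - 1) <= A ^+ j.
    elim: j => [|j ih]; first by rewrite mul0r addr0 expr0.
    rewrite exprS -natr1; have := mulr_ge0 (ler0n R j) (sqr_ge0 (A - 1)).
    have := ler_wpM2l (ltW (lt_trans ltr01 A1)) ih.
    set a := A ^+ j; set k := j%:R; move=> le1 le2; lra.
  have BJ j : (J <= j)%N -> B <= A ^+ j.
    move=> Jj; rewrite (le_trans (ler_norm _))//.
    have Bj : `|B| <= j%:R * (A - 1).
      rewrite -ler_pdivrMr//.
      have : `|B| / (A - 1) < (Num.bound (`|B| / (A - 1)))%:R.
        by rewrite archi_boundP// divr_ge0// ltW.
      by move=> /ltW/le_trans; apply; rewrite ler_nat ltnW.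
    by rewrite (le_trans Bj)// (le_trans _ (bernoulli j))// lerDr.
  have EJ j : (J <= j)%N -> E j = set0.
    move=> Jj; apply: (cz_vanish cz); first exact: leq_trans Jj.
    by move=> x; rewrite (le_trans (hB x))// BJ.
  apply: (pairing_bound q2 htree alpha1 A1 M0 r1 s0 cz EJ FC _ theta01).
    by rewrite sE.
  by rewrite mulVf// gt_eqF.
exists K => // f [F FC Ff]; split.
  rewrite -Ff (le_lt_trans (main F FC))//.
  have [_ _ _ Ffin] := FC.
  by rewrite lte_mul_pinfty// ?lee_fin ?(ltW K0).
rewrite -lee_pdivrMl//; apply: le_ereal_inf_tmp => _ [G [GC Gf] <-].
by rewrite lee_pdivrMl// -Gf; exact: main.
Qed.

End InterpolationIntoLp.

(** * Monotonicity of complex interpolation and the endpoint embeddings *)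

Section Embeddings.
Context {R : realType} {X : Type}.
Implicit Types (A B D : fspace R X).

Definition embeds A B := exists2 k : R, 0 < k & forall f, fcarrier A f ->
  fcarrier B f /\ (fnorm B f <= k%:E * fnorm A f)%E.

Lemma embeds_refl A : embeds A A.
Proof. by exists 1 => // f fA; rewrite mul1e. Qed.

Lemma embeds_trans A B D : embeds A B -> embeds B D -> embeds A D.
Proof.
move=> [k k0 H] [k' k'0 H']; exists (k' * k) => [|f /H[fB fBn]]; first exact: mulr_gt0.
have [fD fDn] := H' _ fB; split => //; rewrite EFinM -muleA (le_trans fDn)//.
by apply: lee_wpmul2l => //; rewrite lee_fin ltW.
Qed.

Lemma embeds_equiv A B : embeds A B -> embeds B A -> equiv_fspace A B.
Proof.
move=> [k k0 H] [k' k'0 H']; split.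
  by apply/seteqP; split => f => [/H[]|/H'[]].
exists k'^-1, k; split => //; first by rewrite invr_gt0.
move=> f fA; have [fB fBn] := H _ fA; have [_ fAn] := H' _ fB.
by rewrite fBn andbT lee_pdivrMl.
Qed.

Definition nonneg_fspace A := forall f, (0 <= fnorm A f)%E.

Lemma sum_fspace_ge0 A B : nonneg_fspace A -> nonneg_fspace B ->
  nonneg_fspace (sum_fspace A B).
Proof.
move=> A0 B0 f; apply: le_ereal_inf_tmp => _ [f0 [f1 [_ _ _ ->]]].
exact: adde_ge0.
Qed.

Lemma embeds_common A0 A1 B0 B1 : nonneg_fspace A0 -> nonneg_fspace A1 ->
  embeds A0 B0 -> embeds A1 B1 -> exists2 k : R, 0 < k &
  (forall f, fcarrier A0 f -> fcarrier B0 f /\ (fnorm B0 f <= k%:E * fnorm A0 f)%E) /\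
  (forall f, fcarrier A1 f -> fcarrier B1 f /\ (fnorm B1 f <= k%:E * fnorm A1 f)%E).
Proof.
move=> A00 A10 [k k0 H] [k' k'0 H'].
exists (k + k'); first exact: addr_gt0.
split=> f fA.
  have [fB le] := H _ fA; split => //; apply: (le_trans le).
  by apply: lee_wpmul2r => //; rewrite lee_fin lerDl ltW.
have [fB le] := H' _ fA; split => //; apply: (le_trans le).
by apply: lee_wpmul2r => //; rewrite lee_fin lerDr ltW.
Qed.

(** The same [F] serves for both couples, all spaces consisting of functions on [X]: a functional
    bounded on the larger sum space is bounded on the smaller one, so the weak conditions are
    inherited. *)
Lemma interpolation_embeds A0 A1 B0 B1 (theta : R) :
  nonneg_fspace A0 -> nonneg_fspace A1 -> nonneg_fspace B0 -> nonneg_fspace B1 ->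
  embeds A0 B0 -> embeds A1 B1 ->
  embeds (complex_interpolation A0 A1 theta) (complex_interpolation B0 B1 theta).
Proof.
move=> A00 A10 B00 B10 E0 E1; have [k k0 [H0 H1]] := embeds_common A00 A10 E0 E1.
have kk : (0 <= k%:E)%E by rewrite lee_fin ltW.
have sumAB f : fcarrier (sum_fspace A0 A1) f -> fcarrier (sum_fspace B0 B1) f.
  by move=> [f0 [f1 [/H0[f0B _] /H1[f1B _] ->]]]; exists f0, f1.
have sumn f : (fnorm (sum_fspace B0 B1) f <= k%:E * fnorm (sum_fspace A0 A1) f)%E.
  rewrite -lee_pdivrMl//; apply: le_ereal_inf_tmp => _ [f0 [f1 [f0A f1A fE ->]]].
  have [f0B n0] := H0 _ f0A; have [f1B n1] := H1 _ f1A.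
  rewrite lee_pdivrMl// ge0_muleDr//; apply: (@le_trans _ _ (fnorm B0 f0 + fnorm B1 f1)%E).
    by apply: ereal_inf_lbound; exists f0, f1.
  exact: leeD.
have cal F : calderon_space A0 A1 F -> calderon_space B0 B1 F /\
    (calderon_norm B0 B1 F <= k%:E * calderon_norm A0 A1 F)%E.
  move=> [Fs Fl Fe Ff].
  have le : (calderon_norm B0 B1 F <= k%:E * calderon_norm A0 A1 F)%E.
    apply: ge_ereal_sup => _ [t _ <-].
    have [/H0[_ n0] /H1[_ n1]] := Fe t.
    have ub : (maxe (fnorm A0 (F (0 +i* t)%R)) (fnorm A1 (F (1 +i* t)%R)) <=
        calderon_norm A0 A1 F)%E by apply: ereal_sup_ubound; exists t.
    rewrite ge_max; apply/andP; split.
      apply: (le_trans n0); apply: lee_wpmul2l => //; apply: le_trans ub.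
      by rewrite le_max lexx.
    apply: (le_trans n1); apply: lee_wpmul2l => //; apply: le_trans ub.
    by rewrite le_max lexx orbT.
  split => //; split.
  - by move=> z /Fs/sumAB.
  - move=> l [lin [K HK]]; apply: Fl; split.
      by move=> c f g /sumAB fB /sumAB gB; exact: lin.
    (* The absolute value is taken because [K] may be negative; [k] bounds the embedding of the sum
       spaces. *)
    exists (`|K| * k) => f fA; apply: (le_trans (HK _ (sumAB _ fA))).
    apply: (@le_trans _ _ (`|K|%:E * fnorm (sum_fspace B0 B1) f)%E).
      by apply: lee_wpmul2r; [exact: sum_fspace_ge0|rewrite lee_fin ler_norm].
    by rewrite EFinM -muleA; apply: lee_wpmul2l.
  - by move=> t; have [/H0[? _] /H1[? _]] := Fe t.
  - by apply: (le_lt_trans le); rewrite lte_mul_pinfty.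
exists k => // f [F FC Ff]; split.
  by exists F => //; have [] := cal _ FC.
rewrite -lee_pdivrMl//; apply: le_ereal_inf_tmp => _ [G [GC Gf] <-].
rewrite lee_pdivrMl//; have [GC' Gn] := cal _ GC; apply: le_trans Gn.
by apply: ereal_inf_lbound; exists G.
Qed.

End Embeddings.

Section EndpointEmbeddings.
Context {R : realType} {V : choiceType} (adj : rel V) (q : nat).
Hypothesis q2 : (1 < q)%N.
Hypothesis htree : homogeneous_tree adj q.
Variables (o : V) (alpha : R).
Hypothesis alpha1 : 1 < alpha.
Local Opaque gdist.
Local Notation T := (rooted o).
Local Notation mu := (@mu_alpha R V adj o q alpha).
Local Notation m A := (fine (mu A)).
Local Notation L r := (Lp_space adj o q alpha r).
Local Notation BMO := (BMO_space adj o q alpha).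
Local Notation H1 := (H1_space adj o q alpha).

Let mall (A : set T) : measurable A. Proof. by []. Qed.
Let mufin : (mu setT < +oo)%E. Proof. exact: mu_finite. Qed.

Lemma H1_embeds_L1 : embeds H1 (L 1%E).
Proof.
exists 1 => // f fH; split; first by case: fH.
by rewrite mul1e; exact: H1_sub_L1.
Qed.

Lemma Linfty_embeds_BMO : embeds (L +oo%E) BMO.
Proof.
have mT0 : 0 < m setT by exact: (mu_gt0T q2 htree).
(* The oscillation is at most [c + 2 * c] and the mean at most [2 * c * m setT], both factors 2
   coming from [normc_cint]. *)
exists (3 + 2 * m setT) => [|f /= ffin]; first by rewrite addr_gt0// mulr_gt0.
have n0 : (0 <= Lp_norm adj q alpha +oo f)%E by exact: Lnorm_ge0.
have nE : Lp_norm adj q alpha +oo f = (fine (Lp_norm adj q alpha +oo f))%:E.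
  by rewrite fineK// ge0_fin_numE.
set c := fine _ in nE.
have c0 : 0 <= c by exact: fine_ge0.
have fc : forall x, normc (f x) <= c.
  by apply/(Linfty_leP adj q2 alpha); rewrite nE.
have fi : cintegrable mu f by exact: (cintegrable_bounded mall mufin fc).
have int_le D : \int[mu]_(x in D) normc (f x) <= c * m D.
  rewrite -Rint_cst//; apply: Rint_le => //; exact: rintegrable_cst.
have cint_le D : normc (cint mu D f) <= 2 * c * m D.
  rewrite (le_trans (normc_cint mall _ fi))// -mulrA ler_wpM2l//.
have bound : (BMO_norm adj q alpha f <= ((3 + 2 * m setT) * c)%:E)%E.
  rewrite mulrDl EFinD; apply: leeD; last first.
    by rewrite lee_fin (le_trans (cint_le setT))// mulrAC.
  apply: ge_ereal_sup => _ [D Dd <-].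
  have mD : 0 < m D by exact: (dyadic_mu_gt0 q2 htree alpha1 Dd).
  have ale : normc (average adj q alpha D f) <= 2 * c.
    rewrite /average normcM normc_real ger0_norm ?invr_ge0 ?(ltW mD)//.
    by rewrite mulrC ler_pdivrMr//; exact: cint_le.
  rewrite /oscillation -EFin_Rintegral//; last first.
    exact: (cintegrable_sub_cst q2 htree alpha1).
  rewrite -EFinM lee_fin mulrC ler_pdivrMr// -Rint_cst//; apply: Rint_le => //.
  - exact: (cintegrable_sub_cst q2 htree alpha1).
  - exact: rintegrable_cst.
  - move=> x _; rewrite (le_trans (normcB _ _))//; have := fc x; lra.
split; last by rewrite nE -EFinM.
split; first exact/L1P.
by apply: (le_lt_trans bound); exact: ltry.
Qed.

Lemma Lp_nonneg r : nonneg_fspace (L r).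
Proof. by move=> f; exact: Lnorm_ge0. Qed.

End EndpointEmbeddings.


Theorem corollary1 (R : realType) (q : nat) (hq : (2 <= q)%N)
    (V : choiceType) (adj : rel V) (htree : homogeneous_tree adj q) (o : V)
    (alpha : R) (halpha : 1 < alpha)
    (theta : R) (htheta : 0 < theta < 1)
    (p : R) (hp : p^-1 = 1 - theta) :
  let L r := Lp_space adj o q alpha r in
  let H1 := H1_space adj o q alpha in
  let BMO := BMO_space adj o q alpha in
  [/\ equiv_fspace (complex_interpolation (L 1%E) BMO theta) (L p%:E),
      equiv_fspace (complex_interpolation H1 (L +oo%E) theta) (L p%:E) &
      equiv_fspace (complex_interpolation H1 BMO theta) (L p%:E)].
Proof.
have H1nn : nonneg_fspace (H1_space adj o q alpha) by move=> f; exact: H1_norm_ge0.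
have BMOnn : nonneg_fspace (BMO_space adj o q alpha).
  by move=> f; exact: BMO_norm_ge0.
have HL := H1_embeds_L1 hq htree o halpha.
have LB := Linfty_embeds_BMO hq htree o halpha.
have LpI : embeds (Lp_space adj o q alpha p%:E)
    (complex_interpolation (H1_space adj o q alpha) (Lp_space adj o q alpha +oo%E) theta).
  have [K K0 HK] := Lp_sub_H1_Linfty hq htree o halpha htheta hp.
  by exists K.
have ILp : embeds (complex_interpolation (Lp_space adj o q alpha 1%E)
    (BMO_space adj o q alpha) theta) (Lp_space adj o q alpha p%:E).
  have [K K0 HK] := L1_BMO_sub_Lp hq htree o halpha htheta hp.
  by exists K.
have I1 : embeds (complex_interpolation (H1_space adj o q alpha) (Lp_space adj o q alpha +oo%E) theta)
    (complex_interpolation (H1_space adj o q alpha) (BMO_space adj o q alpha) theta).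
  by apply: interpolation_embeds => //; [exact: Lp_nonneg|exact: embeds_refl].
have I2 : embeds (complex_interpolation (H1_space adj o q alpha) (BMO_space adj o q alpha) theta)
    (complex_interpolation (Lp_space adj o q alpha 1%E) (BMO_space adj o q alpha) theta).
  by apply: interpolation_embeds => //; [exact: Lp_nonneg|exact: embeds_refl].
(* The embeddings close up into a cycle through [L^p] and the three interpolation spaces; going
   along the cycle gives each of the six inclusions. *)
split; apply: embeds_equiv.
- exact: ILp.
- exact: embeds_trans LpI (embeds_trans I1 I2).
- exact: embeds_trans I1 (embeds_trans I2 ILp).
- exact: LpI.
- exact: embeds_trans I2 ILp.
- exact: embeds_trans LpI I1.
Qed.
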